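(* Let $r$ be a positive integer. The $K$-algebra $K\check{\mathscr{H}}_{r,2}$ is split semisimple, and the following is the list of its irreducible modules, with distinct members of the list being non-isomorphic: (1) $\check{M}_{\lambda,\mu} := \mathrm{Res}_{K\check{\mathscr{H}}_{r,2}}\, M_\lambda\otimes M_\mu$, one for each unordered pair $\{\lambda,\mu\}$ with $\lambda,\mu\in\mathscr{P}_{r,2}$, $\lambda\neq\mu$; (2) $S'\check{M}_\lambda$, one for each $\lambda\in\mathscr{P}'_{r,2}$; (3) $\check{\Lambda}^2\check{M}_\lambda$, one for each $\lambda\in\mathscr{P}'_{r,2}$; (4) the one-dimensional module $K\check{\epsilon}_+$. Moreover, the irreducible $K(\mathscr{H}_{r,2}\otimes\mathscr{H}_{r,2})$-modules $M_\lambda\otimes M_\mu$ ($\lambda,\mu\in\mathscr{P}_{r,2}$) decompose into $K\check{\mathscr{H}}_{r,2}$-irreducibles as $$M_\lambda\otimes M_\mu\cong \check{M}_{\lambda,\mu}\quad\text{if }\lambda\neq\mu,$$ $$M_\lambda\otimes M_\lambda\cong S'\check{M}_\lambda\oplus\check{\Lambda}^2\check{M}_\lambda\oplus K\check{\epsilon}_+ ,$$ where $S'\check{M}_\lambda$ and $\check{\Lambda}^2\check{M}_\lambda$ are zero when $\dim_K M_\lambda=1$.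
   Context: Let $\mathbf{A}=\mathbb{Z}[u,u^{-1}]$, $K=\mathbb{Q}(u)$, $[2]=u+u^{-1}$. $\mathscr{H}_r$ is the Hecke algebra of the symmetric group $\mathcal{S}_r$ (simple reflections $S=\{s_1,\dots,s_{r-1}\}$) over $\mathbf{A}$: free with basis $T_w$, $w\in\mathcal{S}_r$, with $T_vT_w=T_{vw}$ if $\ell(vw)=\ell(v)+\ell(w)$ and $(T_s-u)(T_s+u^{-1})=0$ for $s\in S$. Put $C'_s=T_s+u^{-1}$ and $C_s=T_s-u$ for $s\in S$. For $w\in \mathcal{S}_r$, $C_w$ is the unique element of $\mathscr{H}_r$ invariant under the bar involution ($\bar u=u^{-1}$, $\overline{T_w}=T_{w^{-1}}^{-1}$) and congruent to $T_w$ modulo $u\,\mathbb{Z}[u]\{T_x:x\in\mathcal{S}_r\}$. All modules are right modules. $K(-)$ denotes $K\otimes_{\mathbf A}(-)$. $K\mathscr{H}_r$ is split semisimple with irreducibles $M_\lambda$ indexed by partitions $\lambda\vdash r$ in the usual way ($M_{(r)}$ is the module $T_s\mapsto u$, $M_{(1^r)}$ is $T_s\mapsto -u^{-1}$; $M_\lambda$ deforms the Specht module of shape $\lambda$). The Temperley-Lieb algebra $\mathscr{H}_{r,2}$ is the quotient of $\mathscr{H}_r$ by the two-sided ideal spanned over $\mathbf A$ by the $C_w$ such that the RSK insertion tableau $P(w)$ has more than $2$ rows. The irreducibles of $K\mathscr{H}_{r,2}$ are the $M_\lambda$ with $\lambda\in\mathscr{P}_{r,2}$, where $\mathscr{P}_{r,2}$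 is the set of partitions of $r$ with at most two parts. $\mathscr{P}'_{r,2}\subseteq\mathscr{P}_{r,2}$ is the subset of those that are neither a single row nor a single column. The nonstandard Temperley-Lieb algebra $\check{\mathscr{H}}_{r,2}$ is the (unital) $\mathbf A$-subalgebra of $\mathscr{H}_{r,2}\otimes_{\mathbf A}\mathscr{H}_{r,2}$ generated by $\mathcal{P}_s=C'_s\otimes C'_s+C_s\otimes C_s$, $s\in S$. It is contained in the subalgebra fixed by the flip $\tau(a\otimes b)=b\otimes a$, so for each $\lambda \in \mathscr{P}_{r,2}$ the symmetric and exterior squares of $M_\lambda$ are $K\check{\mathscr{H}}_{r,2}$-submodules of $M_\lambda\otimes_K M_\lambda$, denoted $\check S^2\check M_\lambda$ and $\check\Lambda^2\check M_\lambda$. $K\check\epsilon_+$ is the one-dimensional module on which every $\mathcal{P}_s$ acts by $[2]^2$. $S'\check M_\lambda$: let $M_\lambda^\diamond=\mathrm{Hom}_K(M_\lambda,K)$ with right $\mathscr{H}_r$-action $\langle m,m'h\rangle=\langle m\,1^{\mathrm{op}}(h),m'\rangle$, where $1^{\mathrm{op}}$ is the anti-automorphism $T_w\mapsto T_{w^{-1}}$. One has $M_\lambda\cong M_\lambda^\diamond$ (an isomorphism unique up to scalar), and the evaluation pairing $\mathrm{tr}:M_\lambda\otimes M_\lambda\cong M_\lambda\otimes M_\lambda^\diamond\to K\check\epsilon_+$ is a $K\check{\mathscr H}_{r,2}$-module homomorphism. Define $S'\check M_\lambda:=\ker(\mathrm{tr})\cap\check S^2\check M_\lambda$. *)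

(* Defs.v *)
From HB Require Import structures.
From mathcomp Require Import all_boot all_order all_fingroup all_algebra all_field.
From mathcomp Require Import mxtens.

Set Implicit Arguments.
Unset Strict Implicit.
Unset Printing Implicit Defensive.

Import GRing.Theory.
Local Open Scope ring_scope.

(* Tensor product of two finite-dimensional algebras: the entry (i, j) is the
   coefficient of the tensor product of the i-th and j-th basis vectors. *)

Section TensorAlgebra.
Variables (F : fieldType) (A B : falgType F).

Definition tens_alg : Type := 'M[F]_(\dim {:A}, \dim {:B}).

HB.instance Definition _ := Vector.copy tens_alg 'M[F]_(\dim {:A}, \dim {:B}).

Definition tens (a : A) (b : B) : tens_alg :=
  \matrix_(i, j) (coord (vbasis {:A}) i a * coord (vbasis {:B}) j b).

(* The linear map on tens_alg induced by a bilinear map f. *)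
Definition tens_lift (V : lmodType F) (f : A -> B -> V) (x : tens_alg) : V :=
  \sum_i \sum_j x i j *: f (vbasis {:A})`_i (vbasis {:B})`_j.

Definition tens_mul (x y : tens_alg) : tens_alg :=
  tens_lift (fun a b => tens_lift (fun c d => tens (a * c) (b * d)) y) x.

Fact tens_is_linear_l b : linear (tens^~ b).
Proof.
by move=> k x y; apply/matrixP => i j; rewrite !mxE linearP mulrDl -mulrA.
Qed.

Fact tens_is_linear_r a : linear (tens a).
Proof.
move=> k x y; apply/matrixP => i j; rewrite !mxE linearP mulrDr /=.
by rewrite mulrCA.
Qed.

HB.instance Definition _ a :=
  GRing.isLinear.Build F B tens_alg _ (tens a) (tens_is_linear_r a).

Fact tens_lift_is_linear (V : lmodType F) (f : A -> B -> V) :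
  linear (tens_lift f).
Proof.
move=> k x y; rewrite /tens_lift scaler_sumr -big_split; apply: eq_bigr => i _.
rewrite scaler_sumr -big_split; apply: eq_bigr => j _ /=.
by rewrite !mxE scalerDl scalerA.
Qed.

HB.instance Definition _ (V : lmodType F) (f : A -> B -> V) :=
  GRing.isLinear.Build F tens_alg V _ (tens_lift f) (tens_lift_is_linear f).

Lemma eq_tens_lift (V : lmodType F) (f g : A -> B -> V) :
  f =2 g -> tens_lift f =1 tens_lift g.
Proof.
by move=> e x; apply: eq_bigr => i _; apply: eq_bigr => j _; rewrite e.
Qed.

Lemma tens_lift_tens (V : lmodType F) (f : A -> B -> V) :
    (forall b, linear (f^~ b)) -> (forall a, linear (f a)) ->
  forall a b, tens_lift f (tens a b) = f a b.
Proof.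
move=> fl fr a b.
pose l b' : {linear A -> V} :=
  HB.pack (f^~ b') (GRing.isLinear.Build F A V _ (f^~ b') (fl b')).
pose r a' : {linear B -> V} :=
  HB.pack (f a') (GRing.isLinear.Build F B V _ (f a') (fr a')).
rewrite -[RHS]/(l b a) [in RHS](coord_vbasis (memvf a)) linear_sum.
apply: eq_bigr => i _; rewrite linearZ /=.
rewrite -[f _ b]/(r _ b) [in RHS](coord_vbasis (memvf b)) linear_sum scaler_sumr.
by apply: eq_bigr => j _; rewrite linearZ /= scalerA mxE.
Qed.

Definition tens_entry i j (x : tens_alg) : F^o := x i j.

Fact tens_entry_is_linear i j : linear (tens_entry i j).
Proof. by move=> k x y; rewrite /tens_entry !mxE. Qed.

HB.instance Definition _ i j := GRing.isLinear.Build F tens_alg F^o _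
  (tens_entry i j) (tens_entry_is_linear i j).

Lemma tens_sum x : tens_lift tens x = x.
Proof.
apply/matrixP => k l; rewrite -[LHS]/(tens_entry k l _) linear_sum.
rewrite (bigD1 k) //= [X in _ + X]big1 => [|i ik]; rewrite linear_sum.
  rewrite (bigD1 l) //= [X in _ + X + _]big1 => [|j jl]; rewrite linearZ /= /tens_entry mxE.
    rewrite !coord_free ?(basis_free (vbasisP _)) // !eqxx mulr1 !addr0.
    exact: mulr1.
  rewrite !coord_free ?(basis_free (vbasisP _)) // (negPf jl) mulr0.
  exact: mulr0.
rewrite big1 // => j _; rewrite linearZ /= /tens_entry mxE.
rewrite !coord_free ?(basis_free (vbasisP _)) // (negPf ik) mul0r.
exact: mulr0.
Qed.

Lemma tens_ind (P : tens_alg -> Prop) :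
    P 0 -> (forall k x y, P x -> P y -> P (k *: x + y)) ->
    (forall a b, P (tens a b)) ->
  forall x, P x.
Proof.
move=> P0 PD Pt x; rewrite -(tens_sum x).
have PS (I : finType) (G : I -> tens_alg) : (forall i, P (G i)) -> P (\sum_i G i).
  by move=> PG; elim/big_ind: _ => // y z Py Pz; rewrite -[y]scale1r; apply: PD.
apply: (PS) => i; apply: (PS) => j; rewrite -[_ *: _]addr0; exact: PD.
Qed.

Fact tens_mul_linear_l y : linear (tens_mul^~ y).
Proof. by move=> k x x'; rewrite /tens_mul linearP. Qed.

Fact tens_mul_linear_r x : linear (tens_mul x).
Proof.
move=> k y y'; rewrite /tens_mul.
rewrite [tens_lift _ x](@eq_tens_lift _ _ (fun a b =>
   k *: tens_lift (fun c d => tens (a * c) (b * d)) y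
   + tens_lift (fun c d => tens (a * c) (b * d)) y')); last first.
  by move=> a b; rewrite linearP.
rewrite /tens_lift scaler_sumr -big_split; apply: eq_bigr => i _ /=.
rewrite scaler_sumr -big_split; apply: eq_bigr => j _ /=.
by rewrite scalerDr !scalerA [k * _]mulrC.
Qed.

Lemma tens_mulE a b c d : tens_mul (tens a b) (tens c d) = tens (a * c) (b * d).
Proof.
rewrite /tens_mul (@eq_tens_lift _ _ (fun a b => tens (a * c) (b * d))).
  rewrite tens_lift_tens // => [b' k x y|a' k x y].
    by rewrite mulrDl -scalerAl tens_is_linear_l.
  by rewrite mulrDl -scalerAl linearP.
move=> a' b'; rewrite tens_lift_tens // => [d' k x y|c' k x y].
  by rewrite mulrDr -scalerAr tens_is_linear_l.
by rewrite mulrDr -scalerAr linearP.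
Qed.

Lemma tens_mul0l y : tens_mul 0 y = 0.
Proof. by rewrite -[0 in LHS](addNr 0) -scaleN1r tens_mul_linear_l scaleN1r addNr. Qed.
Lemma tens_mul0r x : tens_mul x 0 = 0.
Proof. by rewrite -[0 in LHS](addNr 0) -scaleN1r tens_mul_linear_r scaleN1r addNr. Qed.

Fact tens_mulA : associative tens_mul.
Proof.
move=> x y z; elim/tens_ind: x => [|k x x' IH IH'|a b].
- by rewrite !tens_mul0l.
- by rewrite !tens_mul_linear_l IH IH'.
elim/tens_ind: y => [|k y y' IH IH'|c d].
- by rewrite !(tens_mul0l, tens_mul0r).
- by rewrite !(tens_mul_linear_l, tens_mul_linear_r) IH IH'.
elim/tens_ind: z => [|k z z' IH IH'|e f].
- by rewrite !(tens_mul0l, tens_mul0r).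
- by rewrite !(tens_mul_linear_l, tens_mul_linear_r) IH IH'.
by rewrite !tens_mulE !mulrA.
Qed.

Fact tens_mul1l : left_id (tens 1 1) tens_mul.
Proof.
move=> x; elim/tens_ind: x => [|k x x' IH IH'|a b]; first by rewrite tens_mul0r.
  by rewrite tens_mul_linear_r IH IH'.
by rewrite tens_mulE !mul1r.
Qed.

Fact tens_mul1r : right_id (tens 1 1) tens_mul.
Proof.
move=> x; elim/tens_ind: x => [|k x x' IH IH'|a b]; first by rewrite tens_mul0l.
  by rewrite tens_mul_linear_l IH IH'.
by rewrite tens_mulE !mulr1.
Qed.

Fact tens_mulDl : left_distributive tens_mul +%R.
Proof.
by move=> x y z; rewrite -[x]scale1r tens_mul_linear_l !scale1r.
Qed.

Fact tens_mulDr : right_distributive tens_mul +%R.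
Proof.
by move=> x y z; rewrite -[y]scale1r tens_mul_linear_r !scale1r.
Qed.

Fact tens1_neq0 : tens 1 1 != 0.
Proof.
apply/eqP => t0; have /negP[] := oner_neq0 A; apply/eqP.
rewrite [LHS](coord_vbasis (memvf _)) big1 // => i _.
have [j nz] : exists j, coord (vbasis {:B}) j 1 != 0.
  apply/existsP; apply: contraT; rewrite negb_exists => /forallP z.
  have /negP[] := oner_neq0 B; apply/eqP.
  rewrite [LHS](coord_vbasis (memvf _)) big1 // => j _.
  by move: (z j); rewrite negbK => /eqP ->; rewrite scale0r.
move/matrixP/(_ i j): t0; rewrite !mxE => /eqP.
by rewrite mulf_eq0 (negPf nz) orbF => /eqP ->; rewrite scale0r.
Qed.

HB.instance Definition _ := GRing.Zmodule_isNzRing.Build tens_alg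
  tens_mulA tens_mul1l tens_mul1r tens_mulDl tens_mulDr tens1_neq0.

Fact tens_scaleAl (k : F) (x y : tens_alg) : k *: (x * y) = (k *: x) * y.
Proof.
by rewrite -[k *: x]addr0 [RHS]tens_mul_linear_l tens_mul0l addr0.
Qed.

HB.instance Definition _ :=
  GRing.Lmodule_isLalgebra.Build F tens_alg tens_scaleAl.

Fact tens_scaleAr (k : F) (x y : tens_alg) : k *: (x * y) = x * (k *: y).
Proof.
by rewrite -[k *: y]addr0 [RHS]tens_mul_linear_r tens_mul0r addr0.
Qed.

HB.instance Definition _ :=
  GRing.Lalgebra_isAlgebra.Build F tens_alg tens_scaleAr.

HB.instance Definition _ := Algebra_isFalgebra.Build F tens_alg.

Lemma tensM a b c d : tens a b * tens c d = tens (a * c) (b * d).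
Proof. exact: tens_mulE. Qed.

End TensorAlgebra.

(* Finite-dimensional right modules over an algebra, as matrices acting on row
   vectors.  The record is only the raw data; [is_module] states the axioms. *)

Section Modules.
Variables (F : fieldType) (B : falgType F).

Record rmodule := RModule { mdim : nat; mact :> B -> 'M[F]_mdim }.

Definition is_module (V : rmodule) : Prop :=
  [/\ linear (mact V), V 1 = 1%:M & forall x y, V (x * y) = V x *m V y].

(* Submodules of V are row spaces of stable matrices. *)
Definition is_submod (V : rmodule) m (U : 'M[F]_(m, mdim V)) : Prop :=
  forall b, stablemx U (V b).

(* The action on the row space of U, in the coordinates of [row_base U]; it is
   meaningful only when [is_submod V U]. *)
Definition submod (V : rmodule) m (U : 'M[F]_(m, mdim V)) : rmodule :=
  RModule (fun b => row_base U *m V b *m pinvmx (row_base U)).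

Definition mod_iso_by (V W : rmodule) (P : 'M[F]_(mdim V, mdim W)) : Prop :=
  [/\ row_free P, row_full P & forall b, V b *m P = P *m W b].

Definition mod_iso (V W : rmodule) : Prop := exists P, @mod_iso_by V W P.

Definition mod_irr (V : rmodule) : Prop :=
  [/\ is_module V, (0 < mdim V)%N
    & forall U : 'M_(mdim V), is_submod U -> U = 0 \/ row_full U].

Definition dsum (V W : rmodule) : rmodule :=
  RModule (fun b => block_mx (V b) 0 0 (W b)).

Definition semisimple : Prop :=
  forall V, is_module V -> forall U : 'M_(mdim V), is_submod U ->
  exists U' : 'M_(mdim V),
    [/\ is_submod U', (U :&: U' = 0)%MS & row_full (U + U')%MS].

(* Semisimple, and every irreducible module has only scalar endomorphisms. *)
Definition split_semisimple : Prop :=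
  semisimple /\
  forall V, mod_irr V ->
  forall X : 'M_(mdim V), (forall b, V b *m X = X *m V b) -> is_scalar_mx X.

End Modules.

Definition pullback (F : fieldType) (A B : falgType F) (f : A -> B)
  (V : rmodule B) : rmodule A := RModule (fun a => V (f a)).

(* The outer tensor product of V and W. *)
Definition tens_mod (F : fieldType) (A B : falgType F)
  (V : rmodule A) (W : rmodule B) : rmodule (tens_alg A B) :=
  RModule (tens_lift (fun a b => V a *t W b)).

(* The map e_i (x) e_j |-> e_j (x) e_i. *)
Definition flip_mx (F : fieldType) d : 'M[F]_(d * d) :=
  \matrix_(a, b)
    (((mxtens_unindex a).1 == (mxtens_unindex b).2) &&
     ((mxtens_unindex a).2 == (mxtens_unindex b).1))%:R.

Definition sym2 (F : fieldType) d : 'M[F]_(d * d) := kermx (flip_mx F d - 1%:M).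
Definition ext2 (F : fieldType) d : 'M[F]_(d * d) := kermx (flip_mx F d + 1%:M).

(* The ground field Q(u) and its bar automorphism u |-> u^-1. *)

Definition K : fieldType := {fraction {poly rat}}.
Definition u : K := tofrac 'X.

Definition barK (a : K) : K :=
  let q : {ratio {poly rat}} := generic_quotient.repr a in
  (map_poly ratr \n_q).[u^-1] / (map_poly ratr \d_q).[u^-1].

Definition in_laurent (a : K) : Prop :=
  exists (p : {poly int}) (m : nat), a = (map_poly intr p).[u] / u ^+ m.

Definition in_uZu (a : K) : Prop :=
  exists p : {poly int}, a = u * (map_poly intr p).[u].

(* The symmetric group S_r with r = n.+1. *)

Definition simple n (i : 'I_n) : 'S_n.+1 :=
  tperm (widen_ord (leqnSn n) i) (lift ord0 i).

Definition len n (w : 'S_n) : nat :=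
  #|[set p : 'I_n * 'I_n | (p.1 < p.2)%N && (w p.2 < w p.1)%N]|.

(* Schensted row insertion into a row, returning the bumped entry if any. *)
Fixpoint row_insert (x : nat) (R : seq nat) : seq nat * option nat :=
  if R is y :: R' then
    if (x < y)%N then (x :: R', Some y)
    else let: (R'', b) := row_insert x R' in (y :: R'', b)
  else ([:: x], None).

Fixpoint rsk_insert (x : nat) (P : seq (seq nat)) : seq (seq nat) :=
  if P is R :: P' then
    let: (R', b) := row_insert x R in
    R' :: (if b is Some y then rsk_insert y P' else P')
  else [:: [:: x]].

(* The insertion tableau, as the sequence of its rows. *)
Definition rsk_P n (w : 'S_n) : seq (seq nat) :=
  foldl (fun P x => rsk_insert x P) [::] [seq val (w i) | i <- enum 'I_n].

(* The Hecke algebra over K, given by its standard basis T.  Its integral form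
   is the lattice of elements whose coordinates satisfy [in_laurent]. *)

Section Hecke.
Variables (n : nat) (H : falgType K) (T : 'S_n.+1 -> H).

Definition is_hecke : Prop :=
  [/\ basis_of fullv (codom T),
      forall v w, len (v * w)%g = (len v + len w)%N -> T v * T w = T (v * w)%g
    & forall i, (T (simple i) - u%:A) * (T (simple i) + u^-1%:A) = 0].

Definition hcoord (w : 'S_n.+1) (h : H) : K :=
  coord (codom_tuple T) (enum_rank w) h.

Definition hbar (h : H) : H := \sum_w barK (hcoord w h) *: (T w^-1%g)^-1.

Definition hop (h : H) : H := \sum_w hcoord w h *: T w^-1%g.

(* c is the element C_w of the canonical basis. *)
Definition is_kl (w : 'S_n.+1) (c : H) : Prop :=
  hbar c = c /\ forall x, in_uZu (hcoord x c - (x == w)%:R).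

(* The contragredient module, in the dual basis. *)
Definition dual (V : rmodule H) : rmodule H := RModule (fun h => (V (hop h))^T).

End Hecke.

Definition is_part (r : nat) (lam : seq nat) : bool :=
  [&& sorted geq lam, 0%N \notin lam & sumn lam == r].

Definition part2 (r : nat) (lam : seq nat) : bool :=
  is_part r lam && (size lam <= 2)%N.

Definition part2' (r : nat) (lam : seq nat) : bool :=
  [&& part2 r lam, size lam != 1%N & ~~ all (pred1 1%N) lam].

(* Hoefsmit's seminormal form of M_lam; at u = 1 it becomes Young's seminormal
   form of the Specht module.  A tableau sends each entry to its cell
   (row, column), all indices starting from 0. *)

Definition standard n (lam : seq nat) (t : {ffun 'I_n -> 'I_n * 'I_n}) : bool :=
  [&& injectiveb t,
      [forall k, (t k).2 < nth 0 lam (t k).1]%N,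
      [forall k, forall l,
         ((t k).1 == (t l).1) && ((t k).2 < (t l).2)%N ==> (k < l)%N]
    & [forall k, forall l,
         ((t k).2 == (t l).2) && ((t k).1 < (t l).1)%N ==> (k < l)%N]].

Definition SYT n (lam : seq nat) : {set {ffun 'I_n.+1 -> 'I_n.+1 * 'I_n.+1}} :=
  [set t | standard lam t].

Definition content n (t : {ffun 'I_n -> 'I_n * 'I_n}) (k : 'I_n) : int :=
  ((t k).2 : nat)%:Z - ((t k).1 : nat)%:Z.

Definition seminormal n (lam : seq nat) (i : 'I_n) : 'M[K]_#|SYT n lam| :=
  \matrix_(a, b)
    let t := enum_val a in
    let d := content t (widen_ord (leqnSn n) i) - content t (lift ord0 i) in
    let c := (u - u^-1) / (1 - u ^ (2 * d)) in
    if b == a then c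
    else if enum_val b == [ffun k => t (simple i k)] then u^-1 + c
    else 0.

(* The nonstandard Temperley-Lieb algebra; t i is the image of T_{s_i} in the
   Temperley-Lieb algebra H2. *)

Section Nonstandard.
Variables (n : nat) (H2 : falgType K) (t : 'I_n -> H2).

Definition nsgen (i : 'I_n) : tens_alg H2 H2 :=
  tens (t i + u^-1%:A) (t i + u^-1%:A) + tens (t i - u%:A) (t i - u%:A).

(* K tensored with the integral form [nsTL_int] below; see [nsTLP]. *)
Definition nsTL : {aspace tens_alg H2 H2} :=
  <<<<[seq nsgen i | i <- enum 'I_n]>>%VS>>%AS.

Inductive nsTL_int : tens_alg H2 H2 -> Prop :=
| NsGen i : nsTL_int (nsgen i)
| NsOne : nsTL_int 1
| NsAdd x y : nsTL_int x -> nsTL_int y -> nsTL_int (x + y)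
| NsMul x y : nsTL_int x -> nsTL_int y -> nsTL_int (x * y)
| NsScale a x : in_laurent a -> nsTL_int x -> nsTL_int (a *: x).

Lemma nsTLP x :
  x \in nsTL <->
  exists s : seq (K * tens_alg H2 H2),
    (forall y, y \in s -> nsTL_int y.2) /\ x = \sum_(y <- s) y.1 *: y.2.
Proof.
pose S z := exists s : seq (K * tens_alg H2 H2),
  (forall y, y \in s -> nsTL_int y.2) /\ z = \sum_(y <- s) y.1 *: y.2.
have SI z : nsTL_int z -> S z.
  move=> Iz; exists [:: (1, z)]; split=> [y|]; first by rewrite inE => /eqP ->.
  by rewrite big_seq1 scale1r.
have SD y z : S y -> S z -> S (y + z).
  move=> [s [Is ->]] [s' [Is' ->]]; exists (s ++ s'); rewrite big_cat; split=> // w.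
  by rewrite mem_cat => /orP[/Is|/Is'].
have SM k y z : S y -> S z -> S (k *: (y * z)).
  move=> [s [Is ->]] [s' [Is' ->]].
  exists [seq (k * (p.1 * q.1), p.2 * q.2) | p <- s, q <- s'].
  split=> [_ /allpairsP[[p q] /= [/Is Ip /Is' Iq ->]]|]; first exact: NsMul.
  rewrite big_allpairs_dep mulr_suml scaler_sumr; apply: eq_bigr => p _ /=.
  rewrite mulr_sumr scaler_sumr; apply: eq_bigr => q _ /=.
  by rewrite -scalerAl -scalerAr !scalerA mulrA.
have SZ k z : S z -> S (k *: z).
  by move=> Sz; rewrite -[z]mul1r; apply: SM => //; apply/SI/NsOne.
have S0 : S 0 by exists [::]; rewrite big_nil.
have SX X z : (forall y, y \in X -> S y) -> z \in <<X>>%VS -> S z.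
  move=> SX zX; rewrite (@coord_span _ _ _ (in_tuple X) z zX).
  by elim/big_ind: _ => // i _; apply/SZ/SX/mem_nth.
rewrite -/(S x); split; last first.
  move=> [s [Is ->]]; rewrite big_seq; apply: memv_suml => y /Is Iy.
  apply: memvZ; elim: Iy => [i||y' z _ Hy _ Hz|y' z _ Hy _ Hz|k z _ _ Hz].
  - by apply/(subvP (sub_agenv _))/memv_span/map_f; rewrite mem_enum.
  - by rewrite memvE sub1_agenv.
  - exact: memvD.
  - exact: memvM.
  - exact: memvZ.
move/memv_sumP => [v Iv ->]; elim/big_ind: _ => // i _; move: (v i) (Iv i isT).
elim: (i : nat) => [|m IH] z {v Iv}.
  by rewrite expv0 => /vlineP[k ->]; apply/SZ/SI/NsOne.
rewrite expvSl unlock; apply: (SX) => _ /allpairsP[[p q] /= [pU qU ->]].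
rewrite -[_ * _]scale1r; apply: (SM); last exact/IH/vbasis_mem.
apply: (SX) (vbasis_mem pU) => _ /mapP[j _ ->]; exact/SI/NsGen.
Qed.

Definition nsP (i : 'I_n) : subvs_of nsTL := vsproj nsTL (nsgen i).

Definition is_eps_plus (E : rmodule (subvs_of nsTL)) : Prop :=
  [/\ is_module E, mdim E = 1%N & forall i, E (nsP i) = ((u + u^-1) ^+ 2)%:M].

Definition nsres (V : rmodule (tens_alg H2 H2)) : rmodule (subvs_of nsTL) :=
  pullback vsval V.

Variables (M : seq nat -> rmodule H2) (Phi : forall lam, 'M[K]_(mdim (M lam))).

(* The linear form m (x) m' |-> <m, Phi m'>, as a column vector. *)
Definition tr_form lam : 'cV[K]_(mdim (M lam) * mdim (M lam)) :=
  \col_k Phi lam (mxtens_unindex k).2 (mxtens_unindex k).1.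

Definition Mtens lam mu : rmodule (subvs_of nsTL) :=
  nsres (tens_mod (M lam) (M mu)).

Definition Sprime_space lam : 'M[K]_(mdim (M lam) * mdim (M lam)) :=
  (kermx (tr_form lam) :&: sym2 K (mdim (M lam)))%MS.

Definition Sprime lam : rmodule (subvs_of nsTL) :=
  @submod _ _ (Mtens lam lam) _ (Sprime_space lam).

Definition Ext2 lam : rmodule (subvs_of nsTL) :=
  @submod _ _ (Mtens lam lam) _ (ext2 K (mdim (M lam))).

(* The list of irreducibles; [Mixed lam mu] and [Mixed mu lam] are the same
   member, indexed by an unordered pair. *)
Inductive label :=
  Mixed of seq nat & seq nat | Sym of seq nat | Ext of seq nat | Eps.

Definition label_ok (l : label) : bool :=
  match l with
  | Mixed lam mu => [&& part2 n.+1 lam, part2 n.+1 mu & lam != mu]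
  | Sym lam | Ext lam => part2' n.+1 lam
  | Eps => true
  end.

Definition same_label (l l' : label) : Prop :=
  l = l' \/ exists lam mu, l = Mixed lam mu /\ l' = Mixed mu lam.

Definition ns_irr (E : rmodule (subvs_of nsTL)) (l : label) :=
  match l with
  | Mixed lam mu => Mtens lam mu
  | Sym lam => Sprime lam
  | Ext lam => Ext2 lam
  | Eps => E
  end.

End Nonstandard.

Arguments tr_form {H2} M Phi lam.
Arguments Sprime_space {H2} M Phi lam.
Arguments Sprime {n H2} t M Phi lam.
Arguments ns_irr {n H2} t M Phi E l.

(* Main.v *)
(** Two-row standard tableaux are ballot words, and the seminormal form gives the
    action of T_s on them.  Rescaling T_s to an involution R_s turns P_s into
    [2]^2/2 (1 + R_s (x) R_s), so the nonstandard algebra is generated by the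
    R_s (x) R_s.  By induction on r it contains J (x) 1 + 1 (x) J for each J that is
    skew for the invariant form of the M_lam: on a suitable subspace a product of
    generators is a rotation G (x) G with infinitesimal generator J.  Polynomials in
    these elements give the sign changes x_a = (1 - 2 E_aa) (x) (1 - 2 E_aa), and the
    x_a give all E_ac (x) E_bd + E_bd (x) E_ac with a <> b and c <> d.  Together these
    elements act on the proposed modules as the whole product of their matrix
    algebras.  The action is faithful because H_{r,2} embeds in the product of the
    End(M_lam): the R_s generate this product, and the dimension of H_{r,2} is at
    most the sum of the squares of the numbers of tableaux by RSK and the freeness
    of the C_w.  An algebra isomorphic to a product of matrix algebras is split
    semisimple with the expected list of irreducibles. *)

(* Over Q(u) no limit is available to differentiate a rotation, so its infinitesimal generator is
   isolated by linear algebra from G (x) G and its square. This dictates the conditions in [coefs]: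
   p, 2 p^2 - 1 and 4 p^2 - 1 must not vanish. Lie elements join only words of equal height, whereas
   M_lam (x) M_mu needs pairs of words of different heights; the signs x_a bridge the gap, being
   attached to a single word. Products x_a x_b are found before any single x_a, which then comes
   from averaging over all words. The averaging breaks down for 2 or 4 words; of these only 2
   occurs, at length 2, where the signs are R and -R. One system of matrix units covers all shapes
   at once, so that removing the last letter of a word is the branching rule from r to r - 1. The
   weights [gam] make the seminormal form self-adjoint without square roots. On M_lam (x) M_lam the
   symmetrized matrix units miss the tensors e_a (x) e_a; Leibniz elements reach these, apart from
   the invariant line, which carries K eps_+. *)
Require Import Defs.
From HB Require Import structures.
From mathcomp Require Import all_boot all_order all_fingroup all_algebra all_field.
From mathcomp Require Import mxtens zify ring.

Set Implicit Arguments.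
Unset Strict Implicit.
Unset Printing Implicit Defensive.

Import GRing.Theory.
Local Open Scope ring_scope.

(** * Ballot words *)

(* A word lists the rows of the entries of a two-row standard tableau, the last
   entry first; [true] stands for the second row. *)
Definition word := seq bool.

(** The difference of the two row lengths; together with the length it determines the shape. On
    ballot words the truncation of [.-1] never acts. *)
Fixpoint ht (w : word) : nat :=
  if w is x :: w' then (if x then (ht w').-1 else (ht w').+1) else 0.

Fixpoint ballot (w : word) : bool :=
  if w is x :: w' then ballot w' && (x ==> (0 < ht w'))%N else true.

(** Built by adding the last letter, so that a sum over [Om k.+1] splits along the branching rule,
    as in [big_Om]. *)
Fixpoint Om (k : nat) : seq word :=
  if k is k'.+1 then
    flatten [seq (false :: w) :: (if (0 < ht w)%N then [:: true :: w] else [::])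
            | w <- Om k']
  else [:: [::]].

Lemma mem_Om k w : (w \in Om k) = (size w == k) && ballot w.
Proof.
elim: k w => [|k IH] w; first by case: w.
apply/flatten_mapP/idP => [[w' w'k]|].
  move: w'k; rewrite IH inE => /andP[/eqP sw bw] /orP[/eqP ->|].
    by rewrite /= sw bw eqxx.
  by case: ifP => // h; rewrite inE => /eqP ->; rewrite /= sw bw h eqxx.
case: w => [|x w] //=; rewrite eqSS => /and3P[sw bw xw].
exists w; first by rewrite IH sw bw.
by case: x xw => /= [->|_]; rewrite !inE eqxx ?orbT.
Qed.

Lemma Om0 k w : (false :: w \in Om k.+1) = (w \in Om k).
Proof. by rewrite !mem_Om /= eqSS andbT. Qed.

Lemma Om1 k w : (true :: w \in Om k.+1) = (w \in Om k) && (0 < ht w)%N.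
Proof. by rewrite !mem_Om /= eqSS andbA. Qed.

Lemma Om_cons k x w : x :: w \in Om k.+1 -> w \in Om k.
Proof. by case: x; rewrite ?Om0 // Om1 => /andP[]. Qed.

Lemma Om_uniq k : uniq (Om k).
Proof.
elim: k => // k IH /=; elim: (Om k) IH => //= w s IHs /andP[ws us].
have notin x : x :: w \notin flatten [seq (false :: w) :: (if (0 < ht w)%N
    then [:: true :: w] else [::]) | w <- s].
  apply/flatten_mapP => -[w' w's]; rewrite inE => /orP[/eqP [_ e]|].
    by move: ws; rewrite e w's.
  by case: ifP => // _; rewrite inE => /eqP [_ e]; move: ws; rewrite e w's.
by case: ifP => _ /=; rewrite ?inE (negPf (notin _)) /= ?(negPf (notin _)) IHs.
Qed.

Lemma big_Om (V : nmodType) k (f : word -> V) :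
  \sum_(a <- Om k.+1) f a =
  \sum_(w <- Om k) (f (false :: w) + if (0 < ht w)%N then f (true :: w) else 0).
Proof.
rewrite big_flatten /= big_map; apply: eq_bigr => w _.
by rewrite big_cons; case: ifP; rewrite ?big_seq1 ?big_nil.
Qed.

Lemma ht_le k w : w \in Om k -> (ht w <= k)%N.
Proof.
elim: k w => [|k IH] [|x w]; rewrite ?mem_Om //= eqSS => /andP[sw /andP[bw _]].
have: (ht w <= k)%N by apply: IH; rewrite mem_Om sw bw.
by case: x => //= h; rewrite (leq_trans (leq_pred _)) // leqW.
Qed.

Lemma odd_ht k w : w \in Om k -> odd (ht w) = odd k.
Proof.
elim: k w => [|k IH] [|[] w]; rewrite ?mem_Om //= eqSS => /andP[sw /andP[bw h]];
  have e : odd (ht w) = odd k by apply: IH; rewrite mem_Om sw bw.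
- by move: h e => /=; case: (ht w) => //= m _ <-; rewrite negbK.
- by rewrite /= e.
Qed.

Lemma ex_word k h : (h <= k)%N -> odd h = odd k -> exists2 w, w \in Om k & ht w = h.
Proof.
elim: k h => [|k IH] h; first by case: h => //; exists [::].
case: h => [_ /= ok|h hk /= ok].
  have ok1 : odd k by rewrite -[odd k]negbK -ok.
  have k1 : (0 < k)%N by case: k ok1 {IH ok}.
  have [w wk hw] := IH 1%N k1 (esym ok1).
  by exists (true :: w); rewrite ?Om1 ?wk /= hw.
have [w wk hw] := IH h hk (negb_inj ok).
by exists (false :: w); rewrite ?Om0 //= hw.
Qed.

Lemma ht_max k w : w \in Om k -> ht w = k -> w = nseq k false.
Proof.
elim: k w => [|k IH] [|x w]; rewrite ?mem_Om // => xw; move: (xw).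
rewrite -mem_Om => /Om_cons wk; have := ht_le wk.
case: x xw => /= _ h; first by lia.
by case=> /(IH _ wk) ->.
Qed.

Lemma nseq_Om k : nseq k false \in Om k.
Proof. by elim: k => // k IH; rewrite -[nseq _ _]/(false :: nseq k false) Om0. Qed.

Lemma size_OmS k : (size (Om k) <= size (Om k.+1))%N.
Proof.
rewrite /= size_flatten /shape -map_comp sumnE big_map -sum1_size.
by apply: leq_sum => w _ /=.
Qed.

(** Sizes 2 and 4 are those at which the averaging in [sgn_single] degenerates. *)
Lemma size_Om_neq k : (2 < k)%N -> size (Om k) != 2%N /\ size (Om k) != 4%N.
Proof.
case: k => [|[|[|[|k]]]] // _.
have: (6 <= size (Om k.+4))%N.
  by elim: k => // k IH; apply: leq_trans IH (size_OmS _).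
by lia.
Qed.
Arguments Om _ : simpl never.

(** * Reflection for linear identities *)

Section LinearReflection.
Variables (F : pzRingType) (V : lmodType F).

Inductive lexp :=
  | LVar of nat | LAdd of lexp & lexp | LOpp of lexp | LScale of F & lexp | LZero.

Fixpoint leval (e : seq V) (m : lexp) : V :=
  match m with
  | LVar i => e`_i
  | LAdd a b => leval e a + leval e b
  | LOpp a => - leval e a
  | LScale c a => c *: leval e a
  | LZero => 0
  end.

Fixpoint lcoef (i : nat) (m : lexp) : F :=
  match m with
  | LVar j => if i == j then 1 else 0
  | LAdd a b => lcoef i a + lcoef i b
  | LOpp a => - lcoef i a
  | LScale c a => c * lcoef i a
  | LZero => 0
  end.

Lemma levalE e m : leval e m = \sum_(i < size e) lcoef i m *: e`_i.
Proof.
elim: m => [j|a IHa b IHb|a IHa|c a IHa|] /=; rewrite ?IHa ?IHb.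
- case: (ltnP j (size e)) => [js|js]; last first.
    rewrite nth_default // big1 // => i _; case: eqP => [ij|_]; last exact: scale0r.
    by move: (ltn_ord i); rewrite ij ltnNge js.
  rewrite (bigD1 (Ordinal js)) //= eqxx scale1r big1 ?addr0 // => i ij.
  by rewrite -[_ == j :> nat]/(i == Ordinal js) (negPf ij) scale0r.
- by rewrite -big_split; apply: eq_bigr => i _; rewrite scalerDl.
- by rewrite -sumrN; apply: eq_bigr => i _; rewrite scaleNr.
- by rewrite scaler_sumr; apply: eq_bigr => i _; rewrite scalerA.
- by rewrite big1 // => i _; rewrite scale0r.
Qed.

(** One scalar identity per atom, so that each can be closed by [ring] or [field] on its own. *)
Fixpoint lcoef_eq (n : nat) (a b : lexp) : Prop :=
  if n is n'.+1 then lcoef n' a = lcoef n' b /\ lcoef_eq n' a b else True.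

Lemma leval_eq e a b : lcoef_eq (size e) a b -> leval e a = leval e b.
Proof.
move=> eab; rewrite !levalE; apply: eq_bigr => -[i] /=.
elim: (size e) eab => // n IH [en /IH eab].
by rewrite ltnS leq_eqVlt => /orP[/eqP ->|/eab //]; rewrite en.
Qed.

End LinearReflection.

(* Atoms are compared up to conversion: the same product may be displayed
   through different structures. *)
Ltac lin_mem x l :=
  lazymatch l with
  | nil => constr:(false)
  | ?y :: ?l' =>
    match goal with
    | _ => let _ := match goal with _ => unify x y end in constr:(true)
    | _ => lin_mem x l'
    end
  end.
Ltac lin_atoms e l :=
  lazymatch e with
  | ?a + ?b => let l := lin_atoms a l in lin_atoms b l
  | - ?a => lin_atoms a l
  | ?c *: ?a => lin_atoms a l
  | 0 => l
  | _ => lazymatch lin_mem e l with true => l | false => constr:(e :: l) end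
  end.
Ltac lin_index x l :=
  lazymatch l with
  | ?y :: ?l' =>
    match goal with
    | _ => let _ := match goal with _ => unify x y end in constr:(0%N)
    | _ => let n := lin_index x l' in constr:(n.+1)
    end
  end.
Ltac lin_reify F e l :=
  lazymatch e with
  | ?a + ?b => let a := lin_reify F a l in let b := lin_reify F b l in
               constr:(@LAdd F a b)
  | - ?a => let a := lin_reify F a l in constr:(@LOpp F a)
  | ?c *: ?a => let a := lin_reify F a l in constr:(@LScale F c a)
  | 0 => constr:(@LZero F)
  | _ => let n := lin_index e l in constr:(@LVar F n)
  end.
(* Reduces a linear identity over the scalars F to the identities between the
   coefficients of its atoms. *)
Ltac linear_over F :=
  lazymatch goal with
  | |- @eq ?V ?x ?y =>
    let l := lin_atoms x (@nil V) in
    let l := lin_atoms y l in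
    let a := lin_reify F x l in
    let b := lin_reify F y l in
    refine (@leval_eq F _ l a b _); cbn [lcoef_eq lcoef size eqn];
    repeat split
  end.

(** * Subalgebras of a tensor square *)

(** A predicate rather than a subspace: it also has to cover properties defined by an existential,
    such as [lifted], and serves as the induction principle of [nsTL_ind]. *)
Record subalgebra (F : fieldType) (T : algType F) (D : T -> Prop) : Prop := {
  subalg1 : D 1;
  subalgD : forall x y, D x -> D y -> D (x + y);
  subalgM : forall x y, D x -> D y -> D (x * y);
  subalgZ : forall c x, D x -> D (c *: x) }.

Section Subalgebra.
Variables (F : fieldType) (T : algType F) (D : T -> Prop).
Hypothesis sD : subalgebra D.

Lemma subalg0 : D 0.
Proof. by rewrite -(scale0r 1); apply/(subalgZ sD)/(subalg1 sD). Qed.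

Lemma subalgN x : D x -> D (- x).
Proof. by rewrite -scaleN1r; apply: (subalgZ sD). Qed.

Lemma subalgB x y : D x -> D y -> D (x - y).
Proof. by move=> Dx Dy; apply: (subalgD sD) => //; apply: subalgN. Qed.

Lemma subalg_sum (I : eqType) (s : seq I) (f : I -> T) :
  (forall i, i \in s -> D (f i)) -> D (\sum_(i <- s) f i).
Proof.
move=> Df; rewrite big_seq; elim/big_ind: _ => // [|x y]; first exact: subalg0.
exact: (subalgD sD).
Qed.

Lemma subalgZK c x : c != 0 -> D (c *: x) -> D x.
Proof.
by move=> c0 /(subalgZ sD c^-1); rewrite scalerA mulVf // scale1r.
Qed.

End Subalgebra.

Definition alg_expand (R : pzRingType) :=
  (@mulrDl R, @mulrDr R, @mulrN R, @mulNr R, @mul1r R, @mulr1 R).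

Lemma alg_scale (F : fieldType) (T : algType F) (c : F) (x y : T) :
  ((c *: x) * y = c *: (x * y)) * (x * (c *: y) = c *: (x * y)).
Proof. by split; [rewrite scalerAl|rewrite scalerAr]. Qed.

Section TensorSquare.
Variables (F : fieldType) (B T : algType F) (l r : {lrmorphism B -> T}).
Hypothesis lr : forall a b, l a * r b = r b * l a.
Variable D : T -> Prop.
Hypothesis sD : subalgebra D.

Lemma pairZ c x : (l (c *: x) = c *: l x) * (r (c *: x) = c *: r x).
Proof. by split; rewrite linearZ. Qed.

(** With [l b] = b (x) 1 and [r b] = 1 (x) b, these are the elements whose action by the Leibniz
    rule lies in [D]. They are closed under brackets but in general not under products. *)
Definition Lie (J : B) : Prop := D (l J + r J).

Lemma LieD J J' : Lie J -> Lie J' -> Lie (J + J').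
Proof. by rewrite /Lie !rmorphD addrACA; apply: (subalgD sD). Qed.

Lemma LieZ c J : Lie J -> Lie (c *: J).
Proof. by rewrite /Lie !linearZ /= -scalerDr; apply: (subalgZ sD). Qed.

Lemma LieN J : Lie J -> Lie (- J).
Proof. by rewrite -scaleN1r; apply: LieZ. Qed.

Lemma LieB J J' : Lie J -> Lie J' -> Lie (J - J').
Proof. by move=> LJ LJ'; apply: LieD => //; apply: LieN. Qed.

Lemma LieZK c J : c != 0 -> Lie (c *: J) -> Lie J.
Proof. by move=> c0 /(LieZ c^-1); rewrite scalerA mulVf // scale1r. Qed.

Lemma Lie_bracket J J' : Lie J -> Lie J' -> Lie (J * J' - J' * J).
Proof.
move=> LJ LJ'; rewrite /Lie.
have -> : l (J * J' - J' * J) + r (J * J' - J' * J) =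
    (l J + r J) * (l J' + r J') - (l J' + r J') * (l J + r J).
  rewrite !rmorphB !rmorphM /= !(alg_expand T) !lr.
  by linear_over F; rewrite /=; ring.
by apply: (subalgB sD); apply: (subalgM sD).
Qed.

(* [G] rotates the image of the projection [P], with infinitesimal generator
   [J]; eliminating [l P * r J + l J * r P] between the odd parts of G (x) G and
   of its square leaves the generator acting by the Leibniz rule. *)
Lemma Lie_rotation (P J : B) (c s d : F) :
    P * P = P -> P * J = J -> J * P = J -> J * J = d *: P ->
    c ^+ 2 - d * s ^+ 2 = 1 ->
    2%:R != 0 :> F -> s != 0 -> c != 0 -> c != 1 -> 2%:R * c + 1 != 0 ->
    D (l (1 + (c - 1) *: P + s *: J) * r (1 + (c - 1) *: P + s *: J)) ->
    D (l (1 + (c - 1) *: P - s *: J) * r (1 + (c - 1) *: P - s *: J)) ->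
  Lie J.
Proof.
move=> PP PJ JP JJ cs n2 s0 c0 c1 c2.
set G := 1 + _ + _; set G' := 1 + _ - _ => DG DG'.
have sq e : e ^+ 2 = 1 -> (1 + (c - 1) *: P + (e * s) *: J)
     * (1 + (c - 1) *: P + (e * s) *: J) =
    1 + (2%:R * c ^+ 2 - 2%:R) *: P + (2%:R * e * c * s) *: J.
  move=> e1; rewrite !(alg_expand B, alg_scale) PP PJ JP JJ.
  have ds : d * s ^+ 2 = c ^+ 2 - 1 by rewrite -cs; ring.
  by linear_over F; rewrite /=; ring: ds e1.
have GG : G * G = 1 + (2%:R * c ^+ 2 - 2%:R) *: P + (2%:R * c * s) *: J.
  by have := sq 1; rewrite /G !mul1r !mulr1 => ->; rewrite ?expr1n.
have GG' : G' * G' = 1 + (2%:R * c ^+ 2 - 2%:R) *: P - (2%:R * c * s) *: J.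
  have := sq (-1); rewrite /G' !mulN1r !scaleNr mulrN1 !mulNr scaleNr => -> //.
  by rewrite sqrrN expr1n.
pose a1 := c - 1; pose a2 := 2%:R * c ^+ 2 - 2%:R.
pose b2 := 2%:R * c * s.
(* The pairs [a1], [s] and [a2], [b2] are the coefficients of P and J in G and in its square. Up to
   a factor 2 this is the determinant of the elimination; a2 - a1 = (c - 1) (2 c + 1) explains the
   excluded values of c. *)
have k0 : 2%:R * (s * b2 * (a2 - a1)) != 0.
  have -> : 2%:R * (s * b2 * (a2 - a1)) =
      2%:R * (2%:R * c * s ^+ 2 * ((c - 1) * (2%:R * c + 1))).
    by rewrite /a1 /a2 /b2; ring.
  by rewrite !mulf_neq0 ?expf_neq0 // subr_eq0.
apply: (LieZK k0); rewrite /Lie !linearZ /= -scalerDr.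
have <- : (a2 * b2) *: (l G * r G - l G' * r G')
    - (a1 * s) *: ((l G * r G) * (l G * r G) - (l G' * r G') * (l G' * r G')) =
    (2%:R * (s * b2 * (a2 - a1))) *: (l J + r J).
  have ms x : (l x * r x) * (l x * r x) = l (x * x) * r (x * x).
    by rewrite !rmorphM /= -!mulrA; congr (_ * _); rewrite !mulrA lr.
  rewrite !ms GG GG' /G /G' -/a1 -/a2 -/b2 !(rmorphD, rmorphN, rmorph1) /= !pairZ.
  rewrite !(alg_expand T, alg_scale).
  by linear_over F; rewrite /= /a1 /a2 /b2; ring.
apply: (subalgB sD); apply: (subalgZ sD); apply: (subalgB sD) => //.
  exact: (subalgM sD).
exact: (subalgM sD).
Qed.

(* The square of [l J + r J] has eigenvalues 0, -c and -4c, and the polynomial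
   below takes there the values 1, -1 and 1. *)
Lemma Lie_sign (P J : B) (c : F) :
    P * P = P -> P * J = J -> J * P = J -> J * J = - (c *: P) ->
    c != 0 -> 3%:R != 0 :> F ->
  Lie J -> D (l (1 - 2%:R *: P) * r (1 - 2%:R *: P)).
Proof.
move=> PP PJ JP JJ c0 n3 LJ.
pose X := l J + r J.
pose Y := - (c *: (l P + r P)) + 2%:R *: (l J * r J).
have XX : X * X = Y.
  rewrite /X /Y !(alg_expand T) -!lr -!rmorphM /= JJ !rmorphN /= !pairZ.
  by linear_over F; rewrite /=; ring.
have PPJ x y : l x * r y * (l J * r J) = l (x * J) * r (y * J).
  by rewrite !rmorphM /= -!mulrA; congr (_ * _); rewrite !mulrA lr.
have JJP x y : l J * r J * (l x * r y) = l (J * x) * r (J * y).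
  by rewrite !rmorphM /= -!mulrA; congr (_ * _); rewrite !mulrA lr.
have mlr w x y z : l w * r x * (l y * r z) = l (w * y) * r (x * z).
  by rewrite !rmorphM /= -!mulrA; congr (_ * _); rewrite !mulrA lr.
have l1 x : l x = l x * r 1 by rewrite rmorph1 mulr1.
have r1 x : r x = l 1 * r x by rewrite rmorph1 mul1r.
have YY : Y * Y = c ^+ 2 *: (l P + r P) + (6%:R * c ^+ 2) *: (l P * r P)
    - (8%:R * c) *: (l J * r J).
  rewrite /Y [l P]l1 [r P]r1.
  rewrite !(alg_expand T, alg_scale).
  rewrite !mlr !mul1r !mulr1 !PP !PJ !JP !JJ !rmorphN /= !pairZ.
  rewrite !(alg_expand T, alg_scale) -(l1 P) -(r1 P).
  by linear_over F; rewrite /=; ring.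
rewrite /Lie in LJ *.
have -> : l (1 - 2%:R *: P) * r (1 - 2%:R *: P) =
    1 + (8%:R / (3%:R * c)) *: (X * X)
      + (2%:R / (3%:R * c ^+ 2)) *: ((X * X) * (X * X)).
  rewrite !XX YY /Y !(rmorphB, rmorph1) /= !pairZ !(alg_expand T, alg_scale).
  by linear_over F; rewrite /=; field; rewrite n3 c0.
have DXX : D (X * X) by apply: (subalgM sD).
apply: (subalgD sD); last by apply/(subalgZ sD)/(subalgM sD).
by apply: (subalgD sD); [apply: (subalg1 sD)|apply: (subalgZ sD)].
Qed.

End TensorSquare.

(** * Matrix units indexed by ballot words *)

Lemma eq_word_cons (x y : bool) (a b : word) :
  (x :: a == y :: b) = (x == y) && (a == b).
Proof. by []. Qed.

(** Matrix units of the product, over all heights, of the matrix algebras on the words of that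
    height. Values of [E] at two words of different heights are left unconstrained. *)
Definition units (F : fieldType) (B : algType F) (k : nat)
    (E : word -> word -> B) : Prop :=
  (forall a b c d, a \in Om k -> b \in Om k -> c \in Om k -> d \in Om k ->
     ht a = ht b -> ht c = ht d -> E a b * E c d = if b == c then E a d else 0)
  /\ \sum_(a <- Om k) E a a = 1.

(* The units for the words without their last letter. *)
Definition down (F : fieldType) (B : algType F) (E : word -> word -> B) a b : B :=
  E (false :: a) (false :: b)
  + if (0 < ht a)%N then E (true :: a) (true :: b) else 0.

Lemma units_down (F : fieldType) (B : algType F) k (E : word -> word -> B) :
  units k.+1 E -> units k (down E).
Proof.
move=> [EE E1]; split; last by rewrite -E1 big_Om.
move=> a b c d ak bk ck dk ab cd; rewrite /down !mulrDr !mulrDl.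
have ab0 : ht (false :: a) = ht (false :: b) by rewrite /= ab.
have cd0 : ht (false :: c) = ht (false :: d) by rewrite /= cd.
have ab1 : ht (true :: a) = ht (true :: b) by rewrite /= ab.
have cd1 : ht (true :: c) = ht (true :: d) by rewrite /= cd.
rewrite EE ?Om0 // eq_word_cons /= ab cd.
have [ha|ha] := posnP (ht b).
  rewrite !mul0r !addr0; case: (posnP (ht d)) => hd.
    by rewrite mulr0 addr0; case: eqP.
  rewrite EE ?Om1 ?Om0 ?ck ?dk ?cd // eq_word_cons /= addr0.
  by case: eqP => // e; move: hd; rewrite -cd -e ha.
rewrite [E (true :: a) _ * E (false :: c) _]EE ?Om1 ?Om0 ?ak ?bk ?ab // eq_word_cons /=.
have [hd|hd] := posnP (ht d).
  rewrite !mulr0 !addr0; case: eqP => [e|//].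
  by move: ha; rewrite e cd hd.
rewrite !EE ?Om1 ?Om0 ?ak ?bk ?ck ?dk ?ab ?cd // !eq_word_cons /=.
by rewrite !add0r addr0; case: eqP => // _; rewrite addr0.
Qed.

(* The matrix entries of the generators: [p] on the diagonal, [q] and [q'] off
   it; [g] is the ratio of the norms of w1 and w.  All depend on the height. *)
Record coefs (F : fieldType) := Coefs {
  cp : nat -> F; cq : nat -> F; cq' : nat -> F; cg : nat -> F;
  cp2 : forall h, cp h ^+ 2 + cq h * cq' h = 1;
  cq0 : cq 0 = 0;
  cp0 : cp 0 = -1;
  cq_neq0 : forall h, (0 < h)%N -> cq h != 0;
  cq'_neq0 : forall h, cq' h != 0;
  cp_neq0 : forall h, cp h != 0;
  cp_neq1 : forall h, 2%:R * cp h ^+ 2 != 1;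
  cp_neq2 : forall h, 4%:R * cp h ^+ 2 != 1;
  cg_neq0 : forall h, (0 < h)%N -> cg h != 0;
  cgq : forall h, (0 < h)%N -> cg h.+1 * cq h = cg h * cq' h;
  nat_neq0 : forall n, n.+1%:R != 0 :> F }.

(** * Generators and weights on ballot words *)

Section Generators.
Variables (F : fieldType) (c : coefs F).

(** Equal letters are neighbours in a row, with eigenvalue 1. Neighbours in a column are the words
    [true :: false :: v] with [ht v = 0]; there [cp] is -1 and [cq] is 0, so they need no case of
    their own. *)
Definition dg (t : word) : F :=
  if t is x :: y :: v then
    if x == y then 1 else if x then cp c (ht v) else - cp c (ht v)
  else 1.

Definition od (t : word) : F :=
  if t is x :: y :: v then
    if x == y then 0 else if x then cq c (ht v) else cq' c (ht v)
  else 0.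

Definition sw (t : word) : word := if t is x :: y :: v then y :: x :: v else t.

(** The norms of the seminormal basis for the invariant form: by [gam_od] the generators are
    self-adjoint for these weights. *)
Fixpoint gam (t : word) : F :=
  if t is x :: w then gam w * (if x then cg c (ht w) else 1) else 1.

Lemma swK : involutive sw. Proof. by case=> [|x []]. Qed.

(** Swapping the two last letters of a ballot word breaks the ballot condition only for
    [true :: false :: v] with [ht v = 0], and there the coefficient [cq] vanishes. *)
Lemma od_neq0 k t : t \in Om k -> od t != 0 -> sw t \in Om k /\ ht (sw t) = ht t.
Proof.
case: t => [|x [|y v]]; rewrite ?eqxx //.
case: k => [|[|k]]; rewrite ?mem_Om //= !eqSS.
case: x y => [] [] //=; rewrite ?eqxx // ?andbT ?implybT.
  have [->|h] := posnP (ht v); first by rewrite cq0 eqxx.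
  by case/andP=> -> -> _; rewrite prednK.
by case/and3P=> -> -> h _; rewrite prednK.
Qed.

Lemma gam_neq0 k t : t \in Om k -> gam t != 0.
Proof.
elim: k t => [|k IH] [|x w] //; rewrite ?mem_Om ?oner_neq0 // -mem_Om => xw.
rewrite mulf_neq0 ?(IH _ (Om_cons xw)) //; case: x xw; rewrite ?oner_neq0 //.
by rewrite Om1 => /andP[_]; apply: cg_neq0.
Qed.

Lemma gam_od v : (0 < ht v)%N ->
  gam (true :: false :: v) * cq c (ht v) = gam (false :: true :: v) * cq' c (ht v).
Proof. by move=> h; rewrite /= !mulr1 -!mulrA cgq. Qed.

Variable B : algType F.

(** The elementary skew-adjoint element for the form with norms [gam], supported on the plane of a
    and b. *)
Definition Jab (E : word -> word -> B) a b : B :=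
  gam b *: E a b - gam a *: E b a.

(* The generator exchanging the letters m and m+1, counted from the end. *)
Definition Rat m (E : word -> word -> B) k : B :=
  \sum_(t <- Om k) (dg (drop m t) *: E t t
                    + od (drop m t) *: E t (take m t ++ sw (drop m t))).

(** A generator that leaves the last letter alone is a generator for the words without it; this
    drives the inductions on the length. *)
Lemma Rat_down m E k : Rat m (down E) k = Rat m.+1 E k.+1.
Proof.
rewrite /Rat big_Om; apply: eq_bigr => w _ /=; rewrite /down.
by case: ifP => _; rewrite ?addr0 // !scalerDr addrACA.
Qed.

End Generators.

Section TopGenerator.
Variables (F : fieldType) (c : coefs F) (B : algType F).
Variables (k : nat) (E : word -> word -> B).
Hypothesis uE : units k E.
Let EE := uE.1.
Local Notation R := (Rat c 0 E k).

Lemma unitM a b d : a \in Om k -> b \in Om k -> d \in Om k ->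
  ht a = ht b -> ht b = ht d -> E a b * E b d = E a d.
Proof. by move=> ak bk dk ab bd; rewrite EE // eqxx. Qed.

Lemma unitM0 a b d e : a \in Om k -> b \in Om k -> d \in Om k -> e \in Om k ->
  ht a = ht b -> ht d = ht e -> b != d -> E a b * E d e = 0.
Proof. by move=> ak bk dk ek ab de bd; rewrite EE // (negPf bd). Qed.

Lemma unit_Rat a b : a \in Om k -> b \in Om k -> ht a = ht b ->
  E a b * R = dg c b *: E a b + od c b *: E a (sw b).
Proof.
move=> ak bk ab; rewrite /Rat mulr_sumr (bigD1_seq b) ?Om_uniq //= big_seq_cond.
rewrite big1 => [|t /andP[tk tb]]; rewrite drop0 take0 /= mulrDr !alg_scale; last first.
  rewrite EE // eq_sym (negPf tb) scaler0 add0r.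
  have [->|/(od_neq0 tk)[sk st]] := eqVneq (od c t) 0; first exact: scale0r.
  by rewrite EE // eq_sym (negPf tb) scaler0.
rewrite unitM // addr0; congr (_ + _).
have [->|/(od_neq0 bk)[sk st]] := eqVneq (od c b) 0; first by rewrite !scale0r.
by rewrite unitM // st.
Qed.

Lemma Rat_unit a b : a \in Om k -> b \in Om k -> ht a = ht b ->
  sw a \in Om k -> ht (sw a) = ht a ->
  R * E a b = dg c a *: E a b + od c (sw a) *: E (sw a) b.
Proof.
move=> ak bk ab sk sa; rewrite /Rat mulr_suml.
under eq_bigr => t _ do rewrite drop0 take0 /= mulrDl !alg_scale.
rewrite big_split /=; congr (_ + _).
  rewrite (bigD1_seq a) ?Om_uniq //= big_seq_cond big1 => [|t /andP[tk ta]].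
    by rewrite unitM // addr0.
  by rewrite EE // (negPf ta) scaler0.
rewrite (bigD1_seq (sw a)) ?Om_uniq //= big_seq_cond big1 => [|t /andP[tk ta]].
  by rewrite swK unitM ?addr0.
have [->|/(od_neq0 tk)[stk st]] := eqVneq (od c t) 0; first exact: scale0r.
rewrite EE //; case: eqP => [e|_]; last exact: scaler0.
by move: ta; rewrite -e swK eqxx.
Qed.

Lemma Rat_sq : R * R = 1.
Proof.
rewrite -[LHS]mul1r -uE.2 mulr_suml; apply: eq_big_seq => t tk.
rewrite mulrA unit_Rat // mulrDl !alg_scale unit_Rat //.
have [z|nz] := eqVneq (od c t) 0; last first.
  have [sk st] := od_neq0 tk nz; rewrite unit_Rat // swK.
  case: t tk nz sk st => [|x [|y v]] /= tk; rewrite ?eqxx // eq_sym.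
  have e h : cq c h * cq' c h = 1 - cp c h ^+ 2 by rewrite -(cp2 c h) addrC addKr.
  case: x y tk => [] [] //=; rewrite ?eqxx // => _ _ _ _.
    by linear_over F; rewrite /=; ring: (e (ht v)).
  by linear_over F; rewrite /=; ring: (e (ht v)).
rewrite z !scale0r !addr0 scalerA.
case: t z tk => [|x [|y v]] /=; rewrite ?mulr1 ?scale1r // => + _.
case: x y => [] [] /=; rewrite ?mulr1 ?scale1r // => z; have := cp2 c (ht v).
  by rewrite z mul0r addr0 expr2 => ->; rewrite scale1r.
by rewrite z mulr0 addr0 expr2 mulrNN => ->; rewrite scale1r.
Qed.

End TopGenerator.

(** * Infinitesimal generators of rotations *)

Section LieSwap.
Variables (F : fieldType) (c : coefs F) (B T : algType F).
Variables (l r : {lrmorphism B -> T}) (D : T -> Prop).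
Hypothesis lr : forall a b, l a * r b = r b * l a.
Hypothesis sD : subalgebra D.

Lemma sub_pairM x y : D (l x * r x) -> D (l y * r y) -> D (l (x * y) * r (x * y)).
Proof.
move=> Dx Dy; have -> : l (x * y) * r (x * y) = (l x * r x) * (l y * r y).
  by rewrite !rmorphM /= -!mulrA; congr (_ * _); rewrite !mulrA lr.
exact: (subalgM sD).
Qed.

(** The sign change S of the shorter word [false :: v] negates both o and a, while R fixes o and
    mixes a with b. Hence S R S R is the identity on o and a rotation of the plane of a and b, with
    cosine 2 p^2 - 1; its inverse R S R S is the same expression with J negated, as [Lie_rotation]
    requires. *)
Lemma Lie_swap k (E : word -> word -> B) v :
  units k.+2 E -> v \in Om k -> (0 < ht v)%N ->
  D (l (Rat c 0 E k.+2) * r (Rat c 0 E k.+2)) ->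
  D (l (1 - 2%:R *: down E (false :: v) (false :: v))
     * r (1 - 2%:R *: down E (false :: v) (false :: v))) ->
  Lie l r D (Jab c E (true :: false :: v) (false :: true :: v)).
Proof.
move=> uE vk hv; set R := Rat _ _ _ _ => DR.
set a := true :: _; set b := false :: true :: v; set o := false :: false :: v.
have -> : down E (false :: v) (false :: v) = E o o + E a a by [].
set S := 1 - _ => DS.
have ak : a \in Om k.+2 by rewrite Om1 Om0 vk.
have bk : b \in Om k.+2 by rewrite Om0 Om1 vk.
have ok : o \in Om k.+2 by rewrite !Om0.
have ab : ht a = ht b by rewrite /= prednK.
have EaR : E a a * R = cp c (ht v) *: E a a + cq c (ht v) *: E a b.
  by rewrite (unit_Rat c uE).
have RE x y : x \in [:: a; b; o] -> y \in Om k.+2 -> ht x = ht y ->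
    R * E x y = dg c x *: E x y + od c (sw x) *: E (sw x) y.
  by rewrite !inE => /or3P[] /eqP -> *; rewrite (Rat_unit c uE).
have Ra : R * E a a = cp c (ht v) *: E a a + cq' c (ht v) *: E b a.
  by rewrite RE ?inE ?eqxx.
have Rb : R * E a b = cp c (ht v) *: E a b + cq' c (ht v) *: E b b.
  by rewrite RE ?inE ?eqxx.
have Ro : R * E o o = E o o.
  by rewrite RE ?inE ?eqxx ?orbT //= scale1r scale0r addr0.
have oR : E o o * R = E o o.
  by rewrite (unit_Rat c uE) //= scale1r scale0r addr0.
have RR : R * R = 1 := Rat_sq c uE.
have M1 x y z : x \in [:: a; b] -> y \in [:: a; b] -> z \in [:: a; b] ->
    E x y * E y z = E x z.
  by rewrite !inE => /orP[] /eqP-> /orP[] /eqP-> /orP[] /eqP->; rewrite (unitM uE).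
have M0 x y : x \in [:: a; b] -> y \in [:: a; b] ->
    (E x a * E b y = 0) * (E x b * E a y = 0).
  by rewrite !inE => /orP[] /eqP-> /orP[] /eqP->; rewrite !(unitM0 uE).
have Mo x y : x \in [:: a; b] -> y \in [:: a; b] ->
    (E o o * E x y = 0) * (E x y * E o o = 0).
  by rewrite !inE => /orP[] /eqP-> /orP[] /eqP->; rewrite !(unitM0 uE).
have oo : E o o * E o o = E o o by rewrite (unitM uE).
have aI : a \in [:: a; b] by rewrite inE eqxx.
have bI : b \in [:: a; b] by rewrite !inE eqxx orbT.
have M := (M1 _ _ _ aI aI aI, M1 _ _ _ aI aI bI, M1 _ _ _ aI bI aI,
  M1 _ _ _ aI bI bI, M1 _ _ _ bI aI aI, M1 _ _ _ bI aI bI, M1 _ _ _ bI bI aI,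
  M1 _ _ _ bI bI bI, M0 _ _ aI aI, M0 _ _ aI bI, M0 _ _ bI aI, M0 _ _ bI bI,
  Mo _ _ aI aI, Mo _ _ aI bI, Mo _ _ bI aI, Mo _ _ bI bI, oo).
pose p := cp c (ht v); pose q := cq c (ht v); pose q' := cq' c (ht v).
have pq : q * q' = 1 - p ^+ 2 by rewrite /q /q' /p -(cp2 c (ht v)) addrC addKr.
pose P := E a a + E b b; pose J := q *: E a b - q' *: E b a.
pose N := E o o + p ^+ 2 *: E a a + (p * q) *: E a b + (p * q') *: E b a
          + (1 - p ^+ 2) *: E b b.
have RSR : R * S * R = 1 - 2%:R *: N.
  rewrite /S mulrBr mulr1 mulrBl RR; congr (_ - _).
  rewrite !alg_scale; congr (_ *: _).
  rewrite mulrDr mulrDl Ro oR Ra mulrDl !alg_scale EaR.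
  have -> : E b a * R = p *: E b a + q *: E b b by rewrite (unit_Rat c uE).
  by rewrite /N -/p -/q -/q' -pq; linear_over F; rewrite /=; ring.
pose cc := 2%:R * p ^+ 2 - 1; pose s := 2%:R * p.
have SRSR : S * (R * S * R) = 1 + (cc - 1) *: P + s *: J.
  rewrite RSR /S /N /P /J !(alg_expand B, alg_scale) !M.
  by linear_over F; rewrite /= /cc /s; ring.
have RSRS : R * S * R * S = 1 + (cc - 1) *: P - s *: J.
  rewrite RSR /S /N /P /J !(alg_expand B, alg_scale) !M.
  by linear_over F; rewrite /= /cc /s; ring.
have gJ : Jab c E a b = (gam c b / q) *: J.
  have q0 : q != 0 by apply: cq_neq0.
  rewrite /Jab /J scalerBr !scalerA divfK //; congr (_ - _ *: _).
  by rewrite mulrAC -(gam_od c hv) -/q mulfK.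
rewrite gJ; apply: LieZ => //.
apply: (@Lie_rotation _ _ _ l r lr D sD P J cc s (- (q * q'))).
- by rewrite /P !(alg_expand B) !M; linear_over F; rewrite /=; ring.
- rewrite /P /J !(alg_expand B, alg_scale) !M; linear_over F; rewrite /=; ring.
- rewrite /P /J !(alg_expand B, alg_scale) !M; linear_over F; rewrite /=; ring.
- rewrite /P /J !(alg_expand B, alg_scale) !M; linear_over F; rewrite /=; ring.
- by rewrite pq /cc /s; ring.
- exact: nat_neq0 c 1.
- by rewrite /s mulf_neq0 ?(cp_neq0 c) ?(nat_neq0 c 1).
- by rewrite /cc subr_eq0 (cp_neq1 c).
- rewrite /cc -subr_eq0.
  have -> : 2%:R * p ^+ 2 - 1 - 1 = - 2%:R * (q * q') by rewrite pq; ring.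
  by rewrite !mulf_neq0 ?oppr_eq0 ?(nat_neq0 c 1) ?cq_neq0 ?cq'_neq0.
- have -> : 2%:R * cc + 1 = 4%:R * p ^+ 2 - 1 by rewrite /cc; ring.
  by rewrite subr_eq0 (cp_neq2 c).
- by rewrite -SRSR; apply: sub_pairM => //; apply: sub_pairM => //; apply: sub_pairM.
- by rewrite -RSRS; apply: sub_pairM => //; apply: sub_pairM => //; apply: sub_pairM.
Qed.

End LieSwap.

Section Brackets.
Variables (F : fieldType) (c : coefs F) (B T : algType F).
Variables (l r : {lrmorphism B -> T}) (D : T -> Prop).
Hypothesis lr : forall a b, l a * r b = r b * l a.
Hypothesis sD : subalgebra D.
Local Notation J := (Jab c).
Local Notation Lie := (Lie l r D).

Lemma JabN (E : word -> word -> B) a b : J E a b = - J E b a.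
Proof. by rewrite /Jab opprB. Qed.

Lemma Jab_bracket k (E : word -> word -> B) a b d : units k E ->
  a \in Om k -> b \in Om k -> d \in Om k -> ht a = ht b -> ht b = ht d ->
  a != b -> b != d -> a != d ->
  J E a b * J E b d - J E b d * J E a b = gam c b *: J E a d.
Proof.
move=> uE ak bk dk ab bd nab nbd nad.
have ad : ht a = ht d by rewrite ab.
rewrite /Jab !(alg_expand B, alg_scale) !(unitM uE) //.
rewrite !(unitM0 uE) ?(eq_sym d) ?(eq_sym b a) //.
by linear_over F; rewrite /=; ring.
Qed.

Lemma Jab_comm k (E : word -> word -> B) a b d e : units k E ->
  a \in Om k -> b \in Om k -> d \in Om k -> e \in Om k -> ht a = ht b -> ht d = ht e ->
  a != d -> a != e -> b != d -> b != e ->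
  J E a b * J E d e - J E d e * J E a b = 0.
Proof.
move=> uE ak bk dk ek ab de ad ae bd be.
rewrite /Jab !(alg_expand B, alg_scale) !(unitM0 uE) // 1?eq_sym //.
by linear_over F; rewrite /=; ring.
Qed.

Lemma Jab_down (E : word -> word -> B) w w' : ht w = ht w' ->
  J (down E) w w' = J E (false :: w) (false :: w')
  + if (0 < ht w)%N then (cg c (ht w))^-1 *: J E (true :: w) (true :: w') else 0.
Proof.
move=> ww; rewrite /Jab /down /= -ww; case: posnP => h.
  by rewrite !addr0 !mulr1.
have g0 := cg_neq0 c h; rewrite !mulr1.
by linear_over F; rewrite /=; field.
Qed.

Lemma bracketDZ (X Y Z : B) (s : F) :
  X * (Y + s *: Z) - (Y + s *: Z) * X = (X * Y - Y * X) + s *: (X * Z - Z * X).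
Proof.
by rewrite !(alg_expand B, alg_scale); linear_over F; rewrite /=; ring.
Qed.

(** An element for the shorter words is the sum of a part on words with last letter [false] and a
    part on words with last letter [true]; a bracket with an element that meets only one part
    isolates it. S1 and S2 thus join words with different last letters, starting from the swaps; S3
    and S4 join words with the same last letter through a common word with the other one. *)
Lemma Lie_Jab k (E : word -> word -> B) : units k.+2 E ->
    (forall v, v \in Om k -> (0 < ht v)%N ->
       Lie (J E (true :: false :: v) (false :: true :: v))) ->
    (forall w w', w \in Om k.+1 -> w' \in Om k.+1 -> ht w = ht w' ->
       Lie (J (down E) w w')) ->
  forall a b, a \in Om k.+2 -> b \in Om k.+2 -> ht a = ht b -> Lie (J E a b).
Proof.
move=> uE Hs Hd.
have L0 : Lie 0 by rewrite /Lie !raddf0 addr0; apply: subalg0.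
have Jaa a : J E a a = 0 by rewrite /Jab subrr.
have neq x y w w' : ht w != ht w' -> x :: w != y :: w'.
  by rewrite eq_word_cons => h; apply: contra h => /andP[_ /eqP ->].
have h2 h : h.+2 != h by apply/eqP; lia.
have S1 v w' : v \in Om k -> (0 < ht v)%N -> w' \in Om k.+1 -> ht w' = (ht v).+1 ->
    Lie (J E (false :: true :: v) (true :: w')).
  move=> vk hv wk hw; have [->|nw] := eqVneq w' (false :: v).
    by rewrite JabN; apply: LieN => //; apply: Hs.
  have vk0 : false :: v \in Om k.+1 by rewrite Om0.
  have := Lie_bracket lr sD (LieN sD (Hs v vk hv)) (Hd _ _ vk0 wk (esym hw)).
  have ma : false :: true :: v \in Om k.+2 by rewrite Om0 Om1 vk.
  have mb : true :: false :: v \in Om k.+2 by rewrite Om1 vk0.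
  have mc : false :: false :: v \in Om k.+2 by rewrite Om0.
  have md : false :: w' \in Om k.+2 by rewrite Om0.
  have me : true :: w' \in Om k.+2 by rewrite Om1 wk hw.
  rewrite -JabN Jab_down ?hw //= bracketDZ.
  rewrite (Jab_comm uE ma mb mc md) /= ?prednK ?hw //; last first.
    by apply: neq; rewrite hw /=; apply/eqP; clear; lia.
  rewrite (Jab_bracket uE ma mb me) /= ?prednK ?hw //; last first.
    by rewrite eq_word_cons eq_sym.
  rewrite add0r scalerA => /LieZK; apply=> //.
  by rewrite mulf_neq0 ?invr_neq0 ?cg_neq0 // (gam_neq0 c mb).
have S2 w w' : w \in Om k.+1 -> w' \in Om k.+1 -> ht w' = (ht w).+2 ->
    Lie (J E (false :: w) (true :: w')).
  move=> wk wk' hw.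
  (* The intermediate word is [false :: true :: v]: S1 joins it to [true :: w'], and an element for
     the shorter words joins [true :: v] to [w]. *)
  have [|//|v vk hv] := @ex_word k (ht w).+1.
  - by move: (ht_le wk'); rewrite hw.
  - by move: (odd_ht wk) => /= ->; rewrite negbK.
  have hv0 : (0 < ht v)%N by rewrite hv.
  have [->|nw] := eqVneq w (true :: v); first by apply: S1; rewrite ?hv.
  have vk1 : true :: v \in Om k.+1 by rewrite Om1 vk.
  have hwv : ht w = ht (true :: v) by rewrite /= hv.
  have := Lie_bracket lr sD (S1 v w' vk hv0 wk' _) (Hd _ _ wk vk1 hwv).
  rewrite hw hv => /(_ erefl) /(LieN sD); rewrite opprB Jab_down //.
  have fw : false :: w \in Om k.+2 by rewrite Om0.
  have fv : false :: true :: v \in Om k.+2 by rewrite Om0.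
  have tw' : true :: w' \in Om k.+2 by rewrite Om1 wk' hw.
  have key : Lie (J E (false :: w) (false :: true :: v) * J E (false :: true :: v) (true :: w')
     - J E (false :: true :: v) (true :: w') * J E (false :: w) (false :: true :: v)) ->
     Lie (J E (false :: w) (true :: w')).
    have gv := gam_neq0 c fv.
    rewrite [X in Lie X](_ : _ = gam c (false :: true :: v) *: J E (false :: w) (true :: w')).
      by move/LieZK; apply.
    by apply: (Jab_bracket uE fw fv tw'); rewrite ?eq_word_cons //= ?hv ?hw.
  case: ifP => hw0; last by rewrite addr0.
  have tw : true :: w \in Om k.+2 by rewrite Om1 wk.
  have tv : true :: true :: v \in Om k.+2 by rewrite Om1 vk1 -hwv.
  rewrite -opprB bracketDZ -[X in _ + _ *: X]opprB.
  rewrite (Jab_comm uE tw tv fv tw') /= ?hv ?hw //.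
  - by rewrite oppr0 scaler0 addr0 opprB.
  - by apply: neq; rewrite hw eq_sym.
  - by apply: neq; rewrite hw /= hv; apply/eqP; clear; lia.
have S3 w w' : w \in Om k.+1 -> w' \in Om k.+1 -> ht w = ht w' ->
    Lie (J E (false :: w) (false :: w')).
  move=> wk wk' hw; have [->|nw] := eqVneq w w'; first by rewrite Jaa.
  (* Only one word has the maximal height k + 1, and parity excludes height k; otherwise there is
     room for a common word [true :: w1] with [ht w1 = ht w + 2]. *)
  have lt : ((ht w).+2 <= k.+1)%N.
    have := odd_ht wk; have := ht_le wk; rewrite leq_eqVlt => /orP[/eqP e|].
      by move: nw; rewrite (ht_max wk e) (ht_max wk') -?hw // eqxx.
    by rewrite leq_eqVlt => /orP[/eqP [->] /=|//]; case: odd.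
  have [|w1 w1k hw1] := @ex_word k.+1 _ lt; first by rewrite /= (odd_ht wk) /= negbK.
  have := Lie_bracket lr sD (S2 w w1 wk w1k hw1) (LieN sD (S2 w' w1 wk' w1k _)).
  rewrite -hw => /(_ hw1); rewrite -JabN.
  have t1 : true :: w1 \in Om k.+2 by rewrite Om1 w1k hw1.
  have m1 : false :: w \in Om k.+2 by rewrite Om0.
  have m2 : false :: w' \in Om k.+2 by rewrite Om0.
  have g1 := gam_neq0 c t1.
  rewrite [X in Lie X](_ : _ = gam c (true :: w1) *: J E (false :: w) (false :: w')).
    by move/LieZK; apply.
  by apply: (Jab_bracket uE m1 t1 m2); rewrite ?eq_word_cons //= -?hw ?hw1.
have S4 w w' : w \in Om k.+1 -> w' \in Om k.+1 -> ht w = ht w' -> (0 < ht w)%N ->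
    Lie (J E (true :: w) (true :: w')).
  move=> wk wk' hw h0; have [->|nw] := eqVneq w w'; first by rewrite Jaa.
  (* A common word [false :: w1] needs [ht w1 = ht w - 2], impossible at height 1; there the part
     already known by S3 is subtracted instead. *)
  have [h1|h1] := eqVneq (ht w) 1%N.
    have := LieB sD (Hd _ _ wk wk' hw) (S3 _ _ wk wk' hw).
    rewrite Jab_down // h0 addrAC subrr add0r => /LieZK; apply=> //.
    by rewrite invr_neq0 // cg_neq0.
  have [h e] : exists h, ht w = h.+2.
    by exists (ht w).-2; move: h0 h1; case: (ht w) => [|[]].
  have [||w1 w1k hw1] := @ex_word k.+1 h.
  - by have := ht_le wk; rewrite e; clear; lia.
  - by have := odd_ht wk; rewrite e /= negbK.
  have e1 : ht w = (ht w1).+2 by rewrite hw1.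
  have e2 : ht w' = (ht w1).+2 by rewrite -hw e1.
  have := Lie_bracket lr sD (LieN sD (S2 w1 w w1k wk e1)) (S2 w1 w' w1k wk' e2).
  rewrite -JabN.
  have t1 : false :: w1 \in Om k.+2 by rewrite Om0.
  have m1 : true :: w \in Om k.+2 by rewrite Om1 wk h0.
  have m2 : true :: w' \in Om k.+2 by rewrite Om1 wk' -hw h0.
  have g1 := gam_neq0 c t1.
  rewrite [X in Lie X](_ : _ = gam c (false :: w1) *: J E (true :: w) (true :: w')).
    by move/LieZK; apply.
  by apply: (Jab_bracket uE m1 t1 m2); rewrite ?eq_word_cons //= ?e1 ?e2.
case=> [|x w] [|y w']; rewrite ?mem_Om //; rewrite -!mem_Om => xw yw.
have wk := Om_cons xw; have wk' := Om_cons yw.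
case: x y xw yw => [] [] /=; rewrite ?Om0 ?Om1 => xw yw e.
- case/andP: xw => _ h; case/andP: yw => _ h'; apply: S4 => //.
  by rewrite -(prednK h) e prednK.
- case/andP: xw => _ h; rewrite JabN; apply: LieN => //; apply: S2 => //.
  by rewrite -(prednK h) e.
- by case/andP: yw => _ h; apply: S2 => //; rewrite -(prednK h) -e.
- by apply: S3 => //; case: e.
Qed.

End Brackets.

(** * Sign changes *)

Section Signs.
Variables (F : fieldType) (c : coefs F) (B T : algType F).
Variables (l r : {lrmorphism B -> T}) (D : T -> Prop).
Hypothesis lr : forall a b, l a * r b = r b * l a.
Hypothesis sD : subalgebra D.
Local Notation J := (Jab c).
Local Notation Lie := (Lie l r D).

Definition tsq (x : B) : T := l x * r x.
Definition sgn (E : word -> word -> B) a : B := 1 - 2%:R *: E a a.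

Lemma tsqM x y : tsq (x * y) = tsq x * tsq y.
Proof. by rewrite /tsq !rmorphM /= -!mulrA; congr (_ * _); rewrite !mulrA lr. Qed.

Lemma tsqN x : tsq (- x) = tsq x.
Proof. by rewrite /tsq !rmorphN mulrNN. Qed.

Lemma sgn_sq k (E : word -> word -> B) a : units k E -> a \in Om k ->
  sgn E a * sgn E a = 1.
Proof.
move=> uE ak; rewrite /sgn !(alg_expand B, alg_scale) (unitM uE) //.
by linear_over F; rewrite /=; ring.
Qed.

Lemma sgn_mul k (E : word -> word -> B) a b : units k E -> a \in Om k ->
  b \in Om k -> a != b -> sgn E a * sgn E b = 1 - 2%:R *: (E a a + E b b).
Proof.
move=> uE ak bk ab; rewrite /sgn !(alg_expand B, alg_scale) (unitM0 uE) //.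
by linear_over F; rewrite /=; ring.
Qed.

Lemma sgnC k (E : word -> word -> B) a b : units k E -> a \in Om k ->
  b \in Om k -> sgn E a * sgn E b = sgn E b * sgn E a.
Proof.
move=> uE ak bk; have [->|ab] := eqVneq a b; first by [].
by rewrite !(sgn_mul uE) // 1?eq_sym // addrC [E b b + _]addrC addrC.
Qed.

Lemma sgn_pair k (E : word -> word -> B) a b : units k E ->
  a \in Om k -> b \in Om k -> ht a = ht b -> Lie (J E a b) ->
  D (tsq (sgn E a * sgn E b)).
Proof.
move=> uE ak bk ab LJ; have [->|nab] := eqVneq a b.
  by rewrite (sgn_sq uE) // /tsq !rmorph1 mulr1; apply: (subalg1 sD).
have nba : b != a by rewrite eq_sym.
rewrite (sgn_mul uE) //.
apply: (@Lie_sign _ _ _ l r lr D sD _ (J E a b) (gam c a * gam c b)) => //.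
- rewrite !(alg_expand B) !(unitM uE) // !(unitM0 uE) //.
  by linear_over F; rewrite /=; ring.
- rewrite /Jab !(alg_expand B, alg_scale) !(unitM uE) // !(unitM0 uE) //.
  by linear_over F; rewrite /=; ring.
- rewrite /Jab !(alg_expand B, alg_scale) !(unitM uE) // !(unitM0 uE) //.
  by linear_over F; rewrite /=; ring.
- rewrite /Jab !(alg_expand B, alg_scale) !(unitM uE) // !(unitM0 uE) //.
  by linear_over F; rewrite /=; ring.
- by rewrite mulf_neq0 ?(gam_neq0 c ak) ?(gam_neq0 c bk).
- exact: (nat_neq0 c 2).
Qed.

(** Within one height this is [sgn_pair]. To change the height: the sign change of a shorter word w
    of positive height is the product of those of [true :: w] and [false :: w], whose heights differ
    by two. Repeated steps lead every word to the top word. *)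
Lemma sgn_pair_all k (E : word -> word -> B) : units k.+2 E ->
    (forall a b, a \in Om k.+2 -> b \in Om k.+2 -> ht a = ht b -> Lie (J E a b)) ->
    (forall w, w \in Om k.+1 -> D (tsq (sgn (down E) w))) ->
  forall a b, a \in Om k.+2 -> b \in Om k.+2 -> D (tsq (sgn E a * sgn E b)).
Proof.
move=> uE HJ Hd.
pose top : word := nseq k.+2 false.
have trans a b d : b \in Om k.+2 -> D (tsq (sgn E a * sgn E b)) ->
    D (tsq (sgn E b * sgn E d)) -> D (tsq (sgn E a * sgn E d)).
  move=> bk Dab Dbd; have -> : sgn E a * sgn E d =
      (sgn E a * sgn E b) * (sgn E b * sgn E d).
    by rewrite -mulrA [sgn E b * (_ * _)]mulrA (sgn_sq uE) // mul1r.
  by rewrite tsqM; apply: (subalgM sD).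
have tk : top \in Om k.+2 by apply: (nseq_Om k.+2).
have toTop n a : a \in Om k.+2 -> (k.+2 - ht a < n)%N -> D (tsq (sgn E a * sgn E top)).
  elim: n a => // n IH a ak hn.
  have := ht_le ak; rewrite leq_eqVlt => /orP[/eqP e|lt].
    by rewrite (ht_max ak e : a = top); apply/(sgn_pair uE tk tk)/HJ.
  have lt' : (ht a < k.+1)%N.
    move: lt; rewrite ltnS leq_eqVlt => /orP[/eqP e|//].
    by have := odd_ht ak; rewrite e /=; case: odd.
  have [|w wk hw] := @ex_word k.+1 (ht a).+1 lt'.
    by rewrite /= (odd_ht ak) /= negbK.
  have w1 : true :: w \in Om k.+2 by rewrite Om1 wk hw.
  have w0 : false :: w \in Om k.+2 by rewrite Om0.
  have aw : ht a = ht (true :: w) by rewrite /= hw.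
  apply: (trans _ _ _ w1); first by apply/(sgn_pair uE ak w1)/HJ.
  apply: (trans _ _ _ w0); last first.
    by apply: IH => //; rewrite /= hw; clear -hn lt; lia.
  have := Hd w wk; rewrite /sgn /down hw /= -/(sgn E _).
  by rewrite (sgn_mul uE) // [E (true :: w) _ + _]addrC.
move=> a b ak bk; apply: (trans _ _ _ tk); first by apply: (toTop k.+3); rewrite // ltnS leq_subr.
by rewrite (sgnC uE) //; apply: (toTop k.+3); rewrite // ltnS leq_subr.
Qed.

Lemma natB_neq0 m n : m != n -> (m%:R - n%:R : F) != 0.
Proof.
have P m' n' : (m' < n')%N -> (n'%:R - m'%:R : F) != 0.
  move=> mn; rewrite -natrB; last exact: ltnW.
  by rewrite -(prednK (_ : 0 < n' - m')%N) ?subn_gt0 // (nat_neq0 c).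
rewrite neq_ltn => /orP[/P|/P //].
by rewrite -oppr_eq0 opprB.
Qed.

(* With N words, the sum S of all tsq (sgn a) is N on the diagonal vectors and
   N - 4 on the others; S * S lies in D, hence so do the diagonal projection, S,
   and every tsq (sgn a) = (tsq (sgn a) * S) * S^-1. *)
Lemma sgn_single k (E : word -> word -> B) : units k E ->
    size (Om k) != 0%N -> size (Om k) != 2%N -> size (Om k) != 4%N ->
    (forall a b, a \in Om k -> b \in Om k -> D (tsq (sgn E a * sgn E b))) ->
  forall a, a \in Om k -> D (tsq (sgn E a)).
Proof.
move=> uE n0 n2 n4 Dab a ak.
pose S := \sum_(b <- Om k) tsq (sgn E b).
pose P := \sum_(b <- Om k) l (E b b) * r (E b b).
pose N : F := (size (Om k))%:R.
have lP : \sum_(b <- Om k) l (E b b) = 1 by rewrite -rmorph_sum uE.2 rmorph1.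
have rP : \sum_(b <- Om k) r (E b b) = 1 by rewrite -rmorph_sum uE.2 rmorph1.
have SE : S = (N - 4%:R) *: 1 + 4%:R *: P.
  transitivity (\sum_(b <- Om k) (1 - 2%:R *: l (E b b) - 2%:R *: r (E b b)
      + 4%:R *: (l (E b b) * r (E b b)))).
    apply: eq_bigr => b _; rewrite /tsq /sgn !rmorphB !rmorph1 /= !(pairZ l r).
    by rewrite !(alg_expand T, alg_scale); linear_over F; rewrite /=; ring.
  rewrite !big_split /= !sumrN -!scaler_sumr lP rP big_const_seq count_predT.
  rewrite -/P (_ : iter _ _ _ = N *: 1); last first.
    by rewrite /N scaler_nat iter_addr_0.
  by linear_over F; rewrite /=; ring.
have PP : P * P = P.
  rewrite {1}/P mulr_suml; apply: eq_big_seq => b bk.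
  rewrite /P mulr_sumr (bigD1_seq b) ?Om_uniq //= big_seq_cond big1 => [|d /andP[dk db]].
    by rewrite addr0 -!/(tsq _) -tsqM (unitM uE).
  by rewrite -!/(tsq _) -tsqM (unitM0 uE) 1?eq_sym // /tsq rmorph0 mul0r.
have SS : S * S = (N - 4%:R) ^+ 2 *: 1 + (8%:R * (N - 2%:R)) *: P.
  rewrite SE !(alg_expand T, alg_scale) PP.
  by linear_over F; rewrite /=; ring.
have DSS : D (S * S).
  rewrite mulr_suml; apply: subalg_sum => // b bk.
  rewrite mulr_sumr; apply: subalg_sum => // d dk.
  by rewrite -tsqM; apply: Dab.
have DP : D P.
  (* The factor is N^2 - (N - 4)^2, the difference of the two eigenvalues of S * S. It rules out N =
     2, while inverting S rules out N = 0 and N = 4. *)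
  apply: (@subalgZK _ _ _ sD (8%:R * (N - 2%:R))).
    by rewrite mulf_neq0 ?(nat_neq0 c 7) ?natB_neq0.
  have -> : (8%:R * (N - 2%:R)) *: P = S * S - (N - 4%:R) ^+ 2 *: 1.
    by rewrite SS addrAC subrr add0r.
  by apply: subalgB => //; apply/(subalgZ sD)/(subalg1 sD).
have N0 : N != 0 by rewrite -[N]subr0 (natB_neq0 n0).
have DaS : D (tsq (sgn E a) * S).
  by rewrite mulr_sumr; apply: subalg_sum => // b bk; rewrite -tsqM; apply: Dab.
have SI : S * (N *: 1 - 4%:R *: P) = (N * (N - 4%:R)) *: 1.
  rewrite SE !(alg_expand T, alg_scale) PP.
  by linear_over F; rewrite /=; ring.
apply: (@subalgZK _ _ _ sD (N * (N - 4%:R))); first by rewrite mulf_neq0 ?natB_neq0.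
have -> : (N * (N - 4%:R)) *: tsq (sgn E a) =
    (tsq (sgn E a) * S) * (N *: 1 - 4%:R *: P).
  by rewrite -mulrA SI -scalerAr mulr1.
apply: (subalgM sD) => //; apply: subalgB => //; apply: (subalgZ sD) => //.
exact: (subalg1 sD).
Qed.

(** Signs and Lie elements have to be carried through the induction together: the swap uses the
    signs of the shorter words, and the signs of the longer words use its Lie elements. Length 2 has
    exactly two words, so the averaging fails there; the signs are then R and -R. *)
Theorem tensor_square_generation k (E : word -> word -> B) : units k.+1 E ->
    (forall m, (m < k)%N -> D (tsq (Rat c m E k.+1))) ->
  (forall a, a \in Om k.+1 -> D (tsq (sgn E a))) /\
  (forall a b, a \in Om k.+1 -> b \in Om k.+1 -> ht a = ht b -> Lie (J E a b)).
Proof.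
elim: k E => [|k IH] E uE HR.
  split=> [a|a b]; rewrite /Om !inE; [move=> /eqP->|move=> /eqP-> /eqP-> _].
    have -> : sgn E [:: false] = - 1.
      have := uE.2; rewrite /Om /= big_seq1 => e.
      by rewrite /sgn e; linear_over F; rewrite /=; ring.
    by rewrite tsqN /tsq !rmorph1 mulr1; apply: (subalg1 sD).
  by rewrite /Jab subrr /Lie !raddf0 addr0; apply: subalg0.
have ud := units_down uE.
have [m mk|Hd Jd] := IH (down E) ud; first by rewrite Rat_down; apply: HR.
have HJ : forall a b, a \in Om k.+2 -> b \in Om k.+2 -> ht a = ht b -> Lie (J E a b).
  apply: (Lie_Jab lr sD uE) => // v vk hv.
  by apply: (Lie_swap lr sD uE) => //; [apply: HR|apply: Hd; rewrite Om0].
split=> //; case: k => [|k] in IH E uE HR ud Hd Jd HJ *; last first.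
  have [] := @size_Om_neq k.+3 isT => n2 n4.
  apply: (sgn_single uE) => //; last exact: sgn_pair_all.
  by apply: contra (n2) => /eqP e; have := size_OmS k.+2; rewrite e leqn0; elim: (k.+2) => // j; have := size_OmS j; lia.
have e10 : sgn E [:: true; false] = Rat c 0 E 2.
  rewrite /Rat /Om /= !big_cons big_nil /= cp0 cq0 /sgn.
  have := uE.2; rewrite /Om /= !big_cons big_nil addr0 => <-.
  by linear_over F; rewrite /=; ring.
have e00 : sgn E [:: false; false] = - Rat c 0 E 2.
  rewrite -e10 /sgn.
  have := uE.2; rewrite /Om /= !big_cons big_nil addr0 => <-.
  by linear_over F; rewrite /=; ring.
move=> a; rewrite /Om !inE => /orP[] /eqP ->.
  by rewrite e00 tsqN; apply: HR.
by rewrite e10; apply: HR.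
Qed.

End Signs.

(** * Symmetrized matrix units *)

Section PairUnits.
Variables (F : fieldType) (c : coefs F) (B T : algType F).
Variables (l r : {lrmorphism B -> T}) (D : T -> Prop).
Hypothesis lr : forall a b, l a * r b = r b * l a.
Hypothesis sD : subalgebra D.
Variables (k : nat) (E : word -> word -> B).
Hypothesis uE : units k E.
Hypothesis Dsgn : forall a, a \in Om k -> D (tsq l r (sgn E a)).
Hypothesis DJ : forall a b, a \in Om k -> b \in Om k -> ht a = ht b ->
  Lie l r D (Jab c E a b).

(** On ordered pairs of distinct words these multiply like matrix units modulo the flip, as [pairUM]
    shows; this is the most that flip-invariant elements can do. *)
Definition pairU a b d e : T := l (E a d) * r (E b e) + l (E b e) * r (E a d).

Lemma pairUC a b d e : pairU a b d e = pairU b a e d.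
Proof. exact: addrC. Qed.

Let mlr w x y z : l w * r x * (l y * r z) = l (w * y) * r (x * z).
Proof. by rewrite !rmorphM /= -!mulrA; congr (_ * _); rewrite !mulrA lr. Qed.

Let l0 x : l 0 * x = 0. Proof. by rewrite rmorph0 mul0r. Qed.
Let r0 x : x * r 0 = 0. Proof. by rewrite rmorph0 mulr0. Qed.

Lemma pairUM a b d e f g : a \in Om k -> b \in Om k -> d \in Om k -> e \in Om k ->
  f \in Om k -> g \in Om k -> ht a = ht d -> ht b = ht e -> ht d = ht f ->
  ht e = ht g -> d != e -> pairU a b d e * pairU d e f g = pairU a b f g.
Proof.
move=> ak bk dk ek fk gk ad be df eg de; have ed : e != d by rewrite eq_sym.
rewrite /pairU !(alg_expand T) !mlr !(unitM uE) // !(unitM0 uE) //.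
by rewrite !l0 addr0 add0r.
Qed.

(** The element 1 - x_a is twice the projection onto the tensors with exactly one factor a; the
    product of two of these leaves a (x) b and b (x) a. *)
Lemma pairU_proj a b : a \in Om k -> b \in Om k -> a != b -> D (pairU a b a b).
Proof.
move=> ak bk ab; have ba : b != a by rewrite eq_sym.
apply: (subalgZK sD (nat_neq0 c 3)).
have -> : 4%:R *: pairU a b a b =
    (1 - tsq l r (sgn E a)) * (1 - tsq l r (sgn E b)).
  have e x : 1 - tsq l r (sgn E x) = 2%:R *: (l (E x x) * r 1)
      + 2%:R *: (l 1 * r (E x x)) - 4%:R *: (l (E x x) * r (E x x)).
    rewrite /tsq /sgn !rmorphB !rmorph1 /= !(pairZ l r).
    by rewrite !(alg_expand T, alg_scale); linear_over F; rewrite /=; ring.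
  rewrite !e /pairU !(alg_expand T, alg_scale) !mlr !mul1r !mulr1.
  rewrite !(unitM0 uE) // !l0 !r0.
  by linear_over F; rewrite /=; ring.
by apply: (subalgM sD); apply: subalgB => //; try apply: (subalg1 sD); apply: Dsgn.
Qed.

(** The Leibniz action of [Jab c E a d], compressed between the projections of the pairs {a, b} and
    {d, b}, retains only the term exchanging a for d. *)
Lemma pairU_move a b d : a \in Om k -> b \in Om k -> d \in Om k -> ht a = ht d ->
  a != b -> d != b -> D (pairU a b d b).
Proof.
move=> ak bk dk ad ab db; have [<-|nad] := eqVneq a d; first exact: pairU_proj.
have ba : b != a by rewrite eq_sym.
have bd : b != d by rewrite eq_sym.
have da : d != a by rewrite eq_sym.
apply: (subalgZK sD (gam_neq0 c dk)).
have -> : gam c d *: pairU a b d b =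
    pairU a b a b * (l (Jab c E a d) * r 1 + l 1 * r (Jab c E a d)) * pairU d b d b.
  rewrite /pairU /Jab !rmorphB /= !(pairZ l r) !(alg_expand T, alg_scale).
  rewrite !mlr !mulr1 !(unitM uE) // !(unitM0 uE) // !l0 !r0.
  rewrite !(scaler0, subr0, addr0, add0r, sub0r, oppr0).
  rewrite ?(alg_expand T, alg_scale) ?mlr ?(unitM uE) // ?(unitM0 uE) // ?mul0r ?mulr0 ?l0 ?r0.
  by linear_over F; rewrite /=; ring.
apply: (subalgM sD); last exact: pairU_proj.
by apply: (subalgM sD); [apply: pairU_proj|rewrite !rmorph1 mulr1 mul1r; apply: DJ].
Qed.

(** One application of X leads from a (x) b to the tensors a (x) a and b (x) b, outside the pairs of
    distinct words, so its square is compressed instead. The square also returns to a (x) b; the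
    last term removes that part. *)
Lemma pairU_swap a b : a \in Om k -> b \in Om k -> ht a = ht b -> a != b ->
  D (pairU a b b a).
Proof.
move=> ak bk ab nab; have ba : b != a by rewrite eq_sym.
pose X := l (Jab c E a b) * r 1 + l 1 * r (Jab c E a b).
have DX : D X by rewrite /X !rmorph1 mulr1 mul1r; apply: DJ.
have g0 : 2%:R * (gam c a * gam c b) != 0.
  by rewrite !mulf_neq0 ?(gam_neq0 c ak) ?(gam_neq0 c bk) ?(nat_neq0 c 1).
apply: (subalgZK sD g0).
have -> : (2%:R * (gam c a * gam c b)) *: pairU a b b a =
    - (pairU a b a b * X * X * pairU a b a b)
    - (2%:R * (gam c a * gam c b)) *: pairU a b a b.
  have XX : X * X = - (gam c a * gam c b) *: (l (E a a + E b b) * r 1 + l 1 * r (E a a + E b b))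
      + 2%:R *: (l (Jab c E a b) * r (Jab c E a b)).
    have JJ : Jab c E a b * Jab c E a b = - (gam c a * gam c b) *: (E a a + E b b).
      rewrite /Jab !(alg_expand B, alg_scale) !(unitM uE) // !(unitM0 uE) //.
      by linear_over F; rewrite /=; ring.
    rewrite /X !(alg_expand T) !mlr JJ !mulr1 !mul1r !(pairZ l r) !alg_scale.
    by linear_over F; rewrite /=; ring.
  rewrite -[pairU a b a b * X * X]mulrA XX /pairU /Jab !rmorphB !rmorphD /= !(pairZ l r).
  rewrite !(alg_expand T, alg_scale) !mlr !mulr1 !(unitM uE) // !(unitM0 uE) // !l0 !r0.
  rewrite !(scaler0, subr0, addr0, add0r, sub0r, oppr0).
  rewrite ?(alg_expand T, alg_scale) ?mlr ?(unitM uE) // ?(unitM0 uE) // ?mul0r ?mulr0 ?l0 ?r0.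
  by linear_over F; rewrite /=; ring.
apply: subalgB => //; last by apply: (subalgZ sD); apply: pairU_proj.
apply: subalgN => //; apply: (subalgM sD); last exact: pairU_proj.
by do 2!apply: (subalgM sD) => //; apply: pairU_proj.
Qed.

(** One factor is moved at a time, in an order keeping every intermediate pair distinct. Such an
    order exists unless the pair is merely swapped, which is [pairU_swap]. *)
Lemma pairU_in a b d e : a \in Om k -> b \in Om k -> d \in Om k -> e \in Om k ->
  ht a = ht d -> ht b = ht e -> a != b -> d != e -> D (pairU a b d e).
Proof.
move=> ak bk dk ek ad be ab de; have ed : e != d by rewrite eq_sym.
have ba : b != a by rewrite eq_sym.
have [db|db] := eqVneq d b; last first.
  rewrite -(@pairUM a b d b d e) //; apply: (subalgM sD); first exact: pairU_move.
  by rewrite pairUC; apply: pairU_move => //; rewrite eq_sym.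
have [ea|ea] := eqVneq e a; first by rewrite db ea in ad *; apply: pairU_swap.
rewrite -(@pairUM a b a e d e) // 1?eq_sym //; apply: (subalgM sD).
  by rewrite pairUC; apply: pairU_move.
by apply: pairU_move => //; rewrite eq_sym.
Qed.

End PairUnits.

(** * Generation of all matrix units by the involutions *)

Section Generation.
Variables (F : fieldType) (c : coefs F) (B : algType F) (D : B -> Prop).
Hypothesis sD : subalgebra D.

(** R fixes the components o and t, so between the idempotents of the shorter words [false :: v] and
    [true :: v] only its off-diagonal entry at a and b survives. *)
Lemma unit_swap k (E : word -> word -> B) v : units k.+2 E -> v \in Om k ->
    (0 < ht v)%N -> D (Rat c 0 E k.+2) ->
    (forall w, w \in Om k.+1 -> D (down E w w)) ->
  D (E (true :: false :: v) (false :: true :: v)) /\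
  D (E (false :: true :: v) (true :: false :: v)).
Proof.
move=> uE vk hv DR Dd.
set a := true :: _; set b := false :: true :: v; set o := false :: false :: v.
have vk0 : false :: v \in Om k.+1 by rewrite Om0.
have vk1 : true :: v \in Om k.+1 by rewrite Om1 vk.
have ak : a \in Om k.+2 by rewrite Om1 vk0.
have bk : b \in Om k.+2 by rewrite Om0.
have ok : o \in Om k.+2 by rewrite Om0.
have ab : ht a = ht b by rewrite /= prednK.
have e0 : down E (false :: v) (false :: v) = E o o + E a a by [].
(* [t] is the unit of [true :: true :: v], or 0 when that is not a ballot word. *)
have [t [tE t0]] : exists t, down E (true :: v) (true :: v) = E b b + t /\
    [/\ E o o * t = 0, E a a * t = 0, E a b * t = 0, t * E o o = 0 & t * E a a = 0]
    /\ t * Rat c 0 E k.+2 = t.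
  rewrite /down; case: ifP => h; last by exists 0; rewrite !mulr0 !mul0r.
  have tk : true :: true :: v \in Om k.+2 by rewrite Om1 vk1.
  exists (E (true :: true :: v) (true :: true :: v)); split=> //; split.
    by split; rewrite (unitM0 uE).
  by rewrite (unit_Rat c uE) //= scale1r scale0r addr0.
case: t0 => -[ot at_ abt to ta] tR.
have D0 := Dd _ vk0; have D1 := Dd _ vk1.
split.
  apply: (subalgZK sD (cq_neq0 c hv)).
  have -> : cq c (ht v) *: E a b = down E (false :: v) (false :: v) * Rat c 0 E k.+2
      * down E (true :: v) (true :: v).
    rewrite e0 tE [(E o o + _) * _]mulrDl !(unit_Rat c uE) //= scale1r scale0r addr0.
    rewrite !(alg_expand B, alg_scale) ot at_ abt !(unitM uE) // ?(unitM0 uE) //.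
    by linear_over F; rewrite /=; ring.
  by apply: (subalgM sD) => //; apply: (subalgM sD).
apply: (subalgZK sD (cq'_neq0 c (ht v))).
have -> : cq' c (ht v) *: E b a = down E (true :: v) (true :: v) * Rat c 0 E k.+2
    * down E (false :: v) (false :: v).
  rewrite e0 tE mulrDl tR (unit_Rat c uE) //=.
  rewrite !(alg_expand B, alg_scale) to ta !(unitM uE) // ?(unitM0 uE) //.
  by linear_over F; rewrite /=; ring.
by apply: (subalgM sD) => //; apply: (subalgM sD).
Qed.

(** Units of the shorter words multiply a unit from both sides without changing its last letters, so
    one unit for given last letters and heights yields all of them ([sand]). The swaps supply one in
    each case except at the extreme heights, where [Dsub] passes between last letters [false] and
    [true] by subtracting from a unit of the shorter words. *)
Theorem generation k (E : word -> word -> B) : units k.+1 E ->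
    (forall m, (m < k)%N -> D (Rat c m E k.+1)) ->
  forall a b, a \in Om k.+1 -> b \in Om k.+1 -> ht a = ht b -> D (E a b).
Proof.
elim: k E => [|k IH] E uE HR.
  move=> a b; rewrite /Om !inE => /eqP-> /eqP-> _.
  by have := uE.2; rewrite /Om /= big_seq1 => ->; apply: (subalg1 sD).
have ud := units_down uE.
have Dd : forall w w', w \in Om k.+1 -> w' \in Om k.+1 -> ht w = ht w' -> D (down E w w').
  by apply: (IH _ ud) => m mk; rewrite Rat_down; apply: HR.
have DR := HR 0 (ltn0Sn k).
have sws v (vk : v \in Om k) (hv : (0 < ht v)%N) :=
  unit_swap uE vk hv DR (fun w wk => Dd w w wk wk erefl).
have sand x y x1 x2 w v v' w' : D (E (x :: v) (y :: v')) ->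
    w \in Om k.+1 -> w' \in Om k.+1 -> v \in Om k.+1 -> v' \in Om k.+1 ->
    x :: w \in Om k.+2 -> y :: w' \in Om k.+2 -> x :: v \in Om k.+2 ->
    y :: v' \in Om k.+2 -> ht w = ht v -> ht v' = ht w' ->
    ht (x :: v) = ht (y :: v') -> x1 = x -> x2 = y ->
  D (E (x1 :: w) (x2 :: w')).
  move=> Dxy wk wk' vk vk' xw yw xv yv hw hw' hxy -> ->.
  have hx : ht (x :: w) = ht (x :: v) by rewrite /= hw.
  have hy : ht (y :: v') = ht (y :: w') by rewrite /= hw'.
  have eL : down E w v * E (x :: v) (y :: v') = E (x :: w) (y :: v').
    rewrite /down mulrDl.
    case: x {Dxy} xw xv hxy hx => xw xv hxy hx.
      move: (xw); rewrite Om1 => /andP[_ ->].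
      rewrite (unitM0 uE) ?Om0 ?add0r //=; last by rewrite hw.
      by rewrite (unitM uE) .
    case: posnP => h; first by rewrite mul0r addr0 (unitM uE).
    rewrite (unitM uE) // (unitM0 uE) ?addr0 ?Om1 ?wk ?vk -?hw ?h //=.
    by rewrite hw.
  have eR : E (x :: w) (y :: v') * down E v' w' = E (x :: w) (y :: w').
    rewrite /down mulrDr.
    have hxw : ht (x :: w) = ht (y :: v') by rewrite hx.
    case: y {Dxy eL} yw yv hxy hy hxw => yw yv hxy hy hxw.
      move: (yv); rewrite Om1 => /andP[_ ->].
      rewrite (unitM0 uE) ?Om0 ?add0r //=; last by rewrite hw'.
      by rewrite (unitM uE).
    case: posnP => h; first by rewrite mulr0 addr0 (unitM uE).
    rewrite (unitM uE) // (unitM0 uE) ?addr0 ?Om1 ?wk' ?vk' -?hw' ?h //=.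
    by rewrite hw'.
  rewrite -eR -eL; apply: (subalgM sD); last by apply: Dd.
  by apply: (subalgM sD) => //; apply: Dd.
have Dsub w w' : w \in Om k.+1 -> w' \in Om k.+1 -> ht w = ht w' -> (0 < ht w)%N ->
    D (E (false :: w) (false :: w')) <-> D (E (true :: w) (true :: w')).
  move=> wk wk' hw h0; have := Dd _ _ wk wk' hw; rewrite /down h0 => DS.
  split=> DE; have := subalgB sD DS DE; last by rewrite addrK.
  by rewrite addrC addKr.
(* At length 2 no swap exists, as nothing of positive height precedes the two letters; the
   idempotents are (1 + R) / 2 and its complement. *)
case: k => [|k] in IH uE HR ud Dd DR sws sand Dsub *.
  have m0 : [:: false] \in Om 1 by [].
  have D0 : D (E [:: false; false] [:: false; false]).
    apply: (subalgZK sD (nat_neq0 c 1)).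
    have -> : 2%:R *: E [:: false; false] [:: false; false] = 1 + Rat c 0 E 2.
      rewrite /Rat /Om /= !big_cons big_nil /= cp0 cq0.
      have := uE.2; rewrite /Om /= !big_cons big_nil addr0 => <-.
      by linear_over F; rewrite /=; ring.
    by apply: (subalgD sD) => //; apply: (subalg1 sD).
  have D1 : D (E [:: true; false] [:: true; false]) by apply/Dsub.
  by move=> a b; rewrite /Om !inE => /orP[] /eqP-> /orP[] /eqP->.
have Sab v : v \in Om k.+1 -> (0 < ht v)%N ->
  let a := true :: false :: v in let b := false :: true :: v in
  [/\ D (E a a), D (E a b), D (E b a) & D (E b b)].
  move=> vk hv a b; have [Dab Dba] := sws v vk hv.
  have ak : a \in Om k.+3 by rewrite Om1 Om0 vk.
  have bk : b \in Om k.+3 by rewrite Om0 Om1 vk.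
  have ab : ht a = ht b by rewrite /= prednK.
  split=> //; first by rewrite -(unitM uE ak bk ak) //; apply: (subalgM sD).
  by rewrite -(unitM uE bk ak bk) //; apply: (subalgM sD).
have v1P v : v \in Om k.+1 -> (0 < ht v)%N -> [/\ true :: v \in Om k.+2,
    false :: v \in Om k.+2, true :: false :: v \in Om k.+3
    & false :: true :: v \in Om k.+3] by move=> vk hv; rewrite !(Om0, Om1) vk hv.
have S00 w w' : w \in Om k.+2 -> w' \in Om k.+2 -> ht w = ht w' -> (ht w <= k)%N ->
    D (E (false :: w) (false :: w')).
  move=> wk wk' hw hk.
  have [|v vk hv] := @ex_word k.+1 (ht w).+1 hk; first by rewrite /= (odd_ht wk) /= negbK.
  have hv0 : (0 < ht v)%N by rewrite hv.
  have [_ _ _ Dbb] := Sab v vk hv0; have [v1 v0 av bv] := v1P v vk hv0.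
  by apply: (sand _ _ _ _ w _ _ w' Dbb) => //; rewrite ?Om0 //= ?hv.
have S11 w w' : w \in Om k.+2 -> w' \in Om k.+2 -> ht w = ht w' -> (1 < ht w)%N ->
    D (E (true :: w) (true :: w')).
  move=> wk wk' hw hk; have h0 := ltnW hk.
  have [||v vk hv] := @ex_word k.+1 (ht w).-1.
  - by have := ht_le wk; case: (ht w).
  - by have := odd_ht wk; rewrite -{1}(prednK h0) /= => /negb_inj.
  have hv0 : (0 < ht v)%N by rewrite hv -ltnS prednK.
  have [Daa _ _ _] := Sab v vk hv0; have [v1 v0 av bv] := v1P v vk hv0.
  have e : ht (false :: v) = ht w by rewrite /= hv prednK.
  by apply: (sand _ _ _ _ w _ _ w' Daa) => //; rewrite ?Om1 ?wk ?wk' -?hw ?e ?h0.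
have S01 w w' : w \in Om k.+2 -> w' \in Om k.+2 -> ht w' = (ht w).+2 ->
    D (E (false :: w) (true :: w')) /\ D (E (true :: w') (false :: w)).
  move=> wk wk' hw.
  have [||v vk hv] := @ex_word k.+1 (ht w).+1.
  - by have := ht_le wk'; rewrite hw.
  - by rewrite /= (odd_ht wk) /= negbK.
  have hv0 : (0 < ht v)%N by rewrite hv.
  have [_ Dab Dba _] := Sab v vk hv0; have [v1 v0 av bv] := v1P v vk hv0.
  split.
    by apply: (sand _ _ _ _ w _ _ w' Dba) => //; rewrite ?Om0 ?Om1 ?wk' ?hw //= ?hv.
  by apply: (sand _ _ _ _ w' _ _ w Dab) => //; rewrite ?Om0 ?Om1 ?wk' ?hw //= ?hv.
case=> [|x w] [|y w']; rewrite ?mem_Om //; rewrite -!mem_Om => xw yw.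
have wk := Om_cons xw; have wk' := Om_cons yw.
have odd_w := odd_ht wk; have le_w := ht_le wk.
case: x y xw yw => [] [] /=; rewrite ?Om0 ?Om1 => xw yw e.
- case/andP: xw => _ h; case/andP: yw => _ h'.
  have hw : ht w = ht w' by rewrite -(prednK h) e prednK.
  have [h1|h1] := ltnP 1 (ht w); first exact: S11.
  have {}h1 : ht w = 1%N by apply/eqP; rewrite eqn_leq h h1.
  apply/Dsub => //; apply: S00 => //; rewrite h1.
  by move: odd_w; rewrite h1 /= negbK; case: (k).
- case/andP: xw => _ h; apply: (proj2 (S01 _ _ wk' wk _)).
  by rewrite -(prednK h) e.
- by case/andP: yw => _ h; apply: (proj1 (S01 _ _ wk wk' _)); rewrite -(prednK h) -e.
case: e => e; have [h1|h1] := leqP (ht w) k; first exact: S00.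
have h0 : (1 < ht w)%N.
  by move: odd_w h1; case: (ht w) => [|[|h]] //=; rewrite negbK; case: (k).
by apply/Dsub => //; [apply: ltnW|apply: S11].
Qed.

End Generation.

(** * The coefficients of the seminormal form *)

Section SeminormalIdentities.
Variables (F : fieldType) (x y z : F).
Hypotheses (x0 : x != 0) (x2 : 1 + x ^+ 2 != 0) (y1 : 1 - y != 0).

(** In these identities x stands for u, y for u^(2(h+1)) and z for u^(2h). With the powers as
    variables they become rational identities within reach of [field]. *)
Lemma sn_p2 : (- ((1 - x ^+ 2) * (1 + y)) / ((1 + x ^+ 2) * (1 - y))) ^+ 2
  + 2%:R * (x ^+ 2 - y) / ((1 + x ^+ 2) * (1 - y))
    * (2%:R * (1 - x ^+ 2 * y) / ((1 + x ^+ 2) * (1 - y))) = 1.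
Proof. by field; rewrite ?x2 ?y1. Qed.

Lemma sn_p0 : 1 - x ^+ 2 != 0 ->
  - ((1 - x ^+ 2) * (1 + x ^+ 2)) / ((1 + x ^+ 2) * (1 - x ^+ 2)) = -1.
Proof. by move=> d; field; rewrite ?x2 ?d. Qed.

Lemma sn_g : z != 0 -> 1 - x ^+ 2 * z != 0 -> 1 - x ^+ 2 * (x ^+ 2 * z) != 0 ->
  (1 - x ^+ 2 * z) * (1 - x ^+ 2 * (x ^+ 2 * z)) / (x ^+ 2 * z)
    * (2%:R * (x ^+ 2 - x ^+ 2 * z) / ((1 + x ^+ 2) * (1 - x ^+ 2 * z))) =
  (1 - z) * (1 - x ^+ 2 * z) / z
    * (2%:R * (1 - x ^+ 2 * (x ^+ 2 * z)) / ((1 + x ^+ 2) * (1 - x ^+ 2 * z))).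
Proof. by move=> z0 d1 d2; field; rewrite ?x2 ?x0 ?d1 ?z0. Qed.

Let d4 : x * x + 1 != 0. Proof. by rewrite addrC -expr2. Qed.

Lemma sn_diag :
  (2%:R * ((x - x^-1) / (1 - y)) - (x - x^-1)) / (x + x^-1) =
  - ((1 - x ^+ 2) * (1 + y)) / ((1 + x ^+ 2) * (1 - y)).
Proof. by field; rewrite ?x2 ?d4 ?x0 ?y1. Qed.

Lemma sn_off :
  2%:R * (x^-1 + (x - x^-1) / (1 - y)) / (x + x^-1) =
  2%:R * (x ^+ 2 - y) / ((1 + x ^+ 2) * (1 - y)).
Proof. by field; rewrite ?x2 ?d4 ?x0 ?y1. Qed.

Lemma sn_same : 1 - x ^+ 2 != 0 ->
  (2%:R * ((x - x^-1) / (1 - x ^ (2 * -1))) - (x - x^-1)) / (x + x^-1) = 1.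
Proof.
move=> d; rewrite (_ : x ^ (2 * -1) = (x ^+ 2)^-1) //.
have d' : x * x - 1 != 0 by rewrite -oppr_eq0 opprB -expr2.
by field; rewrite ?x0 ?d' ?d4.
Qed.

Hypothesis y0 : y != 0.
Let d5 : y - 1 != 0. Proof. by rewrite -oppr_eq0 opprB. Qed.

Lemma sn_diag' :
  (2%:R * ((x - x^-1) / (1 - y^-1)) - (x - x^-1)) / (x + x^-1) =
  - (- ((1 - x ^+ 2) * (1 + y)) / ((1 + x ^+ 2) * (1 - y))).
Proof. by field; rewrite ?x2 ?d4 ?x0 ?y1 ?y0 ?d5. Qed.

Lemma sn_off' :
  2%:R * (x^-1 + (x - x^-1) / (1 - y^-1)) / (x + x^-1) =
  2%:R * (1 - x ^+ 2 * y) / ((1 + x ^+ 2) * (1 - y)).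
Proof. by field; rewrite ?x2 ?d4 ?x0 ?y1 ?y0 ?d5. Qed.

Lemma sn_sq (a b m : F) : b != 0 -> m * (a / b) ^+ 2 = 1 -> m * a ^+ 2 = b ^+ 2.
Proof.
move=> b0; rewrite exprMn exprVn mulrA => /(canRL (mulfVK _)).
by rewrite mul1r; apply; rewrite expf_neq0.
Qed.

End SeminormalIdentities.

Section SeminormalCoefs.
Variables (F : fieldType) (x : F).
Hypotheses (x0 : x != 0) (x1B : forall n, 1 - x ^+ n.+1 != 0).
Hypothesis x1D : forall n, 1 + x ^+ n.+1 != 0.
Hypothesis n0 : forall n, n.+1%:R != 0 :> F.
Hypothesis x2 : forall m n, m.+2%:R * ((1 - x ^+ 2) * (1 + x ^+ n.+1)) ^+ 2
  - ((1 + x ^+ 2) * (1 - x ^+ n.+1)) ^+ 2 != 0.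

(** As x tends to 1 this tends to -1/(h+1), the entry of Young's seminormal form for entries at
    axial distance h + 1. *)
Definition snp h : F :=
  - ((1 - x ^+ 2) * (1 + x ^+ h.+1.*2)) / ((1 + x ^+ 2) * (1 - x ^+ h.+1.*2)).
Definition snq h : F :=
  2%:R * (x ^+ 2 - x ^+ h.+1.*2) / ((1 + x ^+ 2) * (1 - x ^+ h.+1.*2)).
Definition snq' h : F :=
  2%:R * (1 - x ^+ 2 * x ^+ h.+1.*2) / ((1 + x ^+ 2) * (1 - x ^+ h.+1.*2)).
(** The telescoping solution of [cg h.+1 / cg h = cq' h / cq h]. Up to a factor independent of h it
    is the product of the quantum integers [h] and [h+1]. *)
Definition sng h : F := (1 - x ^+ h.*2) * (1 - x ^+ h.+1.*2) / x ^+ h.*2.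

Let den h : (1 + x ^+ 2) * (1 - x ^+ h.+1.*2) != 0.
Proof. by rewrite mulf_neq0 // ?x1D ?x1B. Qed.

Fact snp_sq h : snp h ^+ 2 + snq h * snq' h = 1.
Proof. exact: (sn_p2 (x1D 1) (x1B _)). Qed.

Fact snq0 : snq 0 = 0. Proof. by rewrite /snq subrr mulr0 mul0r. Qed.

Fact snp0 : snp 0 = -1. Proof. exact: (sn_p0 (x1D 1) (x1B 1)). Qed.

Fact snq_neq0 h : (0 < h)%N -> snq h != 0.
Proof.
case: h => // h _; rewrite /snq mulf_neq0 ?invr_neq0 ?den // mulf_neq0 ?n0 //.
have -> : x ^+ h.+2.*2 = x ^+ 2 * x ^+ h.+1.*2 by rewrite -exprD.
by rewrite -{1}[x ^+ 2]mulr1 -mulrBr mulf_neq0 ?expf_neq0 ?x1B.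
Qed.

Fact snq'_neq0 h : snq' h != 0.
Proof. by rewrite /snq' mulf_neq0 ?invr_neq0 ?den // mulf_neq0 ?n0 // -exprD x1B. Qed.

Fact snp_neq0 h : snp h != 0.
Proof. by rewrite /snp mulf_neq0 ?invr_neq0 ?den // oppr_eq0 mulf_neq0 ?x1B ?x1D. Qed.

Fact snp_sq_neq m h : m.+2%:R * snp h ^+ 2 != 1.
Proof.
apply: contraNneq (x2 m h.*2.+1) => e; rewrite /snp in e.
by rewrite -(sn_sq (den h) e) // sqrrN subrr.
Qed.

Fact sng_neq0 h : (0 < h)%N -> sng h != 0.
Proof.
by case: h => // h _; rewrite /sng mulf_neq0 ?invr_neq0 ?expf_neq0 ?mulf_neq0 ?x1B.
Qed.

Fact sng_q h : (0 < h)%N -> sng h.+1 * snq h = sng h * snq' h.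
Proof.
case: h => // h _; rewrite /sng /snq /snq'.
have yE k : x ^+ k.+1.*2 = x ^+ 2 * x ^+ k.*2 by rewrite -exprD.
rewrite [x ^+ h.+3.*2]yE [x ^+ h.+2.*2]yE; apply: sn_g => //; rewrite ?expf_neq0 -?yE ?x1D ?x1B //.
Qed.

Definition sn_coefs : coefs F :=
  Coefs snp_sq snq0 snp0 snq_neq0 snq'_neq0 snp_neq0 (snp_sq_neq 0)
    (snp_sq_neq 2) sng_neq0 sng_q n0.

(* The entries of [seminormal], after rescaling T_s to an involution. *)
Lemma snpE h : let c := (x - x^-1) / (1 - x ^ (2 * (h.+1)%:Z)) in
  (2%:R * c - (x - x^-1)) / (x + x^-1) = snp h /\
  2%:R * (x^-1 + c) / (x + x^-1) = snq h.
Proof.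
rewrite (_ : x ^ (2 * h.+1%:Z) = x ^+ h.+1.*2); last by rewrite -mul2n.
have d := x1B h.*2.+1; have d2 := x1D 1.
by split; [apply: sn_diag|apply: sn_off].
Qed.

Lemma snpE' h : let c := (x - x^-1) / (1 - x ^ (2 * - (h.+1)%:Z)) in
  (2%:R * c - (x - x^-1)) / (x + x^-1) = - snp h /\
  2%:R * (x^-1 + c) / (x + x^-1) = snq' h.
Proof.
rewrite (_ : x ^ (2 * - h.+1%:Z) = (x ^+ h.+1.*2)^-1); last first.
  by rewrite mulrN -invr_expz -mul2n.
have d := x1B h.*2.+1; have d2 := x1D 1; have y0 := expf_neq0 h.+1.*2 x0.
by split; [apply: sn_diag'|apply: sn_off'].
Qed.

End SeminormalCoefs.

(** Used to test the nonvanishing conditions on the coefficients at u = 0. *)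
Lemma fracX_neq0 (P : {poly rat}) : P.[0] != 0 -> tofrac P != 0.
Proof. by rewrite tofrac_eq0; apply: contraNneq => ->; rewrite horner0. Qed.

Lemma u_neq0 : u != 0.
Proof. by rewrite tofrac_eq0 polyX_eq0. Qed.

Lemma natK_neq0 n : n.+1%:R != 0 :> K.
Proof.
have -> : n.+1%:R = tofrac ((n.+1%:R : rat)%:P) by rewrite !rmorph_nat.
by rewrite tofrac_eq0 polyC_eq0 Num.Theory.pnatr_eq0.
Qed.

Lemma u1B_neq0 n : 1 - u ^+ n.+1 != 0.
Proof.
have -> : 1 - u ^+ n.+1 = tofrac (1 - 'X ^+ n.+1) by rewrite !(rmorphB, rmorphXn, rmorph1).
by apply: fracX_neq0; rewrite !hornerE expr0n subr0 oner_neq0.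
Qed.

Lemma u1D_neq0 n : 1 + u ^+ n.+1 != 0.
Proof.
have -> : 1 + u ^+ n.+1 = tofrac (1 + 'X ^+ n.+1) by rewrite !(rmorphD, rmorphXn, rmorph1).
by apply: fracX_neq0; rewrite !hornerE expr0n addr0 oner_neq0.
Qed.

(** The denominator-free form of (m + 2) p^2 <> 1; at u = 0 the left side equals m + 1. *)
Lemma u_sq_neq m n : m.+2%:R * ((1 - u ^+ 2) * (1 + u ^+ n.+1)) ^+ 2
  - ((1 + u ^+ 2) * (1 - u ^+ n.+1)) ^+ 2 != 0.
Proof.
pose P : {poly rat} := m.+2%:R * ((1 - 'X ^+ 2) * (1 + 'X ^+ n.+1)) ^+ 2
  - ((1 + 'X ^+ 2) * (1 - 'X ^+ n.+1)) ^+ 2.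
have -> : m.+2%:R * ((1 - u ^+ 2) * (1 + u ^+ n.+1)) ^+ 2
     - ((1 + u ^+ 2) * (1 - u ^+ n.+1)) ^+ 2 = tofrac P.
  have -> : m.+2%:R = tofrac m.+2%:R :> K by rewrite rmorph_nat.
  rewrite /P; move: (m.+2%:R : {poly rat}) => k.
  by rewrite !(tofracB, tofracM, tofracXn, tofracD, tofrac1).
apply: fracX_neq0; rewrite /P -[m.+2%:R]polyC_natr !hornerE !expr0n /=.
rewrite ?subr0 ?addr0 ?mulr1 ?expr1n ?mulr1.
by rewrite -[m.+2%:R]natr1 addrK Num.Theory.pnatr_eq0.
Qed.

Definition coefsK : coefs K := sn_coefs u_neq0 u1B_neq0 u1D_neq0 natK_neq0 u_sq_neq.

(** * Algebras isomorphic to a product of matrix algebras *)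

Section RightModules.
Variables (F : fieldType) (A : falgType F).
Implicit Types V W X : rmodule A.

Section Action.
Variables (V : rmodule A) (mV : is_module V).

Lemma actD x y : V (x + y) = V x + V y.
Proof. by case: mV => L _ _; rewrite -[x]scale1r L !scale1r. Qed.

Lemma act0 : V 0 = 0.
Proof. by apply: (@addrI _ (V 0)); rewrite -actD !addr0. Qed.

Lemma actZ k x : V (k *: x) = k *: V x.
Proof. by case: mV => L _ _; rewrite -[k *: x]addr0 L act0 addr0. Qed.

Lemma act1 : V 1 = 1%:M. Proof. by case: mV. Qed.

Lemma actM x y : V (x * y) = V x *m V y. Proof. by case: mV. Qed.

Lemma act_sum (J : Type) (s : seq J) (P : pred J) (f : J -> A) :
  V (\sum_(j <- s | P j) f j) = \sum_(j <- s | P j) V (f j).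
Proof. by elim/big_rec2: _ => [|j x y _ <-]; [exact: act0|exact: actD]. Qed.

End Action.

Lemma mod_iso_refl V : mod_iso V V.
Proof.
exists 1%:M; split=> [||b]; last by rewrite mulmx1 mul1mx.
  by rewrite row_free_unit unitmx1.
by rewrite row_full_unit unitmx1.
Qed.

Lemma mod_iso_sym V W : mod_iso V W -> mod_iso W V.
Proof.
case=> P [fP uP PV].
have Pp : P *m pinvmx P = 1%:M by rewrite mulmxVp.
have pP : pinvmx P *m P = 1%:M by rewrite mulVpmx.
exists (pinvmx P); split.
- by apply/row_freeP; exists P.
- by apply/row_fullP; exists P.
- move=> b; rewrite -[LHS]mul1mx -pP -!mulmxA (mulmxA P) -PV.
  by rewrite -!mulmxA Pp mulmx1.
Qed.

Lemma mod_iso_trans V W X : mod_iso V W -> mod_iso W X -> mod_iso V X.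
Proof.
case=> P [fP uP PV] [Q [fQ uQ QW]]; exists (P *m Q); split.
- by rewrite /row_free mxrankMfree.
- case/row_fullP: uP => P' P'P; case/row_fullP: uQ => Q' Q'Q.
  by apply/row_fullP; exists (Q' *m P'); rewrite -mulmxA (mulmxA P') P'P mul1mx.
- by move=> b; rewrite mulmxA PV -mulmxA QW mulmxA.
Qed.

Lemma mod_iso_dim V W : mod_iso V W -> mdim V = mdim W.
Proof.
case=> P [fP uP _]; apply/eqP; rewrite eqn_leq.
by rewrite -{1}(eqP fP) rank_leq_col -(eqP uP) rank_leq_row.
Qed.

Lemma mod_iso0 V W x : mod_iso V W -> W x = 0 -> V x = 0.
Proof.
case=> P [/row_freeP[P' PP'] _ PV] z.
by rewrite -[V x]mulmx1 -PP' mulmxA PV z mulmx0 mul0mx.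
Qed.

Lemma mod_irr_iso V W : is_module V -> mod_iso V W -> mod_irr W -> mod_irr V.
Proof.
move=> mV iso [mW dW iW]; have dE := mod_iso_dim iso; split=> // [|U sU].
  by rewrite dE.
case: iso => P [fP uP PV]; pose U' := (<<U *m P>>)%MS.
have sU' : is_submod U'.
  move=> b; rewrite (eqmxMr _ (genmxE _)) genmxE -mulmxA -PV mulmxA.
  by apply: submxMr; apply: sU.
have rU : \rank U' = \rank U by rewrite genmxE mxrankMfree.
case: (iW U' sU') => [z|fU]; [left|right].
  by apply/eqP; rewrite -mxrank_eq0 -rU z mxrank0.
by apply/eqP; rewrite -rU (eqP fU) dE.
Qed.

End RightModules.

Section MatrixProduct.
Variables (F : fieldType) (A : falgType F) (I : finType) (V : I -> rmodule A).
Hypothesis mV : forall i, is_module (V i).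
Hypothesis dV : forall i, (0 < mdim (V i))%N.
Hypothesis V_inj : forall x, (forall i, V i x = 0) -> x = 0.
Hypothesis V_surj : forall i (b : 'M_(mdim (V i))),
  exists2 x, V i x = b & forall j, j != i -> V j x = 0.

Lemma V_ext x y : (forall i, V i x = V i y) -> x = y.
Proof.
move=> e; apply/eqP; rewrite -subr_eq0; apply/eqP/V_inj => i.
by rewrite actD // -scaleN1r actZ // e scaleN1r subrr.
Qed.

(** Boolean, so that [xchoose] can turn [V_surj] into a function giving the matrix units of A. *)
Definition eu_pred i (k l : 'I_(mdim (V i))) (x : A) :=
  (V i x == delta_mx k l) && [forall j, (j != i) ==> (V j x == 0)].

Fact eu_ex i k l : exists x, @eu_pred i k l x.
Proof.
have [x xi xj] := V_surj (delta_mx k l); exists x; rewrite /eu_pred xi eqxx.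
by apply/forallP => j; apply/implyP => /xj ->.
Qed.

Definition eu i k l : A := xchoose (@eu_ex i k l).

Lemma euE i k l : V i (@eu i k l) = delta_mx k l.
Proof. by case/andP: (xchooseP (@eu_ex i k l)) => /eqP. Qed.

Lemma eu0 i k l j : j != i -> V j (@eu i k l) = 0.
Proof.
by move=> ji; case/andP: (xchooseP (@eu_ex i k l)) => _ /forallP/(_ j); rewrite ji => /eqP.
Qed.

Lemma mul_eu i (k l m : 'I_(mdim (V i))) : eu k l * eu l m = eu k m.
Proof.
apply: V_ext => j; rewrite actM //; have [->|ji] := eqVneq j i.
  by rewrite !euE mul_delta_mx.
by rewrite !eu0 // mul0mx.
Qed.

Lemma eu_act i x (k l : 'I_(mdim (V i))) : eu k l * x = \sum_m V i x l m *: eu k m.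
Proof.
apply: V_ext => j; rewrite actM // act_sum //; have [->|ji] := eqVneq j i.
  rewrite euE; under eq_bigr => m _ do rewrite actZ // euE.
  apply/matrixP => a b; rewrite mxE (bigD1 l) //= big1 => [|c cl]; last first.
    by rewrite mxE (negPf cl) andbF mul0r.
  rewrite addr0 mxE eqxx andbT summxE (bigD1 b) //= big1 => [|c cb]; last first.
    by rewrite !mxE [b == c]eq_sym (negPf cb) andbF mulr0.
  by rewrite addr0 !mxE eqxx andbT mulrC.
by rewrite eu0 // mul0mx big1 // => m _; rewrite actZ // eu0 // scaler0.
Qed.

Lemma act_eu i x (k l : 'I_(mdim (V i))) : x * eu k l = \sum_m V i x m k *: eu m l.
Proof.
apply: V_ext => j; rewrite actM // act_sum //; have [->|ji] := eqVneq j i.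
  rewrite euE; under eq_bigr => m _ do rewrite actZ // euE.
  apply/matrixP => a b; rewrite mxE (bigD1 k) //= big1 => [|c ck]; last first.
    by rewrite mxE (negPf ck) mulr0.
  rewrite addr0 mxE eqxx summxE (bigD1 a) //= big1 => [|c ca]; last first.
    by rewrite !mxE [a == c]eq_sym (negPf ca) mulr0.
  by rewrite addr0 !mxE eqxx.
by rewrite eu0 // mulmx0 big1 // => m _; rewrite actZ // eu0 // scaler0.
Qed.

Lemma sum_eu : \sum_i \sum_k @eu i k k = 1.
Proof.
apply: V_ext => j; rewrite act_sum // act1 // (bigD1 j) //= [X in _ + X]big1 => [|i ij].
  rewrite addr0 act_sum //; under eq_bigr => k _ do rewrite euE.
  apply/matrixP => a b; rewrite summxE mxE (bigD1 a) //= big1 => [|c ca].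
    by rewrite addr0 mxE eqxx eq_sym.
  by rewrite mxE [a == c]eq_sym (negPf ca).
by rewrite act_sum // big1 // => k _; rewrite eu0 // eq_sym.
Qed.

Let o i : 'I_(mdim (V i)) := Ordinal (dV i).

(* Averaging a projection over the separability idempotent
   \sum eu k o (x) eu o k makes it equivariant. *)
Lemma product_semisimple : semisimple A.
Proof.
move=> W mW U sU.
have [p pK pU] : exists2 p : 'M_(mdim W),
    forall m (w : 'M_(m, _)), (w <= U)%MS -> w *m p = w & (p <= U)%MS.
  exists (pinvmx U *m U); last exact: submxMl.
  by move=> m w wU; rewrite mulmxA mulmxKpV.
pose q := \sum_i \sum_k W (@eu i k (o i)) *m p *m W (eu (o i) k).
have Uq m (v : 'M_(m, _)) : (v <= U)%MS -> v *m q = v.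
  move=> vU; rewrite -[RHS]mulmx1 -(act1 mW) -sum_eu act_sum // !mulmx_sumr.
  apply: eq_bigr => i _; rewrite act_sum // !mulmx_sumr; apply: eq_bigr => k _.
  rewrite -(@mul_eu i k (o i) k) actM // !mulmxA; congr (_ *m _).
  rewrite pK //; by apply: submx_trans (submxMr _ vU) (sU _).
have qU : (q <= U)%MS.
  do 2![apply: summx_sub => ? _]; rewrite -mulmxA.
  apply: mulmx_sub; apply: submx_trans (sU _); exact: submxMr.
have qC x : W x *m q = q *m W x.
  rewrite /q mulmx_sumr mulmx_suml; apply: eq_bigr => i _.
  rewrite mulmx_sumr mulmx_suml.
  transitivity (\sum_k \sum_m V i x m k *: (W (eu m (o i)) *m p *m W (eu (o i) k))).
    apply: eq_bigr => k _; rewrite !mulmxA -actM // act_eu act_sum // !mulmx_suml.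
    by apply: eq_bigr => m _; rewrite actZ // -!scalemxAl.
  rewrite exchange_big /=; apply: eq_bigr => k _.
  rewrite -mulmxA -actM // eu_act act_sum // mulmx_sumr.
  by apply: eq_bigr => m _; rewrite actZ // -scalemxAr.
exists (1%:M - q); split.
- by move=> b; rewrite mulmxBl mul1mx -qC -[X in X - _]mulmx1 -mulmxBr submxMl.
- apply/eqP; rewrite -submx0; set C := (U :&: _)%MS.
  have CU : (C <= U)%MS by apply: capmxSl.
  have: (C <= 1%:M - q)%MS by apply: capmxSr.
  case/submxP => D CD.
  by rewrite -(Uq _ _ CU) CD -mulmxA mulmxBl mul1mx (Uq _ q qU) subrr mulmx0 sub0mx.
- rewrite -sub1mx -[X in (X <= _)%MS](subrK q) addmx_sub //.
    exact: addsmxSr.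
  by apply: submx_trans qU (addsmxSl _ _).
Qed.

Lemma product_irr i : mod_irr (V i).
Proof.
split=> // U sU; have [->|[a [b Uab]]] : U = 0 \/ exists a b, U a b != 0.
- have [/existsP[a /existsP[b h]]|h] := boolP [exists a, [exists b, U a b != 0]].
    by right; exists a, b.
  left; apply/matrixP => a b; rewrite mxE; apply/eqP; apply: contraNT h => h.
  by apply/existsP; exists a; apply/existsP; exists b.
- by left.
- right; rewrite -sub1mx; apply/row_subP => c.
  have -> : row c 1%:M = (U a b)^-1 *: (row a U *m V i (eu b c)).
    apply/rowP => e; rewrite euE !mxE (bigD1 b) //= big1 => [|f fb].
      by rewrite !mxE eqxx addr0 mulrA mulVf // mul1r [e == c]eq_sym.
    by rewrite !mxE (negPf fb) mulr0.
  apply: scalemx_sub; apply: submx_trans (sU (eu b c)); exact: submxMr (row_sub _ _).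
Qed.

(** Since 1 is the sum of the [eu k k], one of them has a nonzero row v in W. The vectors v *
    [eu k l], for varying l, then span a nonzero submodule isomorphic to [V i], and irreducibility
    makes it all of W. *)
Lemma product_complete W : mod_irr W -> exists i, mod_iso W (V i).
Proof.
case=> mW dW irr.
have [i [k nz]] : exists i k, W (@eu i k k) != 0.
  have [/existsP[i /existsP[k h]]|h] := boolP [exists i, [exists k, W (@eu i k k) != 0]].
    by exists i, k.
  have: W 1 = 0.
    rewrite -sum_eu act_sum // big1 // => i _; rewrite act_sum // big1 // => k _.
    by apply/eqP; apply: contraNT h => h; apply/existsP; exists i; apply/existsP; exists k.
  rewrite act1 // => /matrixP/(_ (Ordinal dW) (Ordinal dW)).
  by rewrite !mxE eqxx => /eqP; rewrite oner_eq0.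
have [a av] : exists a, row a (W (eu k k)) != 0.
  by apply/existsP; apply: contraNT nz => h; apply/eqP/row_matrixP => a;
     rewrite row0; apply/eqP; apply: contraNT h => h; apply/existsP; exists a.
pose v := row a (W (eu k k)); exists i; apply: mod_iso_sym.
pose P : 'M_(mdim (V i), mdim W) := \matrix_l (v *m W (eu k l)).
have PW b : V i b *m P = P *m W b.
  apply/row_matrixP => l; rewrite !row_mul rowK -mulmxA -actM // eu_act act_sum //.
  rewrite mulmx_sumr mulmx_sum_row; apply: eq_bigr => m _.
  by rewrite actZ // -scalemxAr rowK mxE.
have vk : v *m W (eu k k) = v by rewrite /v -row_mul -actM // mul_eu.
exists P; split=> //.
  apply/inj_row_free => y yP; apply/rowP => l; rewrite [RHS]mxE.
  have: y *m P *m W (eu l k) = y 0 l *: v.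
    rewrite [y *m P]mulmx_sum_row mulmx_suml (bigD1 l) //= big1 => [|m ml].
      by rewrite addr0 rowK -scalemxAl -mulmxA -actM // mul_eu vk.
    rewrite rowK -scalemxAl -mulmxA -actM //.
    rewrite (_ : eu k m * eu l k = 0) ?act0 ?mulmx0 ?scaler0 //.
    apply: V_ext => j; rewrite act0 // actM //; have [->|ji] := eqVneq j i.
      by rewrite !euE mul_delta_mx_0.
    by rewrite !eu0 // mul0mx.
  rewrite yP mul0mx => /eqP; rewrite eq_sym scaler_eq0 (negPf av) orbF.
  by move/eqP.
pose U := (<<P>>)%MS; have sU : is_submod U.
  move=> b; rewrite !(eqmxMr _ (genmxE _)) genmxE -PW; exact: submxMl.
case: (irr U sU) => [U0|]; last by rewrite /row_full genmxE.
move: av; rewrite -/v; have: (v <= P)%MS.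
  by rewrite -vk; apply: submx_trans (row_sub k P); rewrite rowK.
by rewrite -(genmxE P) -/U U0 submx0 => ->.
Qed.

Lemma product_iso_inj i j : mod_iso (V i) (V j) -> i = j.
Proof.
case=> P [fP uP PV]; apply/eqP; apply: contraT => ij.
have := PV (eu (o i) (o i)); rewrite euE eu0 ?mulmx0; last by rewrite eq_sym.
case/row_freeP: fP => P' PP' /(congr1 (mulmx^~ P')).
rewrite -mulmxA PP' mulmx1 mul0mx => /matrixP/(_ (o i) (o i)).
by rewrite !mxE !eqxx => /eqP; rewrite oner_eq0.
Qed.

Lemma product_scalar (W : rmodule A) (X : 'M[F]_(mdim W)) :
  mod_irr W -> (forall b, W b *m X = X *m W b) -> is_scalar_mx X.
Proof.
move=> iW XW; have [i iso] := product_complete iW.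
have [Q [fQ uQ QV]] := iso.
have [R [QQ QQ']] : exists R, Q *m R = 1%:M /\ R *m Q = 1%:M.
  by exists (pinvmx Q); rewrite mulmxVp // mulVpmx.
pose Y := R *m X *m Q.
have YV b : V i b *m Y = Y *m V i b.
  have K m (Z : 'M_(m, _)) : Z *m Q *m R = Z by rewrite -mulmxA QQ mulmx1.
  have -> : V i b = R *m W b *m Q by rewrite -mulmxA QV mulmxA QQ' mul1mx.
  by rewrite /Y !mulmxA !K -(mulmxA _ (W b)) XW mulmxA.
have YE k l : Y k l = (k == l)%:R * Y (o i) (o i).
  have := YV (eu (o i) k); rewrite euE => /matrixP/(_ (o i) l).
  rewrite !mxE (bigD1 k) //= big1 => [|c ck]; last by rewrite !mxE (negPf ck) andbF mul0r.
  rewrite (bigD1 (o i)) //= big1 => [|c ck]; last by rewrite !mxE (negPf ck) mulr0.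
  by rewrite !mxE !eqxx !addr0 mul1r => ->; rewrite mulrC eq_sym.
have [y Yy] : exists y, Y = y%:M.
  by exists (Y (o i) (o i)); apply/matrixP => k l; rewrite YE [RHS]mxE mulr_natl.
apply/is_scalar_mxP; exists y.
have -> : X = Q *m Y *m R by rewrite /Y !mulmxA QQ mul1mx -mulmxA QQ mulmx1.
by rewrite Yy mul_mx_scalar -scalemxAl QQ scalemx1.
Qed.

Theorem product_split_semisimple : split_semisimple A.
Proof. by split; [apply: product_semisimple|move=> W iW X; apply: product_scalar]. Qed.

End MatrixProduct.

(** * Standard tableaux with two rows *)

Fixpoint wof (f : nat -> bool) k : word :=
  if k is k'.+1 then f k' :: wof f k' else [::].

(** When f gives the rows of the entries of a tableau, this is the length of row x before entry k,
    hence by [tab_col] the column of k if k lies in that row. *)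
Definition nlet (x : bool) (f : nat -> bool) k : nat := (\sum_(j < k) (f j == x))%N.

Lemma nletS x f k : nlet x f k.+1 = (nlet x f k + (f k == x))%N.
Proof. by rewrite /nlet big_ord_recr. Qed.

Lemma nlet_le x f k l : (k <= l)%N -> (nlet x f k <= nlet x f l)%N.
Proof.
elim: l => [|l IH]; first by rewrite leqn0 => /eqP->.
rewrite leq_eqVlt => /orP[/eqP->//|kl]; rewrite nletS.
by apply: leq_trans (leq_addr _ _); apply: IH.
Qed.

Lemma nlet_lt x f k l : (k < l)%N -> f k = x -> (nlet x f k < nlet x f l)%N.
Proof.
by move=> kl fk; apply: leq_trans (nlet_le x f kl); rewrite nletS fk eqxx addn1.
Qed.

Lemma nlet_sum f k : (nlet true f k + nlet false f k = k)%N.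
Proof.
elim: k => [|k IH]; first by rewrite /nlet !big_ord0.
by rewrite !nletS addnACA IH; case: (f k); rewrite ?addn0 ?addn1.
Qed.

Lemma nlet_leq x f k : (nlet x f k <= k)%N.
Proof. by have := nlet_sum f k; case: x; lia. Qed.

Lemma eq_nlet x f g k : (forall j, (j < k)%N -> f j = g j) -> nlet x f k = nlet x g k.
Proof. by move=> e; apply: eq_bigr => j _; rewrite e. Qed.

Lemma eq_wof f g k : (forall j, (j < k)%N -> f j = g j) <-> wof f k = wof g k.
Proof.
elim: k => //= k IH; split=> [e|[ek /IH e] j].
  by rewrite e // (proj1 IH) // => j jk; rewrite e // ltnW.
by rewrite ltnS leq_eqVlt => /orP[/eqP->|/e].
Qed.

Lemma size_wof f k : size (wof f k) = k.
Proof. by elim: k => //= k ->. Qed.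

Lemma drop_wof f m k : drop m (wof f (m + k)) = wof f k.
Proof. by elim: m => [|m IH] //; rewrite drop0. Qed.

Lemma wof_word w : w = wof (fun j => nth false (rev w) j) (size w).
Proof.
elim: w => //= x w IH.
have -> : nth false (rev (x :: w)) (size w) = x.
  by rewrite rev_cons nth_rcons size_rev ltnn eqxx.
congr (_ :: _); rewrite {1}IH; apply/eq_wof => j jw.
by rewrite rev_cons nth_rcons size_rev jw.
Qed.

Definition isballot f k := forall j, (j <= k)%N -> (nlet true f j <= nlet false f j)%N.

Lemma isballotP f k : reflect (isballot f k) (ballot (wof f k)).
Proof.
suff: (isballot f k <-> ballot (wof f k)) /\
    (isballot f k -> ht (wof f k) = (nlet false f k - nlet true f k)%N).
  by case=> -[? ?] _; apply: (iffP idP).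
elim: k => [|k [IHb IHh]] /=.
  split; last by rewrite /nlet !big_ord0.
  by split=> // _ j; rewrite leqn0 => /eqP->; rewrite /nlet !big_ord0.
have bS : isballot f k.+1 <-> isballot f k /\ (nlet true f k.+1 <= nlet false f k.+1)%N.
  split=> [b|[b bk] j]; first by split; [move=> j jk; apply/b/leqW|apply: b].
  by rewrite leq_eqVlt => /orP[/eqP->//|/b].
split=> [|/bS[b]]; last first.
  rewrite IHh // !nletS; have := b k (leqnn _); case: (f k) => /=; lia.
rewrite bS !nletS; split=> [[b bk]|/andP[/IHb b bk]].
  rewrite (proj1 IHb b) IHh //=; move: bk; case: (f k) => //=; lia.
split=> //; move: bk; rewrite IHh //; have := b k (leqnn _).
by case: (f k) => /=; lia.
Qed.

Lemma ht_wof f k : isballot f k -> ht (wof f k) = (nlet false f k - nlet true f k)%N.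
Proof.
elim: k => [|k IH] b /=; first by rewrite /nlet !big_ord0.
have b' : isballot f k by move=> j jk; apply/b/leqW.
by rewrite IH // !nletS; have := b' k (leqnn _); case: (f k) => /=; lia.
Qed.

Definition l1 (lam : seq nat) := nth 0 lam 0.
Definition l2 (lam : seq nat) := nth 0 lam 1.
Definition hl (lam : seq nat) : nat := (l1 lam - l2 lam)%N.

Lemma part2_facts r lam : part2 r lam ->
  [/\ (l2 lam <= l1 lam)%N, (l1 lam + l2 lam = r)%N
    & forall i, (1 < i)%N -> nth 0 lam i = 0%N].
Proof.
rewrite /part2 /is_part => /andP[/and3P[s _ /eqP <-] sz].
case: lam s sz => [|a [|b [|c lam]]] //= s _.
- by split=> // i _; rewrite nth_nil.
- by split; rewrite /l1 /l2 //= ?addn0 // => -[|[]].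
- by move: s; rewrite andbT => s; split; rewrite /l1 /l2 //= ?addn0 // => -[|[|[]]].
Qed.

Lemma part2_inj r lam mu : part2 r lam -> part2 r mu -> hl lam = hl mu -> lam = mu.
Proof.
move=> pl pm e; have [a1 a2 _] := part2_facts pl; have [b1 b2 _] := part2_facts pm.
have e1 : l1 lam = l1 mu by move: e; rewrite /hl; lia.
have e2 : l2 lam = l2 mu by move: e; rewrite /hl; lia.
move: pl pm; rewrite /part2 /is_part => /andP[/and3P[_ zl _] sl] /andP[/and3P[_ zm _] sm].
case: lam mu {e a1 a2 b1 b2} e1 e2 zl sl zm sm =>
  [|a [|b [|c lam]]] // [|a' [|b' [|c' mu]]] //; rewrite /l1 /l2 /= => e1 e2.
all: rewrite ?inE -?e1 -?e2 ?eqxx ?orbT ?e1 ?e2 //.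
all: by rewrite ?inE ?e1 ?e2 ?eqxx ?orbT.
Qed.

Section Tableaux.
Variables (n : nat) (lam : seq nat).
Hypothesis plam : part2 n.+1 lam.
Notation tab := {ffun 'I_n.+1 -> 'I_n.+1 * 'I_n.+1}.

Definition frow (t : tab) (j : nat) : bool := (t (inord j)).1 != 0 :> nat.

Section StandardTableau.
Variable t : tab.
Hypothesis st : standard lam t.

Let t_inj : injective t. Proof. by case/and4P: st => /injectiveP. Qed.
Let t_diag k : ((t k).2 < nth 0 lam (t k).1)%N.
Proof. by case/and4P: st => _ /forallP. Qed.
Let t_row k l : (t k).1 = (t l).1 -> ((t k).2 < (t l).2)%N -> (k < l)%N.
Proof.
move=> e h; case/and4P: st => _ _ /forallP/(_ k)/forallP/(_ l) /implyP + _.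
by apply; rewrite e eqxx.
Qed.
Let t_col k l : (t k).2 = (t l).2 -> ((t k).1 < (t l).1)%N -> (k < l)%N.
Proof.
move=> e h; case/and4P: st => _ _ _ /forallP/(_ k)/forallP/(_ l) /implyP.
by apply; rewrite e eqxx.
Qed.

Lemma frow_val k : (t k).1 = frow t k :> nat.
Proof.
rewrite /frow inord_val; have [_ _ z] := part2_facts plam.
have := t_diag k; case: ((t k).1 : nat) (z (t k).1) => [|[|m]] // /(_ isT) ->.
by rewrite ltn0.
Qed.

Let row_eq (k l : 'I_n.+1) : frow t k = frow t l -> (t k).1 = (t l).1.
Proof. by move=> e; apply/val_inj; rewrite /= !frow_val e. Qed.

Let count_cols (x : bool) (P : pred 'I_n.+1) a b :
  (forall l, P l -> frow t l = x /\ (a <= (t l).2 < b)%N) -> (#|P| <= b - a)%N.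
Proof.
move=> HP; pose s := [seq ((t l).2 : nat) | l <- enum P].
have -> : #|P| = size s by rewrite size_map -cardE.
rewrite -(size_iota a (b - a)); apply: uniq_leq_size.
  rewrite map_inj_in_uniq ?enum_uniq // => k l.
  rewrite !mem_enum => /HP[fk _] /HP[fl _] e; apply: t_inj.
  apply/eqP; rewrite -pair_eqE /pair_eq (row_eq (etrans fk (esym fl))) eqxx.
  exact/eqP/val_inj.
move=> c /mapP[l]; rewrite mem_enum => /HP[_ /andP[al lb]] ->.
by rewrite mem_iota al subnKC // (leq_trans al) // ltnW.
Qed.

Let nletE x k : (k <= n.+1)%N -> nlet x (frow t) k =
  #|[pred l : 'I_n.+1 | (frow t l == x) && (l < k)%N]|.
Proof.
move=> kn; rewrite -sum1_card /nlet (big_ord_widen n.+1 (fun j => (frow t j == x) : nat)) //.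
rewrite [RHS]big_mkcond [LHS]big_mkcond; apply: eq_bigr => l _.
by rewrite inE; case: eqP; case: ltnP.
Qed.

Let lrow (x : bool) := nth 0 lam x.

(** Neither row can be overfull, and the two counts add up to the size of the shape, so both rows
    are full. *)
Let nlet_total x : nlet x (frow t) n.+1 = lrow x.
Proof.
have le y : (nlet y (frow t) n.+1 <= lrow y)%N.
  rewrite nletE // -[lrow y]subn0; apply: (@count_cols y) => l /andP[/eqP fl _].
  by split=> //; rewrite /lrow -fl -frow_val t_diag.
have [_ e _] := part2_facts plam; have := nlet_sum (frow t) n.+1.
move: (le true) (le false); rewrite -e /lrow /l1 /l2 /=.
by case: x => /=; lia.
Qed.

(** In the row of k the smaller entries lie in columns to the left of k, and the others in columns
    from that of k onwards. The numbers of available columns bound both counts, and as the row is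
    full both bounds are attained. *)
Lemma tab_col k : (t k).2 = nlet (frow t k) (frow t) k :> nat.
Proof.
set x := frow t k; have kn : (k <= n.+1)%N by apply/ltnW/ltn_ord.
have lt_col (l : 'I_n.+1) : frow t l = x -> (l < k)%N -> ((t l).2 < (t k).2)%N.
  move=> fl lk; rewrite ltnNge leq_eqVlt; apply/norP; split; last first.
    by apply: contraL lk => /(t_row (row_eq (esym fl))) kl; rewrite -leqNgt ltnW.
  apply: contraL lk => /eqP/val_inj e; rewrite -leqNgt.
  by rewrite (@t_inj k l) // [t k]surjective_pairing [t l]surjective_pairing e (row_eq fl).
have up : (nlet x (frow t) k <= (t k).2)%N.
  rewrite nletE // -[X in (_ <= X)%N]subn0; apply: (@count_cols x) => l /andP[/eqP fl lk].
  by split=> //; rewrite lt_col.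
have down : (#|[pred l : 'I_n.+1 | (frow t l == x) && ~~ (l < k)%N]|
             <= lrow x - (t k).2)%N.
  apply: (@count_cols x) => l /andP[/eqP fl lk]; split=> //.
  rewrite /lrow -fl -frow_val t_diag andbT leqNgt; apply: contra lk.
  exact: (t_row (row_eq fl)).
have tot : (nlet x (frow t) k +
    #|[pred l : 'I_n.+1 | (frow t l == x) && ~~ (l < k)%N]| = lrow x)%N.
  rewrite -nlet_total (nletE x kn) (nletE x (leqnn _)).
  rewrite -[RHS](cardID [pred l : 'I_n.+1 | (l < k)%N]).
  congr (_ + _)%N; apply: eq_card => l; rewrite !inE ltn_ord andbT //.
  by rewrite andbC.
have dk := t_diag k; rewrite frow_val -/x -/(lrow x) in dk.
by lia.
Qed.

(** Each entry of the second row has above it a smaller entry of the first row; [tab_col] turns this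
    into a strict inequality between the numbers of letters. *)
Lemma tab_ballot : isballot (frow t) n.+1.
Proof.
have step (l : 'I_n.+1) : frow t l -> (nlet true (frow t) l < nlet false (frow t) l)%N.
  move=> fl; have cl := tab_col l; rewrite fl in cl.
  have [c0 _ _] := part2_facts plam.
  have cl1 : ((t l).2 < l2 lam)%N by have := t_diag l; rewrite frow_val fl.
  have [k fk ck] : exists2 k : 'I_n.+1, frow t k = false & (t k).2 = (t l).2.
    have [/existsP[k /andP[/eqP fk /eqP ck]]|] :=
      boolP [exists k : 'I_n.+1, (frow t k == false) && ((t k).2 == (t l).2)].
      by exists k.
    rewrite negb_exists => /forallP none.
    (* Pigeonhole: if no entry of the first row had the column of [l], the [l1 lam] entries of that
       row would have distinct columns among [l1 lam - 1] values. *)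
    pose s := [seq ((t k).2 : nat) | k <- enum [pred k : 'I_n.+1 | frow t k == false]].
    have us : uniq s.
      rewrite map_inj_in_uniq ?enum_uniq // => k k'; rewrite !mem_enum !inE.
      move=> /eqP fk /eqP fk' e; apply: t_inj.
      rewrite [t k]surjective_pairing [t k']surjective_pairing.
      by rewrite (row_eq (etrans fk (esym fk'))) (val_inj e).
    have ss : {subset s <= rem ((t l).2 : nat) (iota 0 (l1 lam))}.
      move=> c /mapP[k]; rewrite mem_enum inE => /eqP fk ->.
      rewrite mem_rem_uniq ?iota_uniq // inE mem_iota /=.
      have := none k; rewrite fk eqxx /= => ->.
      by have := t_diag k; rewrite frow_val fk.
    have := uniq_leq_size us ss; rewrite size_rem ?mem_iota ?size_iota /=; last lia.
    have -> : size s = l1 lam.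
      rewrite size_map -cardE -[RHS](nlet_total false) nletE //.
      by apply: eq_card => k; rewrite !inE ltn_ord andbT.
    lia.
  have kl : (k < l)%N.
    by apply: t_col; rewrite // !frow_val fk fl.
  have := nlet_lt kl fk; have := tab_col k; rewrite fk ck cl => <-; by [].
move=> j; elim: j => [|j IH] jn; first by rewrite /nlet !big_ord0.
have {IH} := IH (ltnW jn); rewrite !nletS; case fj: (frow t j) => /=; last by lia.
by have := step (Ordinal jn) fj => /=; lia.
Qed.

Lemma tab_ht : ht (wof (frow t) n.+1) = hl lam.
Proof. by rewrite ht_wof ?(nlet_total false) ?(nlet_total true) //; apply: tab_ballot. Qed.

Lemma tab_word : wof (frow t) n.+1 \in Om n.+1.
Proof. by rewrite mem_Om size_wof eqxx; apply/isballotP/tab_ballot. Qed.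

End StandardTableau.

Lemma tab_eq (t t' : tab) : standard lam t ->
  (forall k : 'I_n.+1, (t' k).1 = frow t k :> nat /\
     (t' k).2 = nlet (frow t k) (frow t) k :> nat) -> t' = t.
Proof.
move=> st e; apply/ffunP => k; have [e1 e2] := e k.
rewrite [t k]surjective_pairing [t' k]surjective_pairing.
by congr (_, _); apply: val_inj; rewrite /= ?e1 ?e2 -?(frow_val st) -?(tab_col st).
Qed.

Lemma tab_inj (t t' : tab) : standard lam t -> standard lam t' ->
  wof (frow t) n.+1 = wof (frow t') n.+1 -> t = t'.
Proof.
move=> st st' /eq_wof e; apply: (tab_eq st') => k.
rewrite -(e k (ltn_ord k)) (frow_val st) (tab_col st); split=> //.
by apply: eq_nlet => j jk; apply: e; apply: ltn_trans jk (ltn_ord k).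
Qed.

Lemma tab_surj w : w \in Om n.+1 -> ht w = hl lam ->
  exists2 t : tab, standard lam t & wof (frow t) n.+1 = w.
Proof.
rewrite mem_Om => /andP[/eqP sw]; rewrite (wof_word w) sw.
set f := fun j => _ => /isballotP bf; rewrite ht_wof // => hf.
have [c0 c1 cz] := part2_facts plam; have c2 := nlet_sum f n.+1.
have ff := bf _ (leqnn _).
have t1 : nlet true f n.+1 = l2 lam by move: hf; rewrite /hl; lia.
have t0 : nlet false f n.+1 = l1 lam by move: hf; rewrite /hl; lia.
pose t : tab := [ffun k : 'I_n.+1 => (inord (f k) : 'I_n.+1, inord (nlet (f k) f k) : 'I_n.+1)].
have bl (k : 'I_n.+1) : f k -> (nlet true f k < nlet false f k)%N.
  by move=> fk; have := bf _ (ltn_ord k); rewrite !nletS fk /=; lia.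
have tr (k : 'I_n.+1) : (t k).1 = f k :> nat.
  rewrite ffunE /= inordK //; case fk: (f k) => //.
  by have := bl k fk; have := nlet_leq false f k; have := ltn_ord k; lia.
have tc (k : 'I_n.+1) : (t k).2 = nlet (f k) f k :> nat.
  by rewrite ffunE /= inordK // (leq_ltn_trans (nlet_leq _ _ _)).
have fr (k : nat) : (k < n.+1)%N -> frow t k = f k.
  move=> kn; rewrite /frow -[k in RHS](inordK kn) tr.
  by case: (f _).
exists t; last by apply/eq_wof.
apply/and4P; split.
- apply/injectiveP => k l e.
  have ef : f k = f l.
    by have := congr1 (fun z => val z.1) e; rewrite /= !tr; case: (f k); case: (f l).
  have := congr1 (fun z => val z.2) e; rewrite /= !tc ef => ec.
  apply/val_inj; case: (ltngtP k l) => // [kl|lk].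
    by have := nlet_lt kl ef; rewrite ec ltnn.
  by have := @nlet_lt _ f _ _ lk erefl; rewrite ec ltnn.
- apply/forallP => k; rewrite tr tc; have := @nlet_lt _ f _ _ (ltn_ord k) erefl.
  by case: (f k); rewrite ?t0 ?t1.
- apply/forallP => k; apply/forallP => l; apply/implyP => /andP[/eqP e].
  have ef : f k = f l.
    by have := congr1 val e; rewrite /= !tr; case: (f k); case: (f l).
  rewrite !tc ef; apply: contraTT; rewrite -!leqNgt; exact: nlet_le.
- apply/forallP => k; apply/forallP => l; apply/implyP => /andP[/eqP e].
  have := congr1 val e; rewrite /= !tc !tr.
  case fk: (f k) => //; case fl: (f l) => //= ec _.
  have := bl l fl; rewrite -ec; apply: contraTT; rewrite -!leqNgt; exact: nlet_le.
Qed.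

End Tableaux.

(** * The seminormal form in terms of words *)

Section SeminormalWords.
Variables (n : nat) (lam : seq nat).
Hypothesis plam : part2 n.+1 lam.

Definition wdl (a : 'I_#|SYT n lam|) : word := wof (frow (enum_val a)) n.+1.

Lemma wdl_std (a : 'I_#|SYT n lam|) : standard lam (enum_val a).
Proof. by have := enum_valP a; rewrite inE. Qed.

Lemma wdl_Om a : wdl a \in Om n.+1.
Proof. exact: tab_word plam _ (wdl_std a). Qed.

Lemma wdl_ht a : ht (wdl a) = hl lam.
Proof. exact: tab_ht plam _ (wdl_std a). Qed.

Lemma wdl_inj : injective wdl.
Proof.
move=> a b e; apply: enum_val_inj.
exact: tab_inj plam _ _ (wdl_std a) (wdl_std b) e.
Qed.

Lemma wdl_surj w : w \in Om n.+1 -> ht w = hl lam -> exists a, wdl a = w.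
Proof.
move=> wk hw; have [t st tw] := tab_surj plam wk hw.
have tS : t \in SYT n lam by rewrite inE.
by exists (enum_rank_in tS t); rewrite /wdl enum_rankK_in.
Qed.

Definition swf (f : nat -> bool) i j : bool :=
  if j == i then f i.+1 else if j == i.+1 then f i else f j.

Lemma wof_swf f m i :
  wof (swf f i) (m + i.+2) = take m (wof f (m + i.+2)) ++ sw (drop m (wof f (m + i.+2))).
Proof.
have e k : (k <= i)%N -> wof (swf f i) k = wof f k.
  move=> ki; apply/eq_wof => j jk; rewrite /swf !ltn_eqF //.
    by apply: leq_trans jk (leqW ki).
  exact: leq_trans jk ki.
elim: m => [|m IH].
  by rewrite take0 drop0 /= e // /swf !eqxx gtn_eqF.
rewrite addSn /= IH; congr (_ :: _); rewrite /swf !gtn_eqF //; lia.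
Qed.

Lemma nlet_swf x f i k : (k <= i)%N -> nlet x (swf f i) k = nlet x f k.
Proof. by move=> ki; apply: eq_nlet => j jk; rewrite /swf !ltn_eqF //; lia. Qed.

Lemma nlet_swf2 x f i k : (i.+2 <= k)%N -> nlet x (swf f i) k = nlet x f k.
Proof.
elim: k => // k IH; rewrite leq_eqVlt => /orP[/eqP [<-]|ik].
  rewrite !nletS nlet_swf // {1}/swf eqxx {1}/swf gtn_eqF // eqxx.
  by rewrite -!addnA; congr (_ + _)%N; rewrite addnC.
by rewrite !nletS IH // /swf !gtn_eqF //; lia.
Qed.

Variable i : 'I_n.
Let p0 := widen_ord (leqnSn n) i.
Let p1 : 'I_n.+1 := lift ord0 i.

Lemma simple_val (k : 'I_n.+1) : simple i k =
  (if k == i :> nat then i.+1 else if k == i.+1 :> nat then i : nat else k : nat) :> nat.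
Proof.
rewrite /simple; case: tpermP => [->|->|k0 k1]; first by rewrite /= eqxx.
  by rewrite /= gtn_eqF // eqxx.
case: (eqVneq (k : nat) i) => [e|_]; first by case: k0; apply: val_inj; rewrite /= e.
by case: (eqVneq (k : nat) i.+1) => [e|//]; case: k1; apply: val_inj; rewrite /= e.
Qed.

(** The hypothesis excludes two entries in one row: there swapping letters leaves the word
    unchanged, while swapping the entries destroys standardness. *)
Lemma swap_word (a b : 'I_#|SYT n lam|) :
  frow (enum_val a) i != frow (enum_val a) i.+1 ->
  (enum_val b == [ffun k => enum_val a (simple i k)]) =
  (wdl b == take (n - i.+1) (wdl a) ++ sw (drop (n - i.+1) (wdl a))).
Proof.
set t := enum_val a; set s := enum_val b; set f := frow t => fi.
have nE : (n - i.+1 + i.+2 = n.+1)%N by have := ltn_ord i; lia.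
have -> : take (n - i.+1) (wdl a) ++ sw (drop (n - i.+1) (wdl a)) = wof (swf f i) n.+1.
  by have := wof_swf f (n - i.+1) i; rewrite nE => ->.
have fs (k : 'I_n.+1) : (t (simple i k)).1 = swf f i k :> nat.
  rewrite (frow_val plam (wdl_std a)) -/t -/f simple_val /swf.
  by case: (_ == _); last case: (_ == _).
apply/eqP/eqP => [e|/eq_wof e].
  apply/eq_wof => j jn; rewrite -/s /frow e ffunE fs inordK //.
  by case: swf.
apply/esym/(tab_eq plam (wdl_std b)) => k; rewrite ffunE -/s (e _ (ltn_ord k)) fs; split=> //.
rewrite (tab_col plam (wdl_std a)) -/t -/f.
have -> : nlet (swf f i k) (frow s) k = nlet (swf f i k) (swf f i) k.
  by apply: eq_nlet => j jk; apply: e; apply: ltn_trans jk (ltn_ord k).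
have -> : f (simple i k) = swf f i k.
  by rewrite simple_val /swf; case: (_ == _); last case: (_ == _).
rewrite simple_val; case: eqP => [->|ki].
  rewrite nlet_swf // {1 2}/swf eqxx nletS; case: eqP => [fe|]; last by rewrite addn0.
  by rewrite fe eqxx in fi.
case: eqP => [->|ki1].
  rewrite nletS nlet_swf // /swf eqxx gtn_eqF // eqxx.
  by rewrite eq_sym (negPf fi) addn0.
have [lt|ge] := ltnP k i; first by rewrite nlet_swf // ltnW.
by rewrite nlet_swf2 //; move/eqP: ki; move/eqP: ki1; lia.
Qed.

Lemma content_diff (a : 'I_#|SYT n lam|) (f := frow (enum_val a)) :
  let d := content (enum_val a) p0 - content (enum_val a) p1 in
  let h := ht (wof f i) in
  if f i == f i.+1 then d = -1 else if f i.+1 then d = h.+1%:Z else d = - h.+1%:Z.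
Proof.
have st := wdl_std a; rewrite /content !(tab_col plam st) !(frow_val plam st) /= -/f.
have b : isballot f i.
  by move=> j ji; apply: (tab_ballot plam st); apply: (leq_trans ji); apply/ltnW/ltnW/ltn_ord.
rewrite ht_wof // /bump /= add1n nletS; have := b i (leqnn i).
by case: (f i); case: (f i.+1) => /=; lia.
Qed.

(** Words list the last entry first, so the generator [i] acts at position [n - i.+1] from the
    end. *)
Lemma seminormal_word (a b : 'I_#|SYT n lam|) (m := (n - i.+1)%N) :
  (2%:R * seminormal lam i a b - (b == a)%:R * (u - u^-1)) / (u + u^-1) =
  (wdl a == wdl b)%:R * dg coefsK (drop m (wdl a))
  + (wdl b == take m (wdl a) ++ sw (drop m (wdl a)))%:R * od coefsK (drop m (wdl a)).
Proof.
have fi := @swap_word a b; have cd := content_diff a; rewrite /= in cd.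
set f := frow (enum_val a) in fi cd.
have nE : (m + i.+2 = n.+1)%N by have := ltn_ord i; rewrite /m; lia.
have wE : drop m (wdl a) = f i.+1 :: f i :: wof f i by have := drop_wof f m i.+2; rewrite nE.
rewrite mxE /= -/p0 -/p1; set d := content _ p0 - _ in cd *.
rewrite [wdl a == wdl b]eq_sym (inj_eq wdl_inj).
(* For two entries in one row the content difference is -1, so the diagonal entry of T_s is u and
   becomes 1; the swapped filling is not standard, so there is no off-diagonal entry. *)
have [fE|fN] := eqVneq (f i) (f i.+1).
  rewrite fE eqxx in cd; have oE : od coefsK (drop m (wdl a)) = 0 by rewrite wE /= fE eqxx.
  have dE : dg coefsK (drop m (wdl a)) = 1 by rewrite wE /= fE eqxx.
  rewrite oE dE mulr0 addr0 mulr1; case: (eqVneq b a) => [_|ba].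
    by rewrite cd mul1r (sn_same u_neq0 (u1D_neq0 1) (u1B_neq0 1)).
  case: eqP => [e|_]; last by rewrite mulr0 mul0r subr0 mul0r.
  move: ba; rewrite -(inj_eq wdl_inj) => /eqP[]; apply/eq_wof => j jn.
  rewrite e /frow ffunE !(frow_val plam (wdl_std a)) simple_val inordK // -/f.
  rewrite -/f; case: (eqVneq j i) => [->|_]; last case: (eqVneq j i.+1) => [->|_];
    rewrite -/(frow _ _) -/f -?fE; by case: (f _).
rewrite (negPf fN) in cd; rewrite fi //.
have oE : od coefsK (drop m (wdl a)) =
    if f i.+1 then cq coefsK (ht (wof f i)) else cq' coefsK (ht (wof f i)).
  by rewrite wE /= eq_sym (negPf fN).
have dE : dg coefsK (drop m (wdl a)) =
    if f i.+1 then cp coefsK (ht (wof f i)) else - cp coefsK (ht (wof f i)).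
  by rewrite wE /= eq_sym (negPf fN).
have nsw : wdl a != take m (wdl a) ++ sw (drop m (wdl a)).
  apply/eqP => e; have := congr1 (drop m) e.
  rewrite drop_size_cat ?size_take ?size_wof ?wE; last by rewrite ifT // -[X in (_ < X)%N]nE; lia.
  by case=> e1 _; rewrite e1 eqxx in fN.
have [eba|ba] := eqVneq b a.
  rewrite eba (negPf nsw) mul0r addr0 !mul1r dE; case: (f i.+1) cd => ->.
    by have [-> _] := snpE u_neq0 u1B_neq0 u1D_neq0 (ht (wof f i)).
  by have [-> _] := snpE' u_neq0 u1B_neq0 u1D_neq0 (ht (wof f i)).
rewrite mul0r subr0 mul0r add0r; case: eqP => _; last by rewrite mulr0 !mul0r.
rewrite mul1r oE; case: (f i.+1) cd => ->.
  by have [_ ->] := snpE u_neq0 u1B_neq0 u1D_neq0 (ht (wof f i)).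
by have [_ ->] := snpE' u_neq0 u1B_neq0 u1D_neq0 (ht (wof f i)).
Qed.

End SeminormalWords.

(** * Counting permutations by two-row insertion *)

Fixpoint dominates (R C : seq nat) : bool :=
  match R, C with
  | _, [::] => true
  | [::], _ => false
  | a :: R', b :: C' => (a < b)%N && dominates R' C'
  end.

Lemma dominates_size R C : dominates R C -> (size C <= size R)%N.
Proof. by elim: R C => [|a R IH] [|b C] //= /andP[_ /IH]. Qed.

Lemma dominates_count k R C : dominates R C ->
  (count (fun x => x < k)%N C <= count (fun x => x < k)%N R)%N.
Proof.
elim: R C => [|a R IH] [|b C] //= /andP[ab /IH]; apply: leq_add.
by case: (ltnP b k) => // bk; rewrite (ltn_trans ab bk).
Qed.

Lemma dominates_rcons R C x : dominates R C -> dominates (rcons R x) C.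
Proof. by elim: R C => [|a R IH] [|b C] //= /andP[-> /IH]. Qed.

(** All of C is below y, which sits in column [size A] of the first row, so C has at most [size A]
    letters. Hence y is appended under a letter of A or under x, both smaller than y. *)
Lemma dominates_bump A B C x y : dominates (A ++ y :: B) C ->
  all (fun c => c < y)%N C -> all (fun a => a < x)%N A -> (x < y)%N ->
  dominates (A ++ x :: B) (rcons C y).
Proof.
elim: A C => [|a A IH] [|b C] //=.
- by move=> _ _ _ ->; case: B.
- by case/andP=> yb _ /andP[/(ltn_trans yb)]; rewrite ltnn.
- by move=> _ _ /andP[ax _] /(ltn_trans ax) ->; case: (A ++ _).
- by case/andP=> -> dC /andP[_ aC] /andP[_ aA] xy; apply: IH.
Qed.

Variant row_insert_spec x (R : seq nat) : seq nat * option nat -> Prop :=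
  | RowAppend : all (fun a => a < x)%N R -> row_insert_spec x R (rcons R x, None)
  | RowBump A y B : R = A ++ y :: B -> all (fun a => a < x)%N A -> (x < y)%N ->
      row_insert_spec x R (A ++ x :: B, Some y).

Lemma row_insertP x R : x \notin R -> row_insert_spec x R (row_insert x R).
Proof.
elim: R => [|y R IH] /=; first by constructor.
rewrite inE negb_or => /andP[xy /IH]; case: ltnP => [lt _|ge].
  exact: (@RowBump _ _ [::] y R).
have yx : (y < x)%N by rewrite ltn_neqAle eq_sym xy.
case=> [aR|A z B -> aA xz]; first by apply: RowAppend; rewrite /= yx.
by apply: (@RowBump _ _ (y :: A) z B); rewrite //= yx.
Qed.

(* Two-row insertion of a sequence given last letter first, with its recording
   word; [None] when a third row is needed. *)
Fixpoint run (s : seq nat) : option (seq nat * seq nat * word) :=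
  if s is x :: s' then
    if run s' is Some (R1, R2, q) then
      let: (R1', b) := row_insert x R1 in
      if b is Some y then
        let: (R2', b') := row_insert y R2 in
        if b' is Some _ then None else Some (R1', R2', true :: q)
      else Some (R1', R2, false :: q)
    else None
  else Some ([::], [::], [::]).

Definition rows (R1 R2 : seq nat) : seq (seq nat) :=
  if R1 is [::] then [::] else if R2 is [::] then [:: R1] else [:: R1; R2].

Definition run_inv (s : seq nat) R1 R2 (q : word) :=
  [/\ pairwise ltn R1, pairwise ltn R2, perm_eq (R1 ++ R2) s, dominates R1 R2
    & [/\ size q = size s, ballot q & ht q = (size R1 - size R2)%N]].

Lemma runP s R1 R2 q : uniq s -> run s = Some (R1, R2, q) -> run_inv s R1 R2 q.
Proof.
elim: s R1 R2 q => [|x s IH] R1 R2 q /=; first by move=> _ [<- <- <-].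
case/andP=> xs us; case: (run s) IH => [[[A1 A2] q0]|] // /(_ A1 A2 q0 us erefl).
case=> s1 s2 pm dm [sq bq hq].
have x1 : x \notin A1 by apply: contra xs; rewrite -(perm_mem pm) mem_cat => ->.
have uA : uniq (A1 ++ A2) by rewrite (perm_uniq pm).
have le12 := dominates_size dm.
case: (row_insertP x1) => [a1|A y B eA aA xy].
  case=> <- <- <-; split=> //; first by rewrite pairwise_rcons a1.
  - apply/seq.permP => P; have := seq.permP pm P.
    by rewrite -cats1 !count_cat /=; clear; lia.
  - exact: dominates_rcons.
  - by split; rewrite /= ?sq ?bq // hq size_rcons subSn.
have y2 : y \notin A2.
  move: uA; rewrite cat_uniq => /and3P[_ /hasPn h _]; apply/negP => /h.
  by rewrite eA mem_cat inE eqxx orbT.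
case: (row_insertP y2) => // a2 [<- <- <-].
have dm' : dominates (A ++ x :: B) (rcons A2 y) by apply: dominates_bump; rewrite -?eA.
split=> //.
- move: s1; rewrite eA !pairwise_cat !allrel_consr /= => /and4P[/andP[_ AB] pA yB pB].
  rewrite AB pA pB aA /= andbT; apply: sub_all yB => z; exact: ltn_trans.
- by rewrite pairwise_rcons a2.
- apply/seq.permP => P; have := seq.permP pm P.
  by rewrite eA -cats1 !count_cat /= ?count_cat /=; clear; lia.
- split; rewrite /= ?sq ?bq //.
    by rewrite hq subn_gt0; move: (dominates_size dm'); rewrite size_rcons eA !size_cat.
  by rewrite hq size_rcons eA !size_cat /= subnS.
Qed.

(** The recording word tells whether the last insertion bumped. If not, x is the last letter of the
    first row. If so, the bumped y is the last letter of the second row, and x is the largest letter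
    of the first row below y. *)
Lemma run_inj s s' R1 R2 q : uniq s -> uniq s' ->
  run s = Some (R1, R2, q) -> run s' = Some (R1, R2, q) -> s = s'.
Proof.
elim: s s' R1 R2 q => [|x s IH] [|x' s'] R1 R2 q us us'.
- by [].
- move=> /= [<- <- <-]; case: (run s') => [[[? ?] ?]|] //.
  by case: (row_insert _ _) => ? [?|] //; case: (row_insert _ _) => ? [?|].
- move=> /= r1 [e1 e2 e3]; move: r1; rewrite -e3; case: (run s) => [[[? ?] ?]|] //.
  by case: (row_insert _ _) => ? [?|] //; case: (row_insert _ _) => ? [?|].
move: us us' => /= /andP[xs us] /andP[xs' us'].
case rs: (run s) => [[[A1 A2] q0]|] //; case rs': (run s') => [[[A1' A2'] q0']|] //.
have [p1 p2 pm dm _] := runP us rs; have [p1' p2' pm' dm' _] := runP us' rs'.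
have x1 : x \notin A1 by apply: contra xs; rewrite -(perm_mem pm) mem_cat => ->.
have x1' : x' \notin A1' by apply: contra xs'; rewrite -(perm_mem pm') mem_cat => ->.
have uA : uniq (A1 ++ A2) by rewrite (perm_uniq pm).
have uA' : uniq (A1' ++ A2') by rewrite (perm_uniq pm').
have y2 A y B (C D : seq nat) : C = A ++ y :: B -> uniq (C ++ D) -> y \notin D.
  move=> -> ; rewrite cat_uniq => /and3P[_ /hasPn h _]; apply/negP => /h.
  by rewrite mem_cat inE eqxx orbT.
case: (row_insertP x1) => [a1|A y B eA aA xy]; case: (row_insertP x1') => [a1'|A' y' B' eA' aA' xy'].
- case=> <- <- <- [/rcons_inj[e1 ->] e2 e3]; congr (_ :: _).
  by apply: (IH _ A1 A2 q0) => //; rewrite rs' e1 e2 e3.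
- by case=> _ _ <-; case: (row_insert _ _) => ? [?|].
- case: (row_insert _ _) => ? [?|] // [_ _ <-]; by case.
have := row_insertP (y2 _ _ _ _ _ eA uA); case=> // a2 [<- <- <-].
have := row_insertP (y2 _ _ _ _ _ eA' uA'); case=> // a2' [e1 /rcons_inj[e2 ey] e3].
rewrite {}ey in eA' xy' a2'.
have flt C z D w : pairwise ltn (C ++ w :: D) -> all (fun a => a < z)%N C -> (z < w)%N ->
    [seq i <- C ++ z :: D | (i < w)%N] = rcons C z.
  rewrite pairwise_cat allrel_consr /= => /and4P[_ _ wD _] Cz zw.
  rewrite filter_cat /= zw -cats1; congr (_ ++ _ :: _).
    apply/all_filterP; apply: sub_all Cz => i iz; exact: ltn_trans iz zw.
  by apply/eqP; rewrite -size_eq0 size_filter -leqn0 leqNgt -has_count; apply/hasPn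
    => i /(allP wD) wi; rewrite -leqNgt ltnW.
have f1 : rcons A x = rcons A' x'.
  rewrite -(flt A x B y) -?eA // -(flt A' x' B' y) -?eA' //.
  by rewrite e1.
have [eAA exx] := rcons_inj f1.
have eB : B = B' by move/eqP: e1; rewrite eAA exx eqseq_cat // eqxx => /eqP[].
rewrite exx; congr (_ :: _); apply: (IH _ A1 A2 q0) => //.
by rewrite rs' eA eA' eAA eB e2 e3.
Qed.

Lemma size_rsk_insert x P : (size P <= size (rsk_insert x P))%N.
Proof.
elim: P x => //= R P IH x; case: (row_insert x R) => R' [y|] //=.
exact: IH.
Qed.

Lemma row_insert_nil x R : (row_insert x R).1 != [::].
Proof. by case: R => //= y R; case: ifP => // _; case: (row_insert x R). Qed.

Lemma run_rsk s : (size (foldr rsk_insert [::] s) <= 2)%N ->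
  exists R1 R2 q, [/\ run s = Some (R1, R2, q), foldr rsk_insert [::] s = rows R1 R2
    & R1 = [::] -> R2 = [::]].
Proof.
elim: s => [|x s IH] /= sz; first by exists [::], [::], [::].
have [R1 [R2 [q [-> e R0]]]] := IH (leq_trans (size_rsk_insert _ _) sz).
rewrite e in sz *; case: R1 R0 {e} sz => [|a R1] R0 sz.
  by rewrite R0 //=; exists [:: x], [::], (false :: q).
have := row_insert_nil x (a :: R1).
have E : rows (a :: R1) R2 = (a :: R1) :: (if R2 is [::] then [::] else [:: R2]).
  by case: (R2).
rewrite E /= -/(row_insert x (a :: R1)) in sz *.
have E' R : R != [::] -> rows R R2 = R :: (if R2 is [::] then [::] else [:: R2]).
  by case: R => // ? ?; case: (R2).
case: (row_insert x (a :: R1)) sz => R [y|] /= sz Rn; last first.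
  by exists R, R2, (false :: q); rewrite E' //; split=> // R0'; rewrite R0' in Rn.
case: R2 {R0 E E'} sz => [|b R2] sz.
  exists R, [:: y], (true :: q); split=> //; last by move=> R0'; rewrite R0' in Rn.
  by case: R Rn {sz}.
move: sz => /=; rewrite -/(row_insert y (b :: R2)).
have := row_insert_nil y (b :: R2).
case: (row_insert y (b :: R2)) => R' [z|] //= Rn' _.
exists R, R', (true :: q); split=> //; last by move=> R0'; rewrite R0' in Rn.
by case: R R' Rn Rn' => // ? ? [].
Qed.

(** * The pair of words of a permutation *)

Definition perm_seq r (w : 'S_r) : seq nat := rev [seq val (w i) | i <- enum 'I_r].

Lemma perm_seq_inj r : injective (@perm_seq r).
Proof.
move=> w w' /(can_inj revK) e; apply/permP => i; apply: val_inj.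
by have /eq_in_map := e; apply; rewrite mem_enum.
Qed.

Lemma perm_seq_uniq r (w : 'S_r) : uniq (perm_seq w).
Proof. by rewrite rev_uniq map_inj_uniq ?enum_uniq // => i j /val_inj/perm_inj. Qed.

Lemma mem_perm_seq r (w : 'S_r) x : (x \in perm_seq w) = (x < r)%N.
Proof.
rewrite mem_rev; apply/mapP/idP => [[i _ ->]|xr]; first exact: ltn_ord.
by exists (w^-1%g (Ordinal xr)); rewrite ?mem_enum // permKV.
Qed.

Lemma size_perm_seq r (w : 'S_r) : size (perm_seq w) = r.
Proof. by rewrite size_rev size_map size_enum_ord. Qed.

Lemma rsk_PE r (w : 'S_r) : rsk_P w = foldr rsk_insert [::] (perm_seq w).
Proof. by rewrite /rsk_P /perm_seq -foldl_rev revK. Qed.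

(** Its size is the sum over the two-row shapes of the squared numbers of standard tableaux. *)
Definition Om2 r : seq (word * word) :=
  [seq p <- [seq (a, b) | a <- Om r, b <- Om r] | ht p.1 == ht p.2].

Lemma mem_Om2 r a b : ((a, b) \in Om2 r) = [&& a \in Om r, b \in Om r & ht a == ht b].
Proof.
rewrite mem_filter /= andbC; apply/andP/and3P => [[/allpairsP[[x y] [? ? [-> ->]]] ?]|[? ? ?]] //.
by split=> //; apply/allpairsP; exists (a, b).
Qed.

Lemma Om2_uniq r : uniq (Om2 r).
Proof.
by rewrite filter_uniq // allpairs_uniq ?Om_uniq // => -[? ?] [? ?] _ _ [-> ->].
Qed.

(* The two words of w record, for each entry, its row in the insertion and in
   the recording tableau. *)
Definition rsk_words r (w : 'S_r) : word * word :=
  if run (perm_seq w) is Some (R1, R2, q) then (wof (fun j => j \in R2) r, q)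
  else ([::], [::]).

Section RskWords.
Variables (r : nat) (w : 'S_r).
Hypothesis sz : (size (rsk_P w) <= 2)%N.

Lemma rsk_words_run : exists R1 R2 q, run (perm_seq w) = Some (R1, R2, q).
Proof.
by move: sz; rewrite rsk_PE => /run_rsk[R1 [R2 [q [? _ _]]]]; exists R1, R2, q.
Qed.

(** The rows are increasing and partition 0, ..., r - 1, so [R2] determines [R1]. Counting the
    letters below k in each row turns column strictness into the ballot condition. *)
Lemma run_rows R1 R2 q : run (perm_seq w) = Some (R1, R2, q) ->
  [/\ R1 = [seq j <- iota 0 r | j \notin R2], R2 = [seq j <- iota 0 r | j \in R2],
      isballot (fun j => j \in R2) r & ht (wof (fun j => j \in R2) r) = ht q].
Proof.
move=> /(runP (perm_seq_uniq w)) [p1 p2 pm dm [sq bq hq]].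
have uA : uniq (R1 ++ R2) by rewrite (perm_uniq pm) perm_seq_uniq.
have mA j : (j \in R1) || (j \in R2) = (j < r)%N.
  by rewrite -mem_cat (perm_mem pm) mem_perm_seq.
have dis j : j \in R1 -> j \notin R2.
  move: uA; rewrite cat_uniq => /and3P[_ /hasPn h _] j1; apply/negP => /h.
  by rewrite j1.
have srt s t : pairwise ltn s -> pairwise ltn t -> s =i t -> s = t.
  rewrite -!sorted_pairwise; try exact: ltn_trans.
  by apply: irr_sorted_eq; [apply: ltn_trans|move=> x; apply: ltnn].
have iot P : pairwise ltn [seq j <- iota 0 r | P j].
  by apply: pairwise_filter; rewrite -sorted_pairwise ?iota_ltn_sorted //; apply: ltn_trans.
have e1 : R1 = [seq j <- iota 0 r | j \notin R2].
  apply: srt => // j; rewrite mem_filter mem_iota /= -mA.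
  by case j1: (j \in R1); rewrite ?(dis _ j1) //=; case: (j \in R2).
have e2 : R2 = [seq j <- iota 0 r | j \in R2].
  apply: srt => // j; rewrite mem_filter mem_iota /= -mA.
  by case: (j \in R2); rewrite ?orbT ?andbF.
have nl x k : (k <= r)%N -> nlet x (fun j => j \in R2) k =
    count (fun j => j < k)%N (if x then R2 else R1).
  move=> kr; have -> : (if x then R2 else R1) = [seq j <- iota 0 r | (j \in R2) == x].
    by case: x; [rewrite [LHS]e2|rewrite [LHS]e1]; apply: eq_filter => j; case: (j \in R2).
  rewrite count_filter /nlet -(big_mkord xpredT (fun j => ((j \in R2) == x) : nat)).
  rewrite /index_iota subn0 -sum1_count -[in RHS](subnKC kr) iotaD big_cat /=.
  rewrite [X in (_ + X)%N]big1_seq ?addn0 => [|j]; last first.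
    by rewrite mem_iota add0n => /andP[/andP[jk _] /andP[kj _]]; rewrite ltnNge kj in jk.
  rewrite [RHS]big_mkcond; apply: eq_big_seq => j; rewrite mem_iota add0n => /andP[_ jk].
  by rewrite jk /=; case: (_ == x).
have b : isballot (fun j => j \in R2) r.
  by move=> k kr; rewrite !nl //; apply: dominates_count.
split=> //; rewrite ht_wof // !nl // hq; congr (_ - _)%N; apply/eqP; rewrite -all_count;
  by apply/allP => j jR; rewrite -mA jR ?orbT.
Qed.

Lemma rsk_words_Om2 : rsk_words w \in Om2 r.
Proof.
have [R1 [R2 [q rw]]] := rsk_words_run; rewrite /rsk_words rw mem_Om2.
have [_ _ b h] := run_rows rw; have [_ _ _ _ [sq bq _]] := runP (perm_seq_uniq w) rw.
by rewrite !mem_Om size_wof sq size_perm_seq !eqxx bq h eqxx /= !andbT; apply/isballotP.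
Qed.

End RskWords.

Lemma rsk_words_inj r (w w' : 'S_r) : (size (rsk_P w) <= 2)%N ->
  (size (rsk_P w') <= 2)%N -> rsk_words w = rsk_words w' -> w = w'.
Proof.
move=> sz sz'; have [R1 [R2 [q rw]]] := rsk_words_run sz.
have [R1' [R2' [q' rw']]] := rsk_words_run sz'.
rewrite /rsk_words rw rw' => -[/eq_wof e eq].
have [e1 e2 _ _] := run_rows rw; have [e1' e2' _ _] := run_rows rw'.
have e2E : R2 = R2'.
  rewrite e2 e2'; apply: eq_in_filter => j; rewrite mem_iota => /andP[_ jr].
  exact: e.
have e1E : R1 = R1' by rewrite e1 e1' e2E.
apply: perm_seq_inj; apply: (run_inj (perm_seq_uniq _) (perm_seq_uniq _) rw).
by rewrite rw' e1E e2E eq.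
Qed.

(** The upper half of a dimension count; the lower half is the linear independence of the lifted
    units in [TL_units]. *)
Lemma card_two_row r : (#|[pred w : 'S_r | (size (rsk_P w) <= 2)%N]| <= size (Om2 r))%N.
Proof.
rewrite cardE -(size_map (@rsk_words r)); apply: uniq_leq_size.
  rewrite map_inj_in_uniq ?enum_uniq // => w w'; rewrite !mem_enum !inE.
  exact: rsk_words_inj.
by move=> p /mapP[w]; rewrite mem_enum inE => sz ->; apply: rsk_words_Om2.
Qed.

(** * The dimension of the Temperley-Lieb quotient *)

Definition evu (p : {poly int}) : K := (map_poly intr p).[u].

Lemma evuE p : evu p = tofrac (map_poly intr p).
Proof.
rewrite /evu; elim/poly_ind: p => [|p c IH]; first by rewrite !rmorph0 horner0.
rewrite !rmorphD !rmorphM /= !map_polyX !map_polyC /= hornerD hornerM hornerX hornerC IH.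
by rewrite [(c%:~R)%:P]rmorph_int rmorph_int.
Qed.

Fact evu_is_zmod_morphism : zmod_morphism evu.
Proof. by move=> p q; rewrite /evu rmorphB hornerD hornerN. Qed.

Fact evu_is_monoid_morphism : monoid_morphism evu.
Proof.
by split=> [|p q]; [rewrite /evu rmorph1 hornerC|rewrite /evu rmorphM hornerM].
Qed.

HB.instance Definition _ :=
  GRing.isZmodMorphism.Build {poly int} K evu evu_is_zmod_morphism.
HB.instance Definition _ :=
  GRing.isMonoidMorphism.Build {poly int} K evu evu_is_monoid_morphism.

Lemma evu_neq0 p : p.[0] = 1 -> evu p != 0.
Proof.
move=> p0; rewrite evuE; apply: fracX_neq0.
by rewrite -[0](rmorph0 (intr : int -> rat)) horner_map p0 rmorph1 oner_neq0.
Qed.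

Section Dimension.
Variables (n : nat) (H : falgType K) (T : 'S_n.+1 -> H) (C : 'S_n.+1 -> H).
Hypothesis hT : is_hecke T.
Hypothesis hC : forall w, is_kl T w (C w).

(** The matrix of the C_w in the basis T is integral in u and the identity modulo u, so its
    determinant is a polynomial with constant term 1. *)
Lemma kl_free : free [seq C w | w <- enum 'S_n.+1].
Proof.
pose N := #|'S_n.+1|.
have Hij (i j : 'I_N) : exists p : {poly int},
    hcoord T (enum_val j) (C (enum_val i)) = (i == j)%:R + u * evu p.
  have [_ /(_ (enum_val j)) [p e]] := hC (enum_val i).
  by exists p; rewrite /evu -e addrC eq_sym (inj_eq enum_val_inj) subrK.
have [P HP] := fin_all_exists (fun i => fin_all_exists (Hij i)).
pose M : 'M[{poly int}]_N := 1%:M + \matrix_(i, j) ('X * P i j).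
have detM : evu (\det M) != 0.
  apply: evu_neq0; rewrite -[LHS]/(horner_eval 0 _) -det_map_mx.
  rewrite (_ : map_mx _ _ = 1%:M) ?det1 //.
  apply/matrixP => i j; rewrite !mxE /= /horner_eval hornerD hornerM hornerX mul0r addr0.
  by rewrite hornerMn hornerC.
have ME : map_mx evu M = \matrix_(i, j) hcoord T (enum_val j) (C (enum_val i)).
  apply/matrixP => i j; rewrite !mxE HP rmorphD rmorphM rmorph_nat /=; congr (_ + _ * _).
  by rewrite /evu map_polyX hornerX.
have sz : size [seq C w | w <- enum 'S_n.+1] == N by rewrite size_map -cardE.
apply/(@freeP _ _ _ (Tuple sz)) => k k0 i.
have: (\row_j k j) *m map_mx evu M = 0.
  apply/rowP => j; rewrite ME !mxE.
  have := congr1 (hcoord T (enum_val j)) k0.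
  rewrite /hcoord linear_sum /= linear0 => e0; rewrite -[RHS]e0; apply: eq_bigr => l _.
  rewrite !mxE linearZ /=; congr (_ * coord _ _ _).
  have lt : (l < size (enum 'S_n.+1))%N by rewrite -cardE; apply: ltn_ord.
  by rewrite (nth_map (enum_default l)).
have: map_mx evu M \in unitmx by rewrite unitmxE det_map_mx unitfE.
move=> uM /(congr1 (mulmx^~ (invmx (map_mx evu M)))).
by rewrite mulmxK // mul0mx => /rowP/(_ i); rewrite !mxE.
Qed.

Lemma dim_quotient (H2 : falgType K) (pi : 'AHom(H, H2)) :
  limg pi = fullv ->
  lker pi = <<[seq C w | w <- enum 'S_n.+1 & (2 < size (rsk_P w))%N]>>%VS ->
  (\dim {:H2} <= size (Om2 n.+1))%N.
Proof.
move=> sp kp; apply: leq_trans (card_two_row n.+1).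
have dH : \dim {:H} = #|'S_n.+1|.
  by case: hT => bT _ _; apply: (@size_basis _ _ _ _ (codom_tuple T)).
have dk : \dim (lker pi) = #|[pred w : 'S_n.+1 | (2 < size (rsk_P w))%N]|.
  rewrite kp; have fk : free [seq C w | w <- enum 'S_n.+1 & (2 < size (rsk_P w))%N].
    have := kl_free; rewrite -(perm_free (perm_map C (permEl (perm_filterC
      (fun w : 'S_n.+1 => (2 < size (rsk_P w))%N) _)))) map_cat.
    exact: catl_free.
  by rewrite (eqP fk) size_map -sum1_size big_filter big_enum_cond sum1_card.
have := limg_ker_dim pi fullv; rewrite capfv dk -[(_ @: _)%VS]/(limg pi) sp dH.
set P := [pred w : 'S_n.+1 | _]; have <- := cardID P 'S_n.+1 => e.
have {e} : (#|P| + \dim {:H2} =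
    #|P| + #|[pred w : 'S_n.+1 | (size (rsk_P w) <= 2)%N]|)%N.
  rewrite e; congr (_ + _)%N; apply: eq_card => w; rewrite !inE //=.
  by rewrite andbT -leqNgt.
by move/addnI ->.
Qed.

End Dimension.

(** * Tensor products of modules *)

Section TensorMatrices.
Variable F : fieldType.

Lemma tensmx_linear_l m n p q (B : 'M[F]_(p, q)) : linear (fun A : 'M[F]_(m, n) => A *t B).
Proof. by move=> k A A'; apply/matrixP => i j; rewrite !mxE mulrDl mulrA. Qed.

Lemma tensmx_linear_r m n p q (A : 'M[F]_(m, n)) : linear (fun B : 'M[F]_(p, q) => A *t B).
Proof. by move=> k B B'; apply/matrixP => i j; rewrite !mxE mulrDr mulrCA. Qed.

Lemma tensmx_1 m n : (1%:M : 'M[F]_m) *t (1%:M : 'M[F]_n) = 1%:M.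
Proof.
apply/matrixP => i j; case: (mxtens_indexP i) => i1 i2; case: (mxtens_indexP j) => j1 j2.
rewrite tensmxE !mxE -natrM mulnb; congr (_%:R); congr nat_of_bool.
rewrite (can_eq (@mxtens_indexK m n)) -pair_eqE /pair_eq /=; by [].
Qed.

Definition swap_mx d e : 'M[F]_(d * e, e * d) :=
  \matrix_(k, l)
    (((mxtens_unindex k).1 == (mxtens_unindex l).2) &&
     ((mxtens_unindex k).2 == (mxtens_unindex l).1))%:R.

Lemma flip_swap d : flip_mx F d = swap_mx d d. Proof. by []. Qed.

Definition swapix d e (k : 'I_(d * e)) : 'I_(e * d) :=
  mxtens_index ((mxtens_unindex k).2, (mxtens_unindex k).1).

Lemma swapixK d e : cancel (@swapix d e) (@swapix e d).
Proof. by move=> k; case: (mxtens_indexP k) => i j; rewrite /swapix !mxtens_indexK. Qed.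

Lemma swap_mxE d e k l : swap_mx d e k l = (l == swapix k)%:R.
Proof.
rewrite mxE; congr (_%:R); congr nat_of_bool.
rewrite -[in RHS](mxtens_unindexK l) /swapix (can_eq (@mxtens_indexK e d)).
by rewrite [mxtens_unindex l]surjective_pairing -pair_eqE /pair_eq /= andbC
  [_ == (mxtens_unindex k).2]eq_sym [_ == (mxtens_unindex k).1]eq_sym.
Qed.

Lemma mul_swap m d e (X : 'M[F]_(m, d * e)) k l : (X *m swap_mx d e) k l = X k (swapix l).
Proof.
rewrite mxE (bigD1 (swapix l)) //= swap_mxE swapixK eqxx mulr1 big1 ?addr0 // => i il.
rewrite swap_mxE; case: eqP => [e1|_]; last exact: mulr0.
by rewrite e1 swapixK eqxx in il.
Qed.

Lemma swap_mul m d e (X : 'M[F]_(e * d, m)) k l : (swap_mx d e *m X) k l = X (swapix k) l.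
Proof.
rewrite mxE (bigD1 (swapix k)) //= swap_mxE eqxx mul1r big1 ?addr0 // => i il.
by rewrite swap_mxE (negPf il) mul0r.
Qed.

Lemma swap_mxK d e : swap_mx d e *m swap_mx e d = 1%:M.
Proof.
apply/matrixP => k l; rewrite swap_mul swap_mxE mxE.
by rewrite swapixK eq_sym.
Qed.

Lemma tens_swap d e (X : 'M[F]_d) (Y : 'M[F]_e) :
  (X *t Y) *m swap_mx d e = swap_mx d e *m (Y *t X).
Proof.
apply/matrixP => k l; rewrite mul_swap swap_mul /swapix.
case: (mxtens_indexP k) => k1 k2; case: (mxtens_indexP l) => l1 l2.
by rewrite !mxtens_indexK /= !tensmxE mulrC.
Qed.

End TensorMatrices.

Section TensorModules.
Variables (F : fieldType) (A B : falgType F) (V : rmodule A) (W : rmodule B).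
Hypotheses (mV : is_module V) (mW : is_module W).

Lemma tens_modE a b : tens_mod V W (tens a b) = V a *t W b.
Proof.
apply: (tens_lift_tens (f := fun a b => V a *t W b)).
  by move=> y k x x'; rewrite (actD mV) (actZ mV) tensmx_linear_l.
by move=> x k y y'; rewrite (actD mW) (actZ mW) tensmx_linear_r.
Qed.

Lemma tens_mod_module : is_module (tens_mod V W).
Proof.
have L : linear (tens_mod V W : tens_alg A B -> 'M_(mdim V * mdim W)).
  exact: (tens_lift_is_linear (fun a b => V a *t W b)).
have D x y : tens_mod V W (x + y) = tens_mod V W x + tens_mod V W y.
  by rewrite -[x in LHS]scale1r L scale1r.
have z0 : tens_mod V W 0 = 0 by rewrite -[0 in LHS](addNr 0) -scaleN1r L scaleN1r addNr.
split=> //; first by rewrite tens_modE (act1 mV) (act1 mW) tensmx_1.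
move=> x y; elim/tens_ind: x => [|k x x' IH IH'|a b].
- by rewrite mul0r z0 mul0mx.
- by rewrite mulrDl -scalerAl !L IH IH' mulmxDl -scalemxAl.
elim/tens_ind: y => [|k y y' IH IH'|c d].
- by rewrite mulr0 z0 mulmx0.
- by rewrite mulrDr -scalerAr !L IH IH' mulmxDr -scalemxAr.
by rewrite tensM !tens_modE (actM mV) (actM mW) tensmx_mul.
Qed.

End TensorModules.

Section TensorEmbeddings.
Variables (F : fieldType) (B : falgType F).

Definition tens_l (b : B) : tens_alg B B := tens b 1.
Definition tens_r (b : B) : tens_alg B B := tens 1 b.

Fact tens_l_linear : linear tens_l. Proof. exact: tens_is_linear_l. Qed.
Fact tens_r_linear : linear tens_r. Proof. exact: tens_is_linear_r. Qed.
Fact tens_l_monoid : monoid_morphism tens_l.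
Proof. by split=> // x y; rewrite /tens_l tensM mulr1. Qed.
Fact tens_r_monoid : monoid_morphism tens_r.
Proof. by split=> // x y; rewrite /tens_r tensM mulr1. Qed.

HB.instance Definition _ := GRing.isLinear.Build F B (tens_alg B B) _ tens_l tens_l_linear.
HB.instance Definition _ := GRing.isLinear.Build F B (tens_alg B B) _ tens_r tens_r_linear.
HB.instance Definition _ := GRing.isMonoidMorphism.Build B (tens_alg B B) tens_l tens_l_monoid.
HB.instance Definition _ := GRing.isMonoidMorphism.Build B (tens_alg B B) tens_r tens_r_monoid.

Definition tens_lm : {lrmorphism B -> tens_alg B B} := tens_l.
Definition tens_rm : {lrmorphism B -> tens_alg B B} := tens_r.

Lemma tens_lr a b : tens_lm a * tens_rm b = tens a b.
Proof. by rewrite /tens_lm /tens_rm /= tensM mulr1 mul1r. Qed.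

Lemma tens_comm a b : tens_lm a * tens_rm b = tens_rm b * tens_lm a.
Proof. by rewrite /tens_lm /tens_rm /= !tensM !mulr1 !mul1r. Qed.

End TensorEmbeddings.

(** * The Temperley-Lieb algebra *)

Section Letters.
Variables (F : fieldType) (c : coefs F).

Definition swat m (w : word) : word := take m w ++ sw (drop m w).

(** Later letters see only the height of what precedes them, which a swap preserves; so
    self-adjointness of the top generator carries over to every position. *)
Lemma gam_od_at k m w : w \in Om k -> od c (drop m w) != 0 ->
  [/\ swat m w \in Om k, ht (swat m w) = ht w, swat m (swat m w) = w
    & gam c (swat m w) * od c (drop m (swat m w)) = gam c w * od c (drop m w)].
Proof.
elim: m k w => [|m IH] k w wk.
  rewrite /swat !take0 !drop0 /= => nz; have [s1 s2] := od_neq0 wk nz; split=> //.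
    exact: swK.
  case: w wk nz s1 s2 => [|x [|y v]]; rewrite ?eqxx //= .
  case: k => [|[|k]]; rewrite ?mem_Om //= => bw.
  case: x y bw => [] []; rewrite /= ?eqxx // => bw nz _ _.
    have hv : (0 < ht v)%N by case: (ht v) nz => //; rewrite cq0 eqxx.
    by have := gam_od c hv; rewrite /= => ->.
  have hv : (0 < ht v)%N by case/andP: bw => _ /andP[/andP[_]].
  by have := gam_od c hv; rewrite /= => ->.
case: w wk => [|x w]; first by rewrite /= eqxx.
case: k => [|k]; first by rewrite mem_Om.
move=> xw nz; have [h1 h2 h3 h4] := IH k w (Om_cons xw) nz.
have e v : swat m.+1 (x :: v) = x :: swat m v by [].
rewrite !e; split.
- by case: x xw {e nz}; rewrite ?Om0 ?Om1 ?h2 ?h1 // => /andP[].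
- by rewrite /= h2.
- by rewrite h3.
- by rewrite /= h2 [LHS]mulrAC h4 mulrAC.
Qed.

Lemma gam_od_sym k m a b : a \in Om k -> b \in Om k ->
  (b == swat m a)%:R * od c (drop m a) * gam c a =
  (a == swat m b)%:R * od c (drop m b) * gam c b.
Proof.
have half x y : x \in Om k -> od c (drop m x) != 0 -> y == swat m x ->
    (x == swat m y) && (od c (drop m y) * gam c y == od c (drop m x) * gam c x).
  move=> xk nz /eqP->; have [_ _ -> e] := gam_od_at xk nz.
  by rewrite eqxx mulrC e mulrC eqxx.
move=> ak bk; have [za|za] := eqVneq (od c (drop m a)) 0.
  rewrite za mulr0 mul0r; have [zb|zb] := eqVneq (od c (drop m b)) 0.
    by rewrite zb mulr0 mul0r.
  case: eqP => [/eqP e|_]; last by rewrite !mul0r.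
  have /andP[_ /eqP] := half _ _ bk zb e; rewrite za mul0r => ab.
  by rewrite -mulrA -ab mulr0.
case: eqP => [/eqP e|ne].
  by have /andP[-> /eqP ab] := half _ _ ak za e; rewrite !mul1r ab.
rewrite !mul0r; have [zb|zb] := eqVneq (od c (drop m b)) 0.
  by rewrite zb mulr0 mul0r.
case: eqP => [/eqP e|_]; last by rewrite !mul0r.
by have /andP[/eqP e1 _] := half _ _ bk zb e.
Qed.

(** [ent] is an abstract matrix entry: the lemma serves both for matrices indexed by all words and
    for the action on one M_lam. *)
Lemma Rat_entry (B : algType F) k m (E : word -> word -> B) (ent : B -> F) x y :
    (forall b b', ent (b + b') = ent b + ent b') ->
    (forall a b, ent (a *: b) = a * ent b) ->
    x \in Om k ->
    (forall a b, a \in Om k -> b \in Om k -> ht a = ht b ->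
       ent (E a b) = ((x == a) && (y == b))%:R) ->
  ent (Rat c m E k) =
  (x == y)%:R * dg c (drop m x) + (y == swat m x)%:R * od c (drop m x).
Proof.
move=> eD eZ xk eE.
have e0 : ent 0 = 0 by rewrite -(scale0r 0) eZ mul0r.
have eS f : ent (\sum_(t <- Om k) f t) = \sum_(t <- Om k) ent (f t).
  by elim/big_rec2: _ => [|i b b' _ <-]; rewrite ?e0.
have oE t : t \in Om k -> od c (drop m t) * ent (E t (swat m t)) =
    od c (drop m t) * ((x == t) && (y == swat m t))%:R.
  move=> tk; have [->|nz] := eqVneq (od c (drop m t)) 0; first by rewrite !mul0r.
  by have [h1 h2 _ _] := gam_od_at tk nz; rewrite eE.
rewrite /Rat eS (bigD1_seq x) ?Om_uniq //= big_seq_cond big1 => [|t /andP[tk tx]].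
  rewrite addr0 eD !eZ -/(swat m x) oE // eE // eqxx /= [y == x]eq_sym.
  by rewrite mulrC [X in _ + X]mulrC.
by rewrite eD !eZ -/(swat m t) oE // eE // eq_sym (negPf tx) /= !mulr0 addr0.
Qed.

End Letters.

(** The shape of size n + 1 with second row b; b = 0 is separate because partitions have no zero
    part. *)
Definition lam_of n b : seq nat := if b is 0 then [:: n.+1] else [:: n.+1 - b; b]%N.

Lemma part2_lam_of n b : (b.*2 <= n.+1)%N -> part2 n.+1 (lam_of n b) && (l2 (lam_of n b) == b).
Proof.
case: b => [|b] h; first by rewrite /part2 /is_part /= addn0 !eqxx.
rewrite /part2 /is_part /lam_of /l2 /= !inE !andbT eqxx andbT addn0 -/(subn n b).
by apply/and3P; split; clear -h; lia.
Qed.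

Lemma part2_lam n lam : part2 n.+1 lam -> lam = lam_of n (l2 lam) /\ ((l2 lam).*2 <= n.+1)%N.
Proof.
move=> pl; have [h1 h2 _] := part2_facts pl; have h : ((l2 lam).*2 <= n.+1)%N.
  by clear -h1 h2; lia.
split=> //; have /andP[pl' /eqP e] := part2_lam_of h.
apply: (part2_inj pl pl'); have [h3 h4 _] := part2_facts pl'.
by rewrite /hl; clear -h1 h2 h3 h4 e; lia.
Qed.

Lemma ht_lam n a : a \in Om n.+1 -> exists2 lam, part2 n.+1 lam & hl lam = ht a.
Proof.
move=> ak; have ha := ht_le ak; have oa := odd_ht ak.
have eE : odd (n.+1 - ht a) = false by rewrite oddB // oa addbb.
have /andP[pl /eqP e] : part2 n.+1 (lam_of n (n.+1 - ht a)./2) &&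
    (l2 (lam_of n (n.+1 - ht a)./2) == (n.+1 - ht a)./2).
  by apply: part2_lam_of; rewrite halfK eE subn0 leq_subr.
exists (lam_of n (n.+1 - ht a)./2) => //; have [h1 h2 _] := part2_facts pl.
have := odd_double_half (n.+1 - ht a); rewrite eE add0n /hl => h3.
by clear -h1 h2 h3 e ha; lia.
Qed.

(* Turns the eigenvalues u and -u^-1 of T_s into 1 and -1. *)
Definition hinv (A : algType K) (x : A) : A :=
  (u + u^-1)^-1 *: (2%:R *: x - (u - u^-1)%:A).

Section Involution.
Variables (F : fieldType) (A : algType F) (q : F) (x : A).
Hypotheses (q0 : q != 0) (q1 : q + q^-1 != 0).
Let r := (q + q^-1)^-1 *: (2%:R *: x - (q - q^-1)%:A).

Fact involution_sq : (x - q%:A) * (x + q^-1%:A) = 0 -> r * r = 1.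
Proof.
move=> e; rewrite !(alg_expand A, alg_scale) in e.
have xx : x * x = (q - q^-1) *: x + 1.
  have -> : x * x = (x * x + q^-1 *: x + (- (q *: x) - q *: q^-1%:A))
      - q^-1 *: x + q *: x + (q * q^-1)%:A by linear_over F; rewrite /=; ring.
  by rewrite e divff //; linear_over F; rewrite /=; ring.
have q2 : q * q + 1 != 0 by apply: contraNneq q1 => z; rewrite -(mulfK q0 (q + _)) mulrDl mulVf // z mul0r.
rewrite /r !(alg_expand A, alg_scale) xx.
by linear_over F; rewrite /=; field; rewrite ?q0 ?q2.
Qed.

End Involution.

Lemma uV_neq0 : u + u^-1 != 0.
Proof.
have -> : u + u^-1 = (1 + u ^+ 2) * u^-1.
  by rewrite mulrDl mul1r expr2 mulfK ?u_neq0 // addrC.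
by apply: mulf_neq0; [exact: (u1D_neq0 1)|exact: (invr_neq0 u_neq0)].
Qed.

Lemma shape_word n lam : part2 n.+1 lam -> exists2 a, a \in Om n.+1 & ht a = hl lam.
Proof.
move=> pl; have [h1 h2 _] := part2_facts pl; apply: ex_word.
  by rewrite /hl; clear -h1 h2; lia.
by rewrite -h2 oddD /hl oddB //; case: odd.
Qed.

(** * Lifting the matrix units to the quotient *)

Section TemperleyLieb.
Variables (n : nat) (H : falgType K) (T : 'S_n.+1 -> H) (C : 'S_n.+1 -> H).
Variables (H2 : falgType K) (pi : 'AHom(H, H2)).
Variable M : forall lam : seq nat, H2 -> 'M[K]_#|SYT n lam|.
Variable Phi : forall lam : seq nat, 'M[K]_#|SYT n lam|.
Let t (i : 'I_n) := pi (T (simple i)).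
Let V (lam : seq nat) := RModule (M lam).
Hypothesis hT : is_hecke T.
Hypothesis hC : forall w, is_kl T w (C w).
Hypothesis spi : limg pi = fullv.
Hypothesis kpi : lker pi = <<[seq C w | w <- enum 'S_n.+1 & (2 < size (rsk_P w))%N]>>%VS.
Hypothesis hM : forall lam, part2 n.+1 lam ->
  is_module (V lam) /\ forall i, M lam (t i) = seminormal lam i.
Hypothesis hPhi : forall lam, part2 n.+1 lam ->
  @mod_iso_by _ _ (pullback pi (V lam)) (dual T (pullback pi (V lam))) (Phi lam).

Lemma hcoord_T w v : hcoord T w (T v) = (w == v)%:R.
Proof.
case: hT => bT _ _.
have tv : T v = (codom_tuple T)`_(enum_rank v).
  by rewrite (nth_map v) -?cardE ?ltn_ord // nth_enum_rank.
rewrite /hcoord tv coord_free; last exact: basis_free bT.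
by rewrite (inj_eq enum_rank_inj) eq_sym.
Qed.

Lemma hop_simple i : hop T (T (simple i)) = T (simple i).
Proof.
rewrite /hop (bigD1 (simple i)) //= hcoord_T eqxx scale1r big1 ?addr0 => [|w ws].
  by rewrite tpermV.
by rewrite hcoord_T (negPf ws) scale0r.
Qed.

Lemma hinv_sq i : hinv (t i) * hinv (t i) = 1.
Proof.
apply: involution_sq; first exact: u_neq0.
  exact: uV_neq0.
case: hT => _ _ /(_ i) /(congr1 pi).
by rewrite rmorphM rmorphB rmorphD rmorph0 /= !rmorph_alg.
Qed.

Section Shape.
Variable lam : seq nat.
Hypothesis plam : part2 n.+1 lam.
Let mV := (hM plam).1.

Definition gdiag := diag_mx (\row_(a < #|SYT n lam|) gam coefsK (wdl a)).

Lemma hinv_mx i : M lam (hinv (t i)) =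
  (u + u^-1)^-1 *: (2%:R *: M lam (t i) - (u - u^-1)%:M).
Proof.
rewrite -[M lam _]/(V lam _) (actZ mV) (actD mV) -scaleN1r !(actZ mV) (act1 mV) scaleN1r.
by rewrite scalemx1.
Qed.

Lemma act_hinv i a b : M lam (hinv (t i)) a b =
  (wdl a == wdl b)%:R * dg coefsK (drop (n - i.+1) (wdl a))
  + (wdl b == swat (n - i.+1) (wdl a))%:R * od coefsK (drop (n - i.+1) (wdl a)).
Proof.
rewrite -(seminormal_word plam i a b) -(hM plam).2 hinv_mx mulrC.
rewrite mxE; congr (_ * _); rewrite mxE; congr (_ + _); first exact: mxE.
by rewrite !mxE [b == a]eq_sym mulr_natl.
Qed.

Lemma hinv_gdiag i : (M lam (hinv (t i)))^T *m gdiag = gdiag *m M lam (hinv (t i)).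
Proof.
apply/matrixP => a b; rewrite mul_mx_diag mul_diag_mx !mxE !act_hinv.
rewrite mulrDl mulrDr [wdl b == _]eq_sym; congr (_ + _).
  by case: eqP => [->|_]; rewrite ?mul0r ?mulr0 // mulrC.
by rewrite (gam_od_sym coefsK _ (wdl_Om plam b) (wdl_Om plam a)) mulrC.
Qed.

Lemma hinv_Phi i : M lam (hinv (t i)) *m Phi lam = Phi lam *m (M lam (hinv (t i)))^T.
Proof.
have [_ _ /(_ (T (simple i)))] := hPhi plam.
rewrite /= hop_simple -/(t i) => e.
have -> : (M lam (hinv (t i)))^T =
    (u + u^-1)^-1 *: (2%:R *: (M lam (t i))^T - (u - u^-1)%:M).
  by rewrite hinv_mx; apply/matrixP => a b; rewrite !mxE [b == a]eq_sym.
rewrite hinv_mx -scalemxAl -scalemxAr.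
rewrite mulmxBl mulmxBr -scalemxAl -scalemxAr e.
by rewrite mul_scalar_mx mul_mx_scalar.
Qed.

(** [Phi] carries the action to its transpose and [gdiag] carries it back, so the product commutes
    with the action. *)
Lemma hinv_PG i : M lam (hinv (t i)) *m (Phi lam *m gdiag) = Phi lam *m gdiag *m M lam (hinv (t i)).
Proof. by rewrite mulmxA hinv_Phi -!mulmxA hinv_gdiag. Qed.

End Shape.

(* Block diagonal matrices indexed by all the ballot words stand for the
   product of the End(M_lam). *)
Let N := (size (Om n.+1)).-1.
Let wi (i : 'I_N.+1) : word := nth [::] (Om n.+1) i.
Let ix (w : word) : 'I_N.+1 := inord (index w (Om n.+1)).

Let sizeN : size (Om n.+1) = N.+1.
Proof.
by rewrite /N prednK // lt0n size_eq0; apply/eqP => e; have := nseq_Om n.+1; rewrite e.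
Qed.

Let wi_Om i : wi i \in Om n.+1. Proof. by rewrite mem_nth // sizeN. Qed.

Let wiK i : ix (wi i) = i.
Proof. by rewrite /ix /wi index_uniq ?Om_uniq ?sizeN // inord_val. Qed.

Let ixK w : w \in Om n.+1 -> wi (ix w) = w.
Proof. by move=> wk; rewrite /wi inordK ?nth_index // -sizeN index_mem. Qed.

Let ix_eq i w : w \in Om n.+1 -> (i == ix w) = (wi i == w).
Proof. by move=> wk; apply/eqP/eqP => [->|<-]; rewrite ?ixK ?wiK. Qed.

Let E0 (a b : word) : 'M[K]_N.+1 := delta_mx (ix a) (ix b).

Let E0E a b i j : a \in Om n.+1 -> b \in Om n.+1 -> E0 a b i j = ((wi i == a) && (wi j == b))%:R.
Proof. by move=> ak bk; rewrite mxE !ix_eq. Qed.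

Let units_E0 : units n.+1 E0.
Proof.
split=> [a b d e ak bk dk ek _ _|].
  rewrite -[b == d](inj_in_eq (f := ix) (D := [in Om n.+1])) //; last first.
    by move=> x y xk yk e'; rewrite -(ixK xk) e' ixK.
  case: eqP => [e'|/eqP ne]; first by rewrite /E0 e' -mulmxE mul_delta_mx.
  by rewrite /E0 -mulmxE mul_delta_mx_0.
apply/matrixP => i j; rewrite summxE (bigD1_seq (wi i)) ?Om_uniq //= big_seq_cond big1.
  by rewrite addr0 E0E // eqxx /= !mxE -(inj_eq (can_inj wiK)) eq_sym.
by move=> a /andP[ak ai]; rewrite E0E // eq_sym (negPf ai).
Qed.

Let sum_wdl lam (f : 'I_N.+1 -> K) : part2 n.+1 lam ->
    (forall i, ht (wi i) != hl lam -> f i = 0) ->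
  \sum_i f i = \sum_a f (ix (@wdl n lam a)).
Proof.
move=> plam f0; rewrite (bigID [pred i | ht (wi i) == hl lam]) /= [X in _ + X]big1 // addr0.
rewrite -(big_imset f (h := fun a => ix (@wdl n lam a)) (A := predT)) /=; last first.
  move=> a b _ _ e; apply: (wdl_inj plam).
  by rewrite -(ixK (wdl_Om plam a)) e (ixK (wdl_Om plam b)).
apply: eq_bigl => i; apply/eqP/imsetP => [e|[a _ ->]].
  have [a aw] := wdl_surj plam (wi_Om i) e.
  by exists a; rewrite ?aw ?wiK.
by rewrite ixK ?(wdl_Om plam) ?(wdl_ht plam).
Qed.

(* The commutation relation, applied to matrix units, will make [Phi] a multiple
   of the inverse of the Gram matrix [gdiag]. *)
Let lifted (X : 'M[K]_N.+1) : Prop :=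
  (forall i j, ht (wi i) != ht (wi j) -> X i j = 0) /\
  exists h : H2, forall lam, part2 n.+1 lam ->
    (forall a b, M lam h a b = X (ix (wdl a)) (ix (wdl b))) /\
    M lam h *m (Phi lam *m gdiag lam) = Phi lam *m gdiag lam *m M lam h.

Let lifted_subalgebra : subalgebra lifted.
Proof.
split.
- split=> [i j ij|]; first by rewrite mxE; case: (eqVneq i j) ij => [->|//]; rewrite eqxx.
  exists 1 => lam pl; have mV := (hM pl).1; rewrite -[M lam 1]/(V lam 1) (act1 mV).
  split=> [a b|]; last by rewrite mul1mx mulmx1.
  by rewrite !mxE ix_eq ?(wdl_Om pl) // ixK ?(wdl_Om pl) // (inj_eq (wdl_inj pl)).
- move=> X Y [X0 [x hx]] [Y0 [y hy]]; split=> [i j ij|].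
    by rewrite mxE X0 ?Y0 ?addr0.
  exists (x + y) => lam pl; have [hx1 hx2] := hx _ pl; have [hy1 hy2] := hy _ pl.
  rewrite -[M lam _]/(V lam _) (actD (hM pl).1) /=; split=> [a b|].
    by rewrite !mxE -hx1 -hy1.
  by rewrite mulmxDl mulmxDr hx2 hy2.
- move=> X Y [X0 [x hx]] [Y0 [y hy]]; split=> [i j ij|].
    rewrite mxE big1 // => k _; have [ik|ik] := eqVneq (ht (wi i)) (ht (wi k)).
      by rewrite Y0 ?mulr0 // -ik.
    by rewrite X0 ?mul0r.
  exists (x * y) => lam pl; have [hx1 hx2] := hx _ pl; have [hy1 hy2] := hy _ pl.
  rewrite -[M lam _]/(V lam _) (actM (hM pl).1) /=; split=> [a b|].
    rewrite !mxE (sum_wdl pl) => [|i hi].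
      by apply: eq_bigr => k _; rewrite -hx1 -hy1.
    by rewrite X0 ?mul0r // ixK ?(wdl_Om pl) // (wdl_ht pl) eq_sym.
  by move: (Phi lam *m _) hx2 hy2 => PG hx2 hy2; rewrite -mulmxA hy2 !mulmxA hx2.
- move=> k X [X0 [x hx]]; split=> [i j ij|]; first by rewrite mxE X0 ?mulr0.
  exists (k *: x) => lam pl; have [hx1 hx2] := hx _ pl.
  rewrite -[M lam _]/(V lam _) (actZ (hM pl).1) /=; split=> [a b|].
    by rewrite !mxE -hx1.
  by rewrite -scalemxAl -scalemxAr hx2.
Qed.

Let lifted_Rat m : (m < n)%N -> lifted (Rat coefsK m E0 n.+1).
Proof.
move=> mn; have entry i j : Rat coefsK m E0 n.+1 i j =
    (wi i == wi j)%:R * dg coefsK (drop m (wi i))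
    + (wi j == swat m (wi i))%:R * od coefsK (drop m (wi i)).
  apply: (@Rat_entry _ coefsK 'M[K]_N.+1 n.+1 m E0 (fun X => X i j)) => [X Y|k X||a b ak bk _] //.
  - by rewrite mxE.
  - by rewrite mxE.
  - exact: E0E.
split=> [i j ij|].
  rewrite entry; case: (eqVneq (wi i) (wi j)) ij => [->|_ ij]; first by rewrite eqxx.
  rewrite mul0r add0r; have [->|nz] := eqVneq (od coefsK (drop m (wi i))) 0.
    by rewrite mulr0.
  have [_ e _ _] := gam_od_at (wi_Om i) nz.
  by case: eqP => [e'|]; rewrite ?mul0r //; rewrite e' e eqxx in ij.
have im : (n - m.+1 < n)%N by clear -mn; lia.
have mE : (n - (n - m.+1).+1 = m)%N by clear -mn; lia.
exists (hinv (t (Ordinal im))) => lam pl; split; last exact: hinv_PG.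
by move=> a b; rewrite (act_hinv pl) /= mE entry !ixK ?(wdl_Om pl).
Qed.

Lemma unit_lifts : exists E : word -> word -> H2,
  forall a b, a \in Om n.+1 -> b \in Om n.+1 -> ht a = ht b ->
  forall lam, part2 n.+1 lam ->
    (forall i j, M lam (E a b) i j = ((wdl i == a) && (wdl j == b))%:R) /\
    M lam (E a b) *m (Phi lam *m gdiag lam) = Phi lam *m gdiag lam *m M lam (E a b).
Proof.
have ex i j : exists h : H2, ht (wi i) = ht (wi j) -> forall lam, part2 n.+1 lam ->
    (forall k l, M lam h k l = ((wdl k == wi i) && (wdl l == wi j))%:R) /\
    M lam h *m (Phi lam *m gdiag lam) = Phi lam *m gdiag lam *m M lam h.
  have [e|ne] := eqVneq (ht (wi i)) (ht (wi j)); last first.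
    by exists 0 => e; rewrite e eqxx in ne.
  have [_ [h hE]] := generation lifted_subalgebra units_E0 lifted_Rat (wi_Om i) (wi_Om j) e.
  exists h => _ lam pl; have [h1 h2] := hE _ pl; split=> // k l.
  by rewrite h1 E0E ?wi_Om // !ixK ?(wdl_Om pl).
have [E HE] := fin_all_exists (fun i => fin_all_exists (ex i)).
exists (fun a b => E (ix a) (ix b)) => a b ak bk ab lam pl.
by have := HE (ix a) (ix b); rewrite !ixK // => /(_ ab lam pl).
Qed.

Let mV lam : part2 n.+1 lam -> is_module (V lam). Proof. by move=> /hM[]. Qed.

(** Each unit is detected by one matrix entry of one M_lam, at which all the other units vanish. *)
Lemma M_inj_span (E : word -> word -> H2) (k : 'I_(size (Om2 n.+1)) -> K) p0 :
    (forall a b, a \in Om n.+1 -> b \in Om n.+1 -> ht a = ht b -> forall lam,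
      part2 n.+1 lam -> forall i j, M lam (E a b) i j = ((wdl i == a) && (wdl j == b))%:R) ->
  (forall lam, part2 n.+1 lam ->
    M lam (\sum_i k i *: E (nth p0 (Om2 n.+1) i).1 (nth p0 (Om2 n.+1) i).2) = 0) ->
  forall i, k i = 0.
Proof.
move=> hE z i; pose q := nth p0 (Om2 n.+1) i.
have mem j : let q := nth p0 (Om2 n.+1) (j : 'I_(size (Om2 n.+1))) in
    [/\ q.1 \in Om n.+1, q.2 \in Om n.+1 & ht q.1 = ht q.2].
  have := mem_nth p0 (ltn_ord j); case: (nth _ _ _) => a b.
  by rewrite mem_Om2 => /and3P[? ? /eqP].
have [q1 q2 q12] := mem i; have [lam pl hl1] := ht_lam q1.
have [a aq] := wdl_surj pl q1 (esym hl1).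
have [b bq] := wdl_surj pl q2 (etrans (esym q12) (esym hl1)).
have := z _ pl; rewrite -[M lam _]/(V lam _) (act_sum (mV pl)) => /matrixP/(_ a b).
rewrite summxE (bigD1 i) //= big1 => [|j ji].
  by rewrite addr0 -[M lam _]/(V lam _) (actZ (mV pl)) /= mxE hE // aq bq !eqxx mulr1 mxE.
have [j1 j2 j12] := mem j.
rewrite -[M lam _]/(V lam _) (actZ (mV pl)) /= mxE hE // aq bq.
case: andP => [[/eqP e1 /eqP e2]|_]; last by rewrite mulr0.
have /eqP : nth p0 (Om2 n.+1) i = nth p0 (Om2 n.+1) j.
  by rewrite [LHS]surjective_pairing e1 e2 -surjective_pairing.
by rewrite nth_uniq ?Om2_uniq // => /eqP/val_inj e; rewrite e eqxx in ji.
Qed.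

(** The lifts are linearly independent and [dim_quotient] bounds the dimension by their number, so
    they form a basis; identities in [H2] can then be checked on the M_lam. *)
Theorem TL_units : exists E : word -> word -> H2,
  [/\ units n.+1 E,
      forall i : 'I_n, hinv (t i) = Rat coefsK (n - i.+1) E n.+1,
      forall a b, a \in Om n.+1 -> b \in Om n.+1 -> ht a = ht b -> forall lam,
        part2 n.+1 lam -> forall i j, M lam (E a b) i j = ((wdl i == a) && (wdl j == b))%:R,
      forall x, exists k : word * word -> K, x = \sum_(p <- Om2 n.+1) k p *: E p.1 p.2
    & forall lam, part2 n.+1 lam -> exists2 c, c != 0 &
        forall i j, Phi lam i j = (i == j)%:R * (c / gam coefsK (wdl i))].
Proof.
have [E hE] := unit_lifts; exists E.
have ME a b : a \in Om n.+1 -> b \in Om n.+1 -> ht a = ht b -> forall lam,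
    part2 n.+1 lam -> forall i j, M lam (E a b) i j = ((wdl i == a) && (wdl j == b))%:R.
  by move=> ak bk ab lam pl; have [] := hE a b ak bk ab lam pl.
pose p0 : word * word := ([::], [::]).
pose sE := in_tuple [seq E p.1 p.2 | p <- Om2 n.+1].
have sz : size sE = size (Om2 n.+1) by rewrite size_map.
have sumE (k : nat -> K) : \sum_(i < size sE) k i *: sE`_i =
    \sum_(i < size (Om2 n.+1)) k i *: E (nth p0 (Om2 n.+1) i).1 (nth p0 (Om2 n.+1) i).2.
  rewrite -[RHS](big_mkord xpredT (fun i => k i *:
    E (nth p0 (Om2 n.+1) i).1 (nth p0 (Om2 n.+1) i).2)) -sz big_mkord.
  apply: eq_bigr => i _; rewrite (nth_map p0) //.
  by rewrite -sz.
have fE : free sE.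
  apply/freeP => k k0 i.
  (* Coefficients pass through [nat] because the two ordinal types have equal but not convertible
     bounds; the default 0 is never reached. *)
  pose k' (j : nat) := if insub j is Some j' then k j' else 0.
  have kk j : k j = k' j by rewrite /k' valK.
  have : \sum_(j < size sE) k' j *: sE`_j = 0.
    by rewrite -[RHS]k0; apply: eq_bigr => j _; rewrite kk.
  rewrite sumE => z; rewrite kk.
  have lt : (i < size (Om2 n.+1))%N by rewrite -sz.
  apply: (M_inj_span (p0 := p0) ME (k := fun j => k' j) _ (Ordinal lt)) => lam pl.
  by rewrite z -[M lam _]/(V lam _) (act0 (mV pl)).
have bE : basis_of fullv sE.
  rewrite basisEfree fE subvf sz /=.
  exact: (dim_quotient hT hC spi kpi).
have ex x : exists k : nat -> K,
    x = \sum_(i < size (Om2 n.+1)) k i *: E (nth p0 (Om2 n.+1) i).1 (nth p0 (Om2 n.+1) i).2.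
  pose k (j : nat) := if insub j is Some j' then coord sE j' x else 0.
  exists k; rewrite -(sumE k) {1}(coord_basis bE (memvf x)).
  by apply: eq_bigr => j _; rewrite /k valK.
have inj x : (forall lam, part2 n.+1 lam -> M lam x = 0) -> x = 0.
  have [k ->] := ex x => /(M_inj_span (p0 := p0) ME (k := fun j => k j)) z.
  by rewrite big1 // => i _; rewrite z scale0r.
have inj2 x y : (forall lam, part2 n.+1 lam -> M lam x = M lam y) -> x = y.
  move=> e; apply/eqP; rewrite -subr_eq0; apply/eqP/inj => lam pl.
  rewrite -[M lam _]/(V lam _) (actD (mV pl)) -scaleN1r (actZ (mV pl)) /= e //.
  by rewrite scaleN1r subrr.
split=> //.
- split=> [a b d e ak bk dk ek ab de|].
    apply: inj2 => lam pl; rewrite -[M lam _]/(V lam _) (actM (mV pl)) /=.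
    apply/matrixP => i j; rewrite mxE; case: (eqVneq b d) => [bd|bd].
      subst d; rewrite ME ?(etrans ab de) //; have [e1|e1] := eqVneq (hl lam) (ht b).
        have [k kb] := wdl_surj pl bk (esym e1).
        rewrite (bigD1 k) //= big1 => [|l lk]; rewrite !ME //.
          by rewrite kb eqxx andbT /= addr0 -natrM mulnb.
        by rewrite -kb (inj_eq (wdl_inj pl)) (negPf lk) andbF mul0r.
      rewrite big1 => [|l _].
        by case: eqP => // e2; rewrite -ab -e2 (wdl_ht pl) eqxx in e1.
      rewrite !ME //; case: (eqVneq (wdl l) b) => e2; last by rewrite andbF mul0r.
      by rewrite -e2 (wdl_ht pl) eqxx in e1.
    rewrite -[M lam 0]/(V lam 0) (act0 (mV pl)) mxE big1 // => l _; rewrite !ME // -natrM mulnb.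
    by case: (eqVneq (wdl l) b) => [->|]; rewrite ?(negPf bd) ?andbF.
  apply: inj2 => lam pl; rewrite -[LHS]/(V lam _) (act_sum (mV pl)) -[RHS]/(V lam _) (act1 (mV pl)).
  apply/matrixP => i j; rewrite summxE (bigD1_seq (wdl i)) ?Om_uniq ?(wdl_Om pl) //=.
  rewrite big_seq_cond big1 => [|a /andP[ak ai]].
    by rewrite addr0 ME ?(wdl_Om pl) // mxE eqxx (inj_eq (wdl_inj pl)) eq_sym.
  by rewrite ME // eq_sym (negPf ai).
- move=> i; apply: inj2 => lam pl; apply/matrixP => a b; rewrite (act_hinv pl).
  apply/esym/(@Rat_entry _ coefsK H2 n.+1 _ E (fun x => M lam x a b)) => [x y|k x||d e dk ek de].
  - by rewrite -[M lam _]/(V lam _) (actD (mV pl)) mxE.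
  - by rewrite -[M lam _]/(V lam _) (actZ (mV pl)) mxE.
  - exact: wdl_Om.
  - exact: ME.
- move=> x; have [k ->] := ex x.
  exists (fun p => k (index p (Om2 n.+1))); rewrite (big_nth p0) big_mkord.
  by apply: eq_bigr => i _; rewrite index_uniq ?Om2_uniq.
move=> lam pl; set PG := Phi lam *m gdiag lam.
have cPG i j k : PG j k = PG i i * (j == k)%:R.
  have [_] := hE (wdl i) (wdl j) (wdl_Om pl i) (wdl_Om pl j)
    (etrans (wdl_ht pl i) (esym (wdl_ht pl j))) lam pl.
  rewrite -/PG; have -> : M lam (E (wdl i) (wdl j)) = delta_mx i j.
    apply/matrixP => a b; rewrite ME ?(wdl_Om pl) ?(wdl_ht pl) // mxE.
    by rewrite !(inj_eq (wdl_inj pl)).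
  move=> /matrixP/(_ i k); rewrite !mxE (bigD1 j) //= big1 => [|l lj].
    rewrite (bigD1 i) //= big1 => [|l li].
      by rewrite !mxE !eqxx !addr0 mul1r [k == j]eq_sym.
    by rewrite !mxE (negPf li) mulr0.
  by rewrite !mxE (negPf lj) andbF mul0r.
have [a ak ha] := shape_word pl; have [o _] := wdl_surj pl ak ha.
have gN (i : 'I_#|SYT n lam|) : gam coefsK (wdl i) != 0.
  exact: (gam_neq0 coefsK (wdl_Om pl i)).
have PE i j : Phi lam i j = (i == j)%:R * (PG o o / gam coefsK (wdl i)).
  have := cPG o i j; rewrite /PG mul_mx_diag mxE [in RHS]mxE => /(canRL (mulfK _)) ->.
    by rewrite !mxE; case: eqP => [->|_]; rewrite ?mulr1 ?mul1r ?mulr0 ?mul0r.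
  by rewrite mxE.
exists (PG o o) => //; apply/eqP => z.
have [/row_freeP[P' PP'] _ _] := hPhi pl.
have := PP'; rewrite (_ : Phi lam = 0) ?mul0mx => [/matrixP/(_ o o)|].
  by rewrite !mxE eqxx => /eqP; rewrite eq_sym oner_eq0.
by apply/matrixP => i j; rewrite PE z mul0r mulr0 mxE.
Qed.

End TemperleyLieb.

(** * Matrices on a tensor square commuting with the flip *)

Section TensorBasis.
Variables (F : fieldType) (d : nat).
Hypothesis n2 : 2%:R != 0 :> F.
Implicit Types s t a b c o : 'I_d.

Definition er s t : 'rV[F]_(d * d) := delta_mx 0 (mxtens_index (s, t)).
Definition ec s t : 'cV[F]_(d * d) := delta_mx (mxtens_index (s, t)) 0.

Lemma mxtens_index_eq s t a b :
  (mxtens_index (s, t) == mxtens_index (a, b)) = (s == a) && (t == b).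
Proof. by rewrite (can_eq (@mxtens_indexK d d)) xpair_eqE. Qed.

Lemma er_ec s t a b : er s t *m ec a b = ((s == a) && (t == b))%:R%:M.
Proof.
rewrite /er /ec -mxtens_index_eq; case: eqVneq => [->|ne].
  by rewrite mul_delta_mx; apply/matrixP => i j; rewrite !ord1 !mxE.
by rewrite mul_delta_mx_0 //; apply/matrixP => i j; rewrite !mxE mul0rn.
Qed.

Lemma ecT s t : (ec s t)^T = er s t. Proof. exact: trmx_delta. Qed.
Lemma erT s t : (er s t)^T = ec s t. Proof. exact: trmx_delta. Qed.

Lemma er_flip s t : er s t *m flip_mx F d = er t s.
Proof.
apply/rowP => k; rewrite flip_swap mul_swap /swapix; case: (mxtens_indexP k) => a b.
by rewrite mxtens_indexK /er !mxE !mxtens_index_eq eqxx /= andbC.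
Qed.

Lemma flip_T : (flip_mx F d)^T = flip_mx F d.
Proof.
by apply/matrixP => k l; rewrite !mxE andbC; congr ((_ && _)%:R); apply: eq_sym.
Qed.

Lemma sum_ec_er : \sum_s \sum_t ec s t *m er s t = 1%:M.
Proof.
rewrite pair_big /= [RHS]mx1_sum_delta.
rewrite (reindex (fun p : 'I_d * 'I_d => mxtens_index p)) /=.
  by apply: eq_bigr => -[s t] _; rewrite mul_delta_mx.
exists (fun k => mxtens_unindex k) => k _; first by rewrite mxtens_indexK.
by rewrite mxtens_unindexK.
Qed.

(* For [e = 1] and [e = -1]: symmetric and antisymmetric tensors. *)
Lemma flip_dec m (e : F) (X : 'M_(m, d * d)) : e * e = 1 -> X *m flip_mx F d = e *: X ->
  X = 2%:R^-1 *: (\sum_s \sum_t (X *m ec s t) *m (er s t + e *: er t s)).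
Proof.
move=> ee XF; apply: (scalerI n2); rewrite [RHS]scalerA divff // scale1r.
transitivity (X *m (1%:M + e *: flip_mx F d)).
  by rewrite mulmxDr mulmx1 -scalemxAr XF scalerA ee scale1r -mulr2n -scaler_nat.
rewrite -sum_ec_er -[flip_mx F d]mul1mx -sum_ec_er mulmx_suml scaler_sumr -big_split.
rewrite mulmx_sumr; apply: eq_bigr => s _.
rewrite mulmx_suml scaler_sumr -big_split mulmx_sumr; apply: eq_bigr => t _ /=.
by rewrite -mulmxA er_flip scalemxAr -mulmxDr mulmxA.
Qed.

End TensorBasis.

Section SymmetricPart.
Variables (F : fieldType) (d : nat) (g : 'I_d -> F).
Hypothesis n2 : 2%:R != 0 :> F.
Hypothesis g0 : forall i, g i != 0.
Implicit Types s t a b c o : 'I_d.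
Local Notation er := (@er F d).
Local Notation ec := (@ec F d).

(** The invariant form as a linear functional on the tensor square; [tr_form] is a multiple of
    it. *)
Definition tau_mx : 'cV[F]_(d * d) := \sum_c (g c)^-1 *: ec c c.
(** The tensor dual to that form. In the symmetric square its line complements S' when d is nonzero
    in F. *)
Definition theta_mx : 'rV[F]_(d * d) := \sum_c g c *: er c c.

Definition PU s t a b : 'M[F]_(d * d) := ec s t *m er a b + ec t s *m er b a.
Definition sr s t := er s t + er t s.
Definition sc s t := ec s t + ec t s.
(** A combination of diagonal tensors killed by [tau_mx]; together with the [sr s t] for distinct s
    and t these span S'. *)
Definition kap o c := g c *: er c c - g o *: er o o.
Definition Jmx c o : 'M[F]_d := g o *: delta_mx c o - g c *: delta_mx o c.
Definition leib (X : 'M[F]_d) : 'M[F]_(d * d) := X *t 1%:M + 1%:M *t X.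

Lemma scT s t : (sc s t)^T = sr s t.
Proof. by rewrite /sr -!ecT -linearD. Qed.

Lemma sc_sr s t a b : sc s t *m sr a b = PU s t a b + PU s t b a.
Proof.
rewrite /sc /sr /PU mulmxDl !mulmxDr.
by rewrite [ec t s *m er a b + _]addrC addrACA.
Qed.

Lemma sym_dec m o (X : 'M_(m, d * d)) : X *m flip_mx F d = X -> X *m tau_mx = 0 ->
  X = 2%:R^-1 *: (\sum_s \sum_(t | t != s) (X *m ec s t) *m sr s t)
      + \sum_c (X *m ec c c) *m ((g c)^-1 *: kap o c).
Proof.
move=> XF Xt; have := @flip_dec F d n2 m 1 X (mulr1 1); rewrite scale1r => /(_ XF).
under eq_bigr => s _ do (under eq_bigr => t _ do rewrite scale1r -/(sr s t)).
move=> {1}->; under eq_bigr => s _ do rewrite (bigD1 s) //=.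
rewrite big_split /= scalerDr addrC; congr (_ + _).
transitivity (\sum_c (X *m ec c c) *m er c c).
  rewrite scaler_sumr; apply: eq_bigr => c _.
  by rewrite /sr -mulr2n -scaler_nat -scalemxAr scalerA mulVf // scale1r.
apply/eqP; rewrite -subr_eq0 -sumrB; apply/eqP.
transitivity (X *m tau_mx *m (g o *: er o o)); last by rewrite Xt mul0mx.
rewrite /tau_mx mulmx_sumr mulmx_suml; apply: eq_bigr => c _.
rewrite /kap scalerBr scalerA mulVf // scale1r mulmxBr opprB addrC subrK.
by rewrite -!scalemxAr -scalemxAl !scalerA mulrC.
Qed.

Lemma leibE (X : 'M[F]_d) a b s t : leib X (mxtens_index (a, b)) (mxtens_index (s, t)) =
  X a s * (b == t)%:R + (a == s)%:R * X b t.
Proof. by rewrite /leib mxE !tensmxE !mxE. Qed.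

(** For distinct indices the [PU] never involve the diagonal tensors e_c (x) e_c. This computation
    reaches them from off-diagonal ones. *)
Lemma sr_leib c o : c != o -> sr c o *m leib (Jmx c o) = - 2%:R *: kap o c.
Proof.
move=> co; have oc : o != c by rewrite eq_sym.
apply/rowP => k; case: (mxtens_indexP k) => a b.
rewrite /sr mulmxDl mxE -!rowE [row _ _ _ _]mxE [X in _ + X]mxE !leibE.
rewrite !mxE !mxtens_index_eq.
rewrite !eqxx (negPf co) (negPf oc) /=.
rewrite ![c == _]eq_sym ![o == _]eq_sym.
have ne x : (x == c) && (x == o) = false.
  by apply/negP => /andP[/eqP->]; rewrite (negPf co).
move: (ne a) (ne b); case: (a == c); case: (a == o); case: (b == c); case: (b == o);
  by move=> //= _ _; ring.
Qed.

Variable D : 'M[F]_(d * d) -> Prop.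
Hypothesis D0 : D 0.
Hypothesis DD : forall X Y, D X -> D Y -> D (X + Y).
Hypothesis DZ : forall k X, D X -> D (k *: X).
Hypothesis DP : forall s t a b, s != t -> a != b -> D (PU s t a b).
Hypothesis DJ : forall c o X, c != o -> D X -> D (X *m leib (Jmx c o)).

Lemma D_sum (J : Type) (r : seq J) (P : pred J) (f : J -> 'M_(d * d)) :
  (forall j, P j -> D (f j)) -> D (\sum_(j <- r | P j) f j).
Proof. by move=> h; elim/big_ind: _. Qed.

Lemma D_sc_sr s t a b : s != t -> a != b -> D (sc s t *m sr a b).
Proof. by move=> st ab; rewrite sc_sr; apply: DD; apply: DP; rewrite // eq_sym. Qed.

Lemma D_sc_kap s t o c : s != t -> D (sc s t *m kap o c).
Proof.
move=> st; have [->|co] := eqVneq c o; first by rewrite /kap subrr mulmx0.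
have n2' : - 2%:R != 0 :> F by rewrite oppr_eq0.
have -> : kap o c = (- 2%:R)^-1 *: (sr c o *m leib (Jmx c o)).
  by rewrite sr_leib // scalerA mulVf // scale1r.
by rewrite -scalemxAr mulmxA; apply/DZ/DJ => //; apply: D_sc_sr.
Qed.

Lemma D_sc_row s t (v : 'rV_(d * d)) : s != t ->
  v *m flip_mx F d = v -> v *m tau_mx = 0 -> D (sc s t *m v).
Proof.
move=> st vF vt; rewrite (sym_dec s vF vt) mulmxDr -scalemxAr.
apply: DD.
  apply: DZ; rewrite mulmx_sumr; apply: D_sum => a _; rewrite mulmx_sumr.
  apply: D_sum => b ba; rewrite [v *m _]mx11_scalar mul_scalar_mx -scalemxAr.
  by apply: DZ; apply: D_sc_sr; rewrite // eq_sym.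
rewrite mulmx_sumr; apply: D_sum => c _.
rewrite [v *m _]mx11_scalar mul_scalar_mx -!scalemxAr.
by do 2!apply: DZ; apply: D_sc_kap.
Qed.

End SymmetricPart.

Section FlipInvariant.
Variables (F : fieldType) (d : nat) (g : 'I_d -> F).
Hypothesis n2 : 2%:R != 0 :> F.
Hypothesis g0 : forall i, g i != 0.
Implicit Types s t a b c o : 'I_d.
Variable D : 'M[F]_(d * d) -> Prop.
Hypothesis D0 : D 0.
Hypothesis DD : forall X Y, D X -> D Y -> D (X + Y).
Hypothesis DZ : forall k X, D X -> D (k *: X).
Hypothesis DM : forall X Y, D X -> D Y -> D (X *m Y).
Hypothesis DP : forall s t a b, s != t -> a != b -> D (PU F s t a b).
Hypothesis DJ : forall c o X, c != o ->
  D X -> D (X *m leib (Jmx g c o)) /\ D (leib (Jmx g c o) *m X).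

Lemma leibT (X : 'M[F]_d) : (leib X)^T = leib X^T.
Proof. by rewrite /leib linearD /= !trmx_tens !trmx1. Qed.

Lemma leibZ k (X : 'M[F]_d) : leib (k *: X) = k *: leib X.
Proof. by apply/matrixP => i j; rewrite !mxE; ring. Qed.

(* Transposition replaces the weights by their inverses, up to scalars. *)
Lemma D_col_sr s t (w : 'cV_(d * d)) : s != t ->
  flip_mx F d *m w = w -> theta_mx g *m w = 0 -> D (w *m sr F s t).
Proof.
move=> st Fw tw; pose g' i := (g i)^-1.
have g'0 i : g' i != 0 by rewrite invr_neq0.
have := @D_sc_row F d g' n2 g'0 (fun X => D X^T).
have -> : w *m sr F s t = (sc F s t *m w^T)^T by rewrite trmx_mul trmxK scT.
apply=> //.
- by rewrite trmx0.
- by move=> X Y DX DY; rewrite linearD; apply: DD.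
- by move=> k X DX; rewrite linearZ; apply: DZ.
- move=> s' t' a b st' ab; have := DP ab st'.
  by rewrite /PU linearD /= !trmx_mul !ecT !erT.
- move=> c o X co DX; rewrite trmx_mul leibT.
  have -> : (Jmx g' c o)^T = (- (g c * g o)^-1) *: Jmx g c o.
    apply/matrixP => a b; rewrite !mxE /g'.
    have gc := g0 c; have go := g0 o.
    by case: (a == c); case: (b == o); case: (a == o); case: (b == c) => /=; field; rewrite gc go.
  by rewrite leibZ -scalemxAl; apply: DZ; have [] := DJ co DX.
- by rewrite -{1}flip_T -trmx_mul Fw.
- have -> : tau_mx g' = (theta_mx g)^T.
    rewrite /tau_mx /theta_mx linear_sum /=; apply: eq_bigr => c _.
    by rewrite linearZ /= erT /g' invrK.
  by rewrite -trmx_mul tw trmx0.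
Qed.

(** X is a sum of products w v of a column and a row. Each is half of (w [sr s t]) ([sc s t] v), as
    [sr s t] times [sc s t] is 2 for distinct s and t; in both factors one side is off-diagonal, the
    case already settled. *)
Lemma D_sym (X : 'M_(d * d)) (s t : 'I_d) : s != t ->
  flip_mx F d *m X = X -> X *m flip_mx F d = X ->
  theta_mx g *m X = 0 -> X *m tau_mx g = 0 -> D X.
Proof.
move=> st FX XF tX Xt.
have Dwv (w : 'cV_(d * d)) (v : 'rV_(d * d)) :
    D (w *m sr F s t) -> D (sc F s t *m v) -> D (w *m v).
  move=> Dw Dv; have -> : w *m v = 2%:R^-1 *: (2%:R *: (w *m v)).
    by rewrite scalerA mulVf // scale1r.
  apply: DZ; have -> : 2%:R *: (w *m v) = (w *m sr F s t) *m (sc F s t *m v).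
    rewrite -!mulmxA (mulmxA (sr F s t)) /sr /sc mulmxDl !mulmxDr !er_ec !eqxx.
    rewrite [t == s]eq_sym (negPf st) /= raddf0 addr0 add0r -raddfD /=.
    by rewrite mul_scalar_mx -scalemxAr.
  exact: DM.
have Dw a b : D (X *m ec F a b *m sr F s t).
  by apply: D_col_sr => //; rewrite mulmxA ?FX ?tX ?mul0mx.
have DJ' c o Y co DY := (@DJ c o Y co DY).1.
rewrite (sym_dec n2 g0 s XF Xt); apply: DD.
  apply/DZ/(D_sum D0 DD) => a _; apply/(D_sum D0 DD) => b ba.
  by apply: Dwv => //; apply: (D_sc_sr DD DP) => //; rewrite eq_sym.
apply/(D_sum D0 DD) => c _; rewrite -scalemxAr; apply/DZ/Dwv => //.
exact: (D_sc_kap n2 D0 DD DZ DP DJ').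
Qed.

(** Antisymmetric tensors have no diagonal part, so differences of [PU] span these operators. *)
Lemma D_ext (X : 'M_(d * d)) :
  flip_mx F d *m X = - X -> X *m flip_mx F d = - X -> D X.
Proof.
move=> FX XF; have ee : (-1) * (-1) = 1 :> F by rewrite mulrNN mulr1.
have Dac a b s t : D ((ec F a b - ec F b a) *m (er F s t - er F t s)).
  have [->|st] := eqVneq s t; first by rewrite subrr mulmx0.
  have [->|ab] := eqVneq a b; first by rewrite subrr mul0mx.
  have -> : (ec F a b - ec F b a) *m (er F s t - er F t s) =
      PU F a b s t + (-1) *: PU F a b t s.
    by rewrite /PU mulmxBl !mulmxBr scaleN1r opprB opprD addrACA.
  by apply: DD; [|apply: DZ]; apply: DP; rewrite // eq_sym.
rewrite (@flip_dec F d n2 _ (-1) X ee) ?scaleN1r //; apply: DZ.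
apply/(D_sum D0 DD) => s _; apply/(D_sum D0 DD) => t _; rewrite scaleN1r.
set w := X *m _; rewrite -[w]trmxK (@flip_dec F d n2 _ (-1) w^T ee); last first.
  by rewrite -{1}flip_T -trmx_mul mulmxA FX scaleN1r mulNmx linearN.
rewrite linearZ /= -scalemxAl; apply: DZ; rewrite linear_sum mulmx_suml.
apply/(D_sum D0 DD) => a _; rewrite linear_sum mulmx_suml; apply/(D_sum D0 DD) => b _.
rewrite /= [w^T *m _]mx11_scalar mul_scalar_mx linearZ /= -scalemxAl; apply: DZ.
have -> : (er F a b + (-1) *: er F b a)^T = ec F a b - ec F b a.
  by rewrite scaleN1r -!erT -linearB.
exact: Dac.
Qed.

End FlipInvariant.

(** * Decomposition of a tensor square *)

Section Submodules.
Variables (F : fieldType) (A : falgType F) (V : rmodule A) (mV : is_module V).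
Variables (m : nat) (X : 'M[F]_(m, mdim V)) (sX : is_submod (V := V) X).

Lemma submod_act x : row_base X *m V x = submod (V := V) X x *m row_base X.
Proof.
rewrite /= mulmxKpV // eq_row_base.
by apply: submx_trans (sX x); apply: submxMr; rewrite eq_row_base.
Qed.

Lemma submod_module : is_module (submod (V := V) X).
Proof.
split=> [k x y||x y] /=.
- by rewrite (actD mV) (actZ mV) mulmxDr mulmxDl -scalemxAr -scalemxAl.
- by rewrite (act1 mV) mulmx1 mulmxVp ?row_base_free.
- rewrite -[RHS]/(submod (V := V) X x *m (row_base X *m V y *m pinvmx (row_base X))).
  rewrite (actM mV); move: (submod_act x) => /=; move: (_ *m pinvmx _) => S e.
  by rewrite mulmxA e !mulmxA.
Qed.

Lemma submod_act0 x : V x = 0 -> submod (V := V) X x = 0.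
Proof. by move=> /= ->; rewrite mulmx0 mul0mx. Qed.

End Submodules.

Section TensorSquareModule.
Variables (F : fieldType) (d : nat) (g : 'I_d -> F) (c : F) (tr : 'cV[F]_(d * d)).
Hypothesis n2 : 2%:R != 0 :> F.
Hypothesis g0 : forall i, g i != 0.
Hypothesis d0 : d%:R != 0 :> F.
Hypothesis c0 : c != 0.
Local Notation tau := (tau_mx g).
Local Notation theta := (theta_mx g).
Local Notation fl := (flip_mx F d).
Hypothesis trE : tr = c *: tau.
Let U := (kermx tr :&: sym2 F d)%MS.
Local Notation rs := (row_base U).
Local Notation ra := (row_base (ext2 F d)).

Lemma theta_tau : theta *m tau = d%:R%:M.
Proof.
rewrite /theta_mx /tau_mx mulmx_suml.
transitivity (\sum_(a < d) (1%:M : 'M[F]_1)); last first.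
  by rewrite sumr_const card_ord -scaler_nat scalemx1.
apply: eq_bigr => a _; rewrite mulmx_sumr (bigD1 a) //= big1 => [|b ba].
  by rewrite addr0 -scalemxAl -scalemxAr er_ec !eqxx scalerA mulfV // scale1r.
by rewrite -scalemxAl -scalemxAr er_ec eq_sym (negPf ba) /= raddf0 !scaler0.
Qed.

Lemma theta_flip : theta *m fl = theta.
Proof. by rewrite mulmx_suml; apply: eq_bigr => a _; rewrite -scalemxAl er_flip. Qed.

Lemma flip_tau : fl *m tau = tau.
Proof.
rewrite mulmx_sumr; apply: eq_bigr => a _; rewrite -scalemxAr -[fl *m _]trmxK.
by rewrite trmx_mul flip_T ecT er_flip erT.
Qed.

Lemma flip_flip : fl *m fl = 1%:M.
Proof. by rewrite flip_swap swap_mxK. Qed.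

Lemma sub_Sprime m (X : 'M_(m, _)) :
  (X <= U)%MS = (X *m tau == 0) && (X *m fl == X).
Proof.
rewrite sub_capmx; congr (_ && _).
  by rewrite (sameP sub_kermxP eqP) trE -scalemxAr scaler_eq0 (negPf c0).
by rewrite (sameP sub_kermxP eqP) mulmxBr mulmx1 subr_eq0.
Qed.

Lemma sub_ext2 m (X : 'M_(m, _)) : (X <= ext2 F d)%MS = (X *m fl == - X).
Proof. by rewrite (sameP sub_kermxP eqP) mulmxDr mulmx1 addr_eq0. Qed.

Lemma rsP : rs *m tau = 0 /\ rs *m fl = rs.
Proof.
have : (rs <= U)%MS by rewrite eq_row_base.
by rewrite sub_Sprime => /andP[/eqP-> /eqP->].
Qed.

Lemma raP : ra *m tau = 0 /\ ra *m fl = - ra.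
Proof.
have : (ra <= ext2 F d)%MS by rewrite eq_row_base.
rewrite sub_ext2 => /eqP e; split=> //.
have : ra *m tau = - (ra *m tau) by rewrite -{1}flip_tau mulmxA e mulNmx.
by move/eqP; rewrite -addr_eq0 -mulr2n -scaler_nat scaler_eq0 (negPf n2) => /eqP.
Qed.

(** The projection onto S': symmetrization minus the projection onto the line of [theta_mx], where
    1/d is the normalization from [theta_tau]. [QS] is the same projection in the coordinates of
    [row_base], and [QA] its antisymmetric counterpart. *)
Let PS : 'M[F]_(d * d) := 2%:R^-1 *: (1%:M + fl) - d%:R^-1 *: (tau *m theta).
Let PA : 'M[F]_(d * d) := 2%:R^-1 *: (1%:M - fl).
Let QS := PS *m pinvmx rs.
Let QA := PA *m pinvmx ra.

Let half m (X : 'M[F]_(m, d * d)) : 2%:R^-1 *: (X + X) = X.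
Proof. by rewrite -mulr2n -scaler_nat scalerA mulVf // scale1r. Qed.

Let half' m (X : 'M[F]_(d * d, m)) : 2%:R^-1 *: (X + X) = X.
Proof. by rewrite -mulr2n -scaler_nat scalerA mulVf // scale1r. Qed.

Let PSl m (X : 'M_(m, _)) : X *m PS = 2%:R^-1 *: (X + X *m fl) - d%:R^-1 *: (X *m tau *m theta).
Proof. by rewrite /PS mulmxBr -!scalemxAr mulmxDr mulmx1 mulmxA. Qed.

Let PAl m (X : 'M_(m, _)) : X *m PA = 2%:R^-1 *: (X - X *m fl).
Proof. by rewrite /PA -scalemxAr mulmxBr mulmx1. Qed.

Let flPS : fl *m PS = PS.
Proof. by rewrite PSl flip_flip flip_tau addrC /PS [fl + _]addrC addrC. Qed.

Let flPA : fl *m PA = - PA.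
Proof. by rewrite PAl flip_flip /PA -scalerN opprB. Qed.

Let thPS : theta *m PS = 0.
Proof.
by rewrite PSl theta_flip half theta_tau mul_scalar_mx scalerA mulVf // scale1r subrr.
Qed.

Let thPA : theta *m PA = 0.
Proof. by rewrite PAl theta_flip subrr scaler0. Qed.

Let PSrs : QS *m rs = PS.
Proof.
rewrite mulmxKpV // eq_row_base sub_Sprime; apply/andP; split; apply/eqP.
  rewrite /PS mulmxBl -!scalemxAl mulmxDl mul1mx flip_tau half' -mulmxA theta_tau.
  by rewrite mul_mx_scalar scalerA mulVf // scale1r subrr.
rewrite /PS mulmxBl -!scalemxAl mulmxDl mul1mx flip_flip -mulmxA theta_flip.
by rewrite [fl + _]addrC.
Qed.

Let PAra : QA *m ra = PA.
Proof.
rewrite mulmxKpV // eq_row_base sub_ext2; apply/eqP.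
by rewrite /PA -!scalemxAl mulmxBl mul1mx flip_flip -scalerN opprB.
Qed.

Let flQS : fl *m QS = QS. Proof. by rewrite /QS mulmxA flPS. Qed.
Let flQA : fl *m QA = - QA. Proof. by rewrite /QA mulmxA flPA mulNmx. Qed.
Let thQS : theta *m QS = 0. Proof. by rewrite /QS mulmxA thPS mul0mx. Qed.
Let thQA : theta *m QA = 0. Proof. by rewrite /QA mulmxA thPA mul0mx. Qed.

Let rsV : rs *m pinvmx rs = 1%:M. Proof. by rewrite mulmxVp ?row_base_free. Qed.
Let raV : ra *m pinvmx ra = 1%:M. Proof. by rewrite mulmxVp ?row_base_free. Qed.

Let rsQS : rs *m QS = 1%:M.
Proof.
have [e1 e2] := rsP; rewrite mulmxA PSl e1 e2 half mul0mx scaler0 subr0; exact: rsV.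
Qed.

Let raQA : ra *m QA = 1%:M.
Proof. by have [e1 e2] := raP; rewrite mulmxA PAl e2 opprK half; exact: raV. Qed.

Let rsQA : rs *m QA = 0.
Proof. by have [e1 e2] := rsP; rewrite mulmxA PAl e2 subrr scaler0 mul0mx. Qed.

Let raQS : ra *m QS = 0.
Proof.
by have [e1 e2] := raP; rewrite mulmxA PSl e1 e2 subrr !mul0mx !scaler0 subrr mul0mx.
Qed.

(** The extension of b by zero on the antisymmetric tensors and on the invariant line; the four
    relations are the hypotheses of [D_sym]. *)
Lemma lift_sym (b : 'M_(\rank U)) : exists X : 'M_(d * d),
  [/\ fl *m X = X, X *m fl = X, theta *m X = 0 & X *m tau = 0] /\
  rs *m X *m pinvmx rs = b /\ ra *m X *m pinvmx ra = 0.
Proof.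
have [e1 e2] := rsP; exists (QS *m b *m rs); split.
  split; first by rewrite 2!(mulmxA fl) flQS.
  - by rewrite -mulmxA e2.
  - by rewrite 2!(mulmxA theta) thQS !mul0mx.
  - by rewrite -mulmxA e1 mulmx0.
split; last by rewrite 2!(mulmxA ra) raQS !mul0mx.
by rewrite 2!(mulmxA rs) rsQS mul1mx -mulmxA rsV mulmx1.
Qed.

Lemma lift_ext (b : 'M_(\rank (ext2 F d))) : exists X : 'M_(d * d),
  (fl *m X = - X /\ X *m fl = - X) /\
  ra *m X *m pinvmx ra = b /\ rs *m X *m pinvmx rs = 0.
Proof.
have [e1 e2] := raP; exists (QA *m b *m ra); split.
  by split; [rewrite 2!(mulmxA fl) flQA !mulNmx|rewrite -mulmxA e2 mulmxN].
split; last by rewrite 2!(mulmxA rs) rsQA !mul0mx.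
by rewrite 2!(mulmxA ra) raQA mul1mx -mulmxA raV mulmx1.
Qed.

Variables (A : falgType F) (rho : A -> 'M[F]_(d * d)) (eps : A -> F).
Hypothesis rho_fl : forall x, rho x *m fl = fl *m rho x.
Hypothesis rho_theta : forall x, theta *m rho x = eps x *: theta.
Hypothesis rho_tau : forall x, rho x *m tau = eps x *: tau.
Let W := RModule rho.

Lemma submod_Sprime : is_submod (V := W) U.
Proof.
move=> x; have : (U <= U)%MS by [].
rewrite {2}/U !sub_Sprime /= => /andP[/eqP e1 /eqP e2]; apply/andP; split; apply/eqP.
  by rewrite -mulmxA rho_tau -scalemxAr e1 scaler0.
by rewrite -mulmxA rho_fl mulmxA e2.
Qed.

Lemma submod_ext2 : is_submod (V := W) (ext2 F d).
Proof.
move=> x; have : (ext2 F d <= ext2 F d)%MS by [].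
rewrite !sub_ext2 /= => /eqP e; apply/eqP.
by rewrite -mulmxA rho_fl mulmxA e mulNmx.
Qed.

Lemma tensor_square_iso : mod_iso W
  (dsum (dsum (submod (V := W) U) (submod (V := W) (ext2 F d)))
        (RModule (fun x => (eps x)%:M : 'M_1))).
Proof.
(* P collects the coordinates along the three summands and N their basis vectors, so that P and N
   are mutually inverse. *)
pose P : 'M_(d * d, (\rank U + \rank (ext2 F d)) + 1) :=
  row_mx (row_mx QS QA) (d%:R^-1 *: tau).
pose N : 'M_((\rank U + \rank (ext2 F d)) + 1, d * d) := col_mx (col_mx rs ra) theta.
have [a1 a2] := rsP; have [b1 b2] := raP.
have PN : P *m N = 1%:M.
  rewrite /P /N !mul_row_col PSrs PAra /PS /PA -scalemxAl.
  rewrite addrAC subrK -scalerDr addrACA subrr addr0.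
  exact: half.
have NP : N *m P = 1%:M.
  rewrite /P /N mul_col_row mul_col_row mul_mx_row rsQS rsQA raQS raQA.
  rewrite thQS thQA row_mx0.
  rewrite -!scalemxAr mul_col_mx a1 b1 col_mx0 scaler0 theta_tau.
  by rewrite scale_scalar_mx mulVf // -!scalar_mx_block.
have WN x : N *m rho x =
    dsum (dsum (submod (V := W) U) (submod (V := W) (ext2 F d)))
        (RModule (fun x => (eps x)%:M : 'M_1)) x *m N.
  rewrite -[RHS]/(block_mx (block_mx (submod (V := W) U x) 0 0
    (submod (V := W) (ext2 F d) x)) 0 0 (eps x)%:M *m col_mx (col_mx rs ra) theta).
  rewrite !mul_block_col !mul0mx !addr0 !add0r.
  rewrite /N !mul_col_mx rho_theta (submod_act submod_Sprime) (submod_act submod_ext2).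
  by rewrite mul_scalar_mx.
exists P; split; first by apply/row_freeP; exists N.
  by apply/row_fullP; exists N.
move=> x; rewrite -[LHS]mul1mx -PN -!mulmxA; congr (P *m _).
by rewrite mulmxA WN -mulmxA NP mulmx1.
Qed.

End TensorSquareModule.

(** * The nonstandard Temperley-Lieb algebra *)

Section TwoRowShapes.
Variable n : nat.

Lemma SYT_ex lam : part2 n.+1 lam -> exists o : 'I_#|SYT n lam|, True.
Proof.
move=> pl; have [a ak ha] := shape_word pl; have [o _] := wdl_surj pl ak ha.
by exists o.
Qed.

(** At positive height the last entry can lie in either row. At height 0 it must lie in the second
    row, and then the entry before it can lie in either. *)
Lemma SYT_two lam : part2' n.+1 lam -> exists s t : 'I_#|SYT n lam|, s != t.
Proof.
rewrite /part2' => /and3P[pl sz ones].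
suff [a [b [ak bk ha hb ab]]] : exists a b,
    [/\ a \in Om n.+1, b \in Om n.+1, ht a = hl lam, ht b = hl lam & a != b].
  have [s sa] := wdl_surj pl ak ha; have [t tb] := wdl_surj pl bk hb.
  by exists s, t; apply: contraNneq ab => e; rewrite -sa -tb e.
have [h1 h2 _] := part2_facts pl; have [lE _] := part2_lam pl.
have l2p : (0 < l2 lam)%N.
  by rewrite lt0n; apply: contraNneq sz => z; rewrite lE z.
have l1p : (1 < l1 lam)%N.
  rewrite ltnNge; apply: contraNN ones => h.
  have e1 : l1 lam = 1%N by clear -h h1 l2p; lia.
  have e2 : l2 lam = 1%N by clear -h h1 l2p; lia.
  by rewrite lE e2 /= -h2 e1 e2.
have on : odd n = ~~ odd (hl lam).
  by rewrite -[odd n]negbK -[~~ odd n]/(odd n.+1) -h2 oddD /hl oddB //; case: odd; case: odd.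
have [h|h] := posnP (hl lam).
  case en : n on => [|m] on; first by clear -en h1 h2 l2p l1p; lia.
  have om : odd m = false by apply: negb_inj; rewrite -[~~ _]/(odd m.+1) on h.
  have [||w wk hw] := @ex_word m 2; [|by rewrite om|].
    by clear -en h1 h2 l1p l2p h om; rewrite /hl in h; lia.
  have [||w' wk' hw'] := @ex_word m 0; [by []|by rewrite om|].
  exists [:: true, true & w], [:: true, false & w'].
  by rewrite !Om1 !Om0 ?wk ?wk' /= hw hw' h.
have [||w wk hw] := @ex_word n (hl lam).+1.
- by rewrite /hl; clear -h1 h2 l2p; lia.
- by rewrite on.
have [||w' wk' hw'] := @ex_word n (hl lam).-1.
- by rewrite /hl; clear -h1 h2 l2p; lia.
- by rewrite on; case: (hl lam) h => //= m _; rewrite negbK.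
exists (true :: w), (false :: w').
by rewrite Om1 Om0 wk wk' /= hw hw' prednK.
Qed.

Lemma SYT_one lam : part2 n.+1 lam -> ~~ part2' n.+1 lam -> #|SYT n lam| = 1%N.
Proof.
move=> pl np; have [o _] := SYT_ex pl.
suff all_eq (s t : 'I_#|SYT n lam|) : s = t.
  case: #|SYT n lam| o all_eq => [[] //|[|m]] // _ all_eq.
  by have := all_eq ord0 ord_max.
apply: (wdl_inj pl); have [sk tk] := (wdl_Om pl s, wdl_Om pl t).
have [sh th] := (wdl_ht pl s, wdl_ht pl t).
move: (wdl s) (wdl t) sk tk sh th => a b ak bk ah bh.
have [h1 h2 _] := part2_facts pl; have [lE _] := part2_lam pl.
move: np; rewrite /part2' pl /= negb_and !negbK => /orP[/eqP sz|ones].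
  have hE : hl lam = n.+1.
    by move: sz; rewrite /hl -h2 {1}lE; case: (l2 lam) => // _; rewrite subn0 addn0.
  by rewrite (ht_max ak) ?ah // (ht_max bk) ?bh.
move: ones; rewrite {1}lE; case El: (l2 lam) => [|k] /=.
  rewrite andbT => /eqP [nE]; rewrite nE in ak bk.
  by case: a b ak bk {ah bh} => [|[] [|? ?]] [|[] [|? ?]].
rewrite andbT => /andP[/eqP e1 /eqP e2].
have nE : n = 1%N by clear -e1 e2; lia.
have hE : hl lam = 0%N by rewrite /hl; clear -h2 El e2 nE; lia.
rewrite hE in ah bh; rewrite nE in ak bk.
by case: a b ak bk ah bh => [|[] [|[] [|? ?]]] [|[] [|[] [|? ?]]].
Qed.

End TwoRowShapes.

Fact nsgen_involution (F : fieldType) (A : falgType F) (q : F) (x : A)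
    (r := (q + q^-1)^-1 *: (2%:R *: x - (q - q^-1)%:A)) :
  q != 0 -> q + q^-1 != 0 -> 2%:R != 0 :> F ->
  tens (x + q^-1%:A) (x + q^-1%:A) + tens (x - q%:A) (x - q%:A) =
  (2%:R^-1 * (q + q^-1) ^+ 2) *: (1 + tens r r).
Proof.
move=> q0 q1 n2; pose h := 2%:R^-1 * (q + q^-1).
have hr : h *: r = 2%:R^-1 *: (2%:R *: x - (q - q^-1)%:A) by rewrite scalerA /h mulfK.
have e1 : x + q^-1%:A = h *: (1 + r).
  by rewrite scalerDr hr /h; linear_over F; rewrite /=; field; rewrite ?q0 ?n2.
have e2 : x - q%:A = h *: (r - 1).
  by rewrite scalerBr hr /h; linear_over F; rewrite /=; field; rewrite ?q0 ?n2.
clear hr; clearbody r; rewrite e1 e2 -!tens_lr !linearZ /= !(rmorphD, rmorphN, rmorph1) /=.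
rewrite !(alg_expand (tens_alg A A), alg_scale).
by linear_over F; rewrite /= /h; field; rewrite ?n2 ?q0.
Qed.

(** A self-adjoint involution is orthogonal, so its tensor square fixes both the form and the dual
    tensor. *)
Lemma tens_form (F : fieldType) d (g : 'I_d -> F) (S : 'M[F]_d) :
    (forall i, g i != 0) -> S *m S = 1%:M ->
    (forall a b, S b a * g b = g a * S a b) ->
  theta_mx g *m (S *t S) = theta_mx g /\ (S *t S) *m tau_mx g = tau_mx g.
Proof.
move=> g0 SS hS.
have SSE a b : \sum_c S a c * S c b = (a == b)%:R.
  by have /matrixP/(_ a b) := SS; rewrite !mxE.
split.
  apply/rowP => k; case: (mxtens_indexP k) => a b.
  rewrite /theta_mx mulmx_suml !summxE.
  transitivity (g a * \sum_c S a c * S c b).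
    rewrite mulr_sumr; apply: eq_bigr => c _; rewrite -scalemxAl mxE -rowE mxE tensmxE.
    by rewrite !mulrA -hS [g c * _]mulrC.
  rewrite SSE (bigD1 a) //= big1 => [|c ca].
    by rewrite addr0 !mxE mxtens_index_eq !eqxx /= [b == a]eq_sym.
  by rewrite !mxE mxtens_index_eq [a == c]eq_sym (negPf ca) /= mulr0.
apply/colP => k; case: (mxtens_indexP k) => a b.
rewrite /tau_mx mulmx_sumr !summxE.
transitivity ((\sum_c S a c * S c b) / g b).
  rewrite mulr_suml; apply: eq_bigr => c _; rewrite -scalemxAr mxE -colE mxE tensmxE.
  have e : S b c = S c b * g c / g b by rewrite hS mulrC mulKf.
  by rewrite e; field; rewrite !g0.
rewrite SSE (bigD1 b) //= big1 => [|c cb].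
  by rewrite addr0 !mxE mxtens_index_eq !eqxx /= !andbT mulrC.
by rewrite !mxE mxtens_index_eq [b == c]eq_sym (negPf cb) andbF mulr0.
Qed.

Lemma tens_delta (F : fieldType) d e (s a : 'I_d) (t b : 'I_e) :
  (delta_mx s a : 'M[F]_d) *t (delta_mx t b : 'M[F]_e) =
  delta_mx (mxtens_index (s, t)) (mxtens_index (a, b)).
Proof.
apply/matrixP => k l; case: (mxtens_indexP k) => k1 k2; case: (mxtens_indexP l) => l1 l2.
rewrite tensmxE !mxE -natrM mulnb !(can_eq (@mxtens_indexK d e)) !xpair_eqE.
by congr (nat_of_bool _)%:R; rewrite -!andbA; congr (_ && _); rewrite andbCA.
Qed.

Lemma scale_scalar_mx11 (F : fieldType) (a b : F) : b != 0 ->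
  (a *: (b%:M : 'M_1)) 0 0 / b = a.
Proof. by move=> b0; rewrite !mxE mulr1n mulfK. Qed.

Lemma tau_mxE (F : fieldType) d (g : 'I_d -> F) (s b : 'I_d) :
  tau_mx g (mxtens_index (s, b)) 0 = (s == b)%:R / g s.
Proof.
rewrite /tau_mx summxE (bigD1 s) //= big1 => [|c cs].
  by rewrite addr0 !mxE mxtens_index_eq !eqxx /= andbT [b == s]eq_sym mulrC.
by rewrite !mxE mxtens_index_eq [s == c]eq_sym (negPf cs) mulr0.
Qed.

Lemma flat_mx_eq (F : fieldType) m k (X Y : 'M[F]_(m, k)) : m = 0%N -> X = Y.
Proof. by move=> m0; apply/matrixP => -[i lt]; exfalso; rewrite m0 in lt. Qed.

Lemma rank_pos (F : fieldType) m k (X : 'M[F]_(m, k)) (v : 'rV_k) :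
  (v <= X)%MS -> v != 0 -> (0 < \rank X)%N.
Proof.
move=> vX; rewrite lt0n mxrank_eq0; apply: contraNneq => z; move: vX.
by rewrite z => /submx0null ->.
Qed.

Lemma er_swap_neq0 (F : fieldType) d (s b : 'I_d) (e : F) : s != b ->
  er F s b + e *: er F b s != 0.
Proof.
move=> st; apply/eqP => /rowP/(_ (mxtens_index (s, b))).
rewrite !mxE !mxtens_index_eq !eqxx [b == s]eq_sym (negPf st) /= mulr0 addr0.
by apply/eqP; apply: oner_neq0.
Qed.

Lemma er_swap_tau (F : fieldType) d (g : 'I_d -> F) (s b : 'I_d) (e : F) : s != b ->
  (er F s b + e *: er F b s) *m tau_mx g = 0.
Proof.
move=> st; apply/rowP => k; rewrite ord1 mulmxDl -scalemxAl -!rowE.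
have rE (a c : 'I_d) : row (mxtens_index (a, c)) (tau_mx g) 0 0 = (a == c)%:R / g a.
  by rewrite mxE tau_mxE.
by rewrite mxE [X in _ + X]mxE !rE [b == s]eq_sym (negPf st) !mul0r mulr0 addr0 mxE.
Qed.

(** * The list of irreducible modules *)

Section Labels.
Variable n : nat.

(** The criterion for products of matrix algebras needs a finite index type, so a shape is encoded
    by the length of its second row; [index_ok] discards what is not an admissible label. *)
Definition irr_index : Type := ('I_n.+2 * 'I_n.+2 + ('I_n.+2 + ('I_n.+2 + unit)))%type.
HB.instance Definition _ := Finite.on irr_index.

Definition index_label (x : irr_index) : label :=
  match x with
  | inl (b, c) => Mixed (lam_of n b) (lam_of n c)
  | inr (inl b) => Defs.Sym (lam_of n b)
  | inr (inr (inl b)) => Ext (lam_of n b)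
  | inr (inr (inr _)) => Eps
  end.

(* Of the two labels of an unordered pair only one is listed. *)
Definition index_ok (x : irr_index) : bool :=
  label_ok n (index_label x) && (if x is inl (b, c) then (b < c)%N else true).

Lemma lam_of_inj (b c : 'I_n.+2) : lam_of n b = lam_of n c -> b = c.
Proof.
have l2E k : l2 (lam_of n k) = k by case: k.
by move=> /(congr1 l2); rewrite !l2E => /val_inj.
Qed.

Lemma index_inj x y : index_ok x -> index_ok y ->
  same_label (index_label x) (index_label y) -> x = y.
Proof.
case: x y => [[b c]|[b|[b|[]]]] [[b' c']|[b'|[b'|[]]]] //= /andP[_ okx] /andP[_ oky];
  case=> [e|[lam [mu [e e']]]] //; try by case: e.
- by case: e => /lam_of_inj -> /lam_of_inj ->.
- case: e e' => <- <- [/lam_of_inj e1 /lam_of_inj e2].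
  by move: okx oky; rewrite e1 e2 => /ltnW; rewrite leqNgt => /negP.
- by case: e => /lam_of_inj ->.
- by case: e => /lam_of_inj ->.
Qed.

Lemma index_surj lb : label_ok n lb ->
  exists2 x, index_ok x & same_label (index_label x) lb.
Proof.
have ex lam : part2 n.+1 lam -> exists b : 'I_n.+2, lam_of n b = lam.
  move=> /part2_lam [e h]; have lt : (l2 lam < n.+2)%N by clear -h; lia.
  by exists (Ordinal lt).
case: lb => [lam mu ok|lam ok|lam ok|_].
- case/and3P: (ok) => pl pm lm; have [b bE] := ex _ pl; have [c cE] := ex _ pm.
  have [bc|cb|e] := ltngtP b c.
  + by exists (inl (b, c)); [rewrite /index_ok /= bE cE bc andbT|left; rewrite /= bE cE].
  + exists (inl (c, b)); first by rewrite /index_ok /= bE cE cb andbT eq_sym pl pm lm.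
    by right; exists mu, lam; rewrite /= bE cE.
  + by case/eqP: lm; rewrite -bE -cE e.
- have [b bE] := ex _ (let: And3 h _ _ := and3P ok in h).
  by exists (inr (inl b)); [rewrite /index_ok /= bE andbT|left; rewrite /= bE].
- have [b bE] := ex _ (let: And3 h _ _ := and3P ok in h).
  by exists (inr (inr (inl b))); [rewrite /index_ok /= bE andbT|left; rewrite /= bE].
- by exists (inr (inr (inr tt))); last left.
Qed.

Lemma same_label_sym lb lb' : same_label lb lb' -> same_label lb' lb.
Proof. by case=> [->|[lam [mu [-> ->]]]]; [left|right; exists mu, lam]. Qed.

Lemma same_label_trans lb1 lb2 lb3 :
  same_label lb1 lb2 -> same_label lb2 lb3 -> same_label lb1 lb3.
Proof.
case=> [->|[lam [mu [-> ->]]]] //; case=> [<-|[lam' [mu' [[-> ->] ->]]]]; last by left.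
by right; exists lam, mu.
Qed.

End Labels.

(** * The nonstandard algebra as a product of matrix algebras *)

Section NonstandardAlgebra.
Variables (n : nat) (H2 : falgType K) (t : 'I_n -> H2).
Variable M : forall lam : seq nat, H2 -> 'M[K]_#|SYT n lam|.
Variable E : word -> word -> H2.
Let V (lam : seq nat) := RModule (M lam).
Hypothesis mV : forall lam, part2 n.+1 lam -> is_module (V lam).
Hypothesis uE : units n.+1 E.
Hypothesis RE : forall i : 'I_n, hinv (t i) = Rat coefsK (n - i.+1) E n.+1.
Hypothesis ME : forall a b, a \in Om n.+1 -> b \in Om n.+1 -> ht a = ht b -> forall lam,
  part2 n.+1 lam -> forall i j, M lam (E a b) i j = ((wdl i == a) && (wdl j == b))%:R.
Hypothesis spanE : forall x, exists k : word * word -> K,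
  x = \sum_(p <- Om2 n.+1) k p *: E p.1 p.2.
Hypothesis symR : forall lam, part2 n.+1 lam -> forall i,
  (M lam (hinv (t i)))^T *m gdiag n lam = gdiag n lam *m M lam (hinv (t i)).
Hypothesis R2 : forall i, hinv (t i) * hinv (t i) = 1.

Let n2K : 2%:R != 0 :> K := natK_neq0 1.

Lemma nsgenE i : nsgen t i =
  (2%:R^-1 * (u + u^-1) ^+ 2) *: (1 + tens (hinv (t i)) (hinv (t i))).
Proof. exact: nsgen_involution u_neq0 uV_neq0 n2K. Qed.

Lemma nsTL_subalgebra : subalgebra (fun x => x \in nsTL t).
Proof.
split=> [|x y|x y|k x]; first by rewrite memvE sub1_agenv.
- exact: memvD.
- exact: memvM.
- exact: memvZ.
Qed.

Lemma nsTL_gen i : nsgen t i \in nsTL t.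
Proof. by apply/(subvP (sub_agenv _))/memv_span/map_f; rewrite mem_enum. Qed.

Lemma nsTL_ind (P : tens_alg H2 H2 -> Prop) : subalgebra P ->
  (forall i, P (nsgen t i)) -> forall x, x \in nsTL t -> P x.
Proof.
move=> sP Pg x /nsTLP [s [sI ->]]; elim: s sI => [|y s IH] sI.
  by rewrite big_nil; apply: subalg0.
rewrite big_cons; apply: (subalgD sP); last first.
  by apply: IH => z zs; apply: sI; rewrite inE zs orbT.
apply: (subalgZ sP); have := sI y (mem_head _ _).
elim=> [i||? ? _ ? _ ?|? ? _ ? _ ?|? ? _ _ ?] //.
- exact: (subalg1 sP).
- exact: (subalgD sP).
- exact: (subalgM sP).
- exact: (subalgZ sP).
Qed.

Lemma nsTL_hinv i : tens (hinv (t i)) (hinv (t i)) \in nsTL t.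
Proof.
have c0 : 2%:R^-1 * (u + u^-1) ^+ 2 != 0.
  by apply: mulf_neq0; [exact: (invr_neq0 n2K)|exact: (expf_neq0 2 uV_neq0)].
have := nsTL_gen i; rewrite nsgenE => /(subalgZK nsTL_subalgebra c0) h.
rewrite -[tens _ _](addKr 1); apply: (subalgD nsTL_subalgebra) => //.
by apply: (subalgN nsTL_subalgebra); apply: (subalg1 nsTL_subalgebra).
Qed.

Local Notation l := (tens_lm H2).
Local Notation r := (tens_rm H2).

Lemma nsTL_tsq :
  (forall a, a \in Om n.+1 -> tsq l r (sgn E a) \in nsTL t) /\
  (forall a b, a \in Om n.+1 -> b \in Om n.+1 -> ht a = ht b ->
    l (Jab coefsK E a b) + r (Jab coefsK E a b) \in nsTL t).
Proof.
apply: (tensor_square_generation (@tens_comm _ H2) nsTL_subalgebra uE) => m mn.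
have im : (n - m.+1 < n)%N by clear -mn; lia.
have mE : (n - (n - m.+1).+1 = m)%N by clear -mn; lia.
have := RE (Ordinal im); rewrite /= mE => <-.
by rewrite /tsq tens_lr; apply: nsTL_hinv.
Qed.

Lemma nsTL_pairU a b d e : a \in Om n.+1 -> b \in Om n.+1 -> d \in Om n.+1 ->
  e \in Om n.+1 -> ht a = ht d -> ht b = ht e -> a != b -> d != e ->
  pairU l r E a b d e \in nsTL t.
Proof.
have [h1 h2] := nsTL_tsq.
exact: (pairU_in (@tens_comm _ H2) nsTL_subalgebra uE h1 h2).
Qed.

Definition rho lam mu (x : tens_alg H2 H2) : 'M[K]_(#|SYT n lam| * #|SYT n mu|) :=
  tens_mod (V lam) (V mu) x.

Section Rho.
Variables lam mu : seq nat.
Hypotheses (pl : part2 n.+1 lam) (pm : part2 n.+1 mu).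
Let mT := tens_mod_module (mV pl) (mV pm).

Lemma rhoD x y : rho lam mu (x + y) = rho lam mu x + rho lam mu y.
Proof. exact: (actD mT). Qed.
Lemma rhoZ k x : rho lam mu (k *: x) = k *: rho lam mu x.
Proof. exact: (actZ mT). Qed.
Lemma rhoM x y : rho lam mu (x * y) = rho lam mu x *m rho lam mu y.
Proof. exact: (actM mT). Qed.
Lemma rho1 : rho lam mu 1 = 1%:M.
Proof. exact: (act1 mT). Qed.
Lemma rho0 : rho lam mu 0 = 0.
Proof. exact: (act0 mT). Qed.
Lemma rho_sum (J : Type) (s : seq J) (P : pred J) f :
  rho lam mu (\sum_(j <- s | P j) f j) = \sum_(j <- s | P j) rho lam mu (f j).
Proof. exact: (act_sum mT). Qed.
Lemma rho_tens a b : rho lam mu (tens a b) = M lam a *t M mu b.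
Proof. exact: (tens_modE (mV pl) (mV pm)). Qed.

Lemma rho_pairU a b d e : rho lam mu (pairU l r E a b d e) =
  M lam (E a d) *t M mu (E b e) + M lam (E b e) *t M mu (E a d).
Proof. by rewrite /pairU !tens_lr rhoD !rho_tens. Qed.

End Rho.

Lemma unit_act lam (i j : 'I_#|SYT n lam|) : part2 n.+1 lam ->
  M lam (E (wdl i) (wdl j)) = delta_mx i j.
Proof.
move=> pl; apply/matrixP => a b; rewrite ME ?(wdl_Om pl) ?(wdl_ht pl) // mxE.
by rewrite !(inj_eq (wdl_inj pl)).
Qed.

Lemma unit_act0 lam mu (i j : 'I_#|SYT n mu|) : part2 n.+1 lam -> part2 n.+1 mu ->
  lam != mu -> M lam (E (wdl i) (wdl j)) = 0.
Proof.
move=> pl pm lm; apply/matrixP => a b; rewrite ME ?(wdl_Om pm) ?(wdl_ht pm) // mxE.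
case: (eqVneq (wdl a) (wdl i)) => // e; case/eqP: lm; apply: (part2_inj pl pm).
by rewrite -(wdl_ht pl a) e (wdl_ht pm).
Qed.

(** X is realized by an element of the algebra acting by 0 on all other products. The pair (mu, lam)
    is exempt, since the flip makes its action equivalent to that on (lam, mu). *)
Definition lifts lam mu (X : 'M[K]_(#|SYT n lam| * #|SYT n mu|)) : Prop :=
  exists2 x, x \in nsTL t & rho lam mu x = X /\
    forall nu nu', part2 n.+1 nu -> part2 n.+1 nu' ->
      (nu, nu') != (lam, mu) -> (nu, nu') != (mu, lam) -> rho nu nu' x = 0.

Section Lifts.
Variables lam mu : seq nat.
Hypotheses (pl : part2 n.+1 lam) (pm : part2 n.+1 mu).
Local Notation lifts := (@lifts lam mu).

Lemma lifts0 : lifts 0.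
Proof.
exists 0; first exact: (subalg0 nsTL_subalgebra).
by split=> [|nu nu' p p' _ _]; apply: rho0.
Qed.

Lemma liftsD X Y : lifts X -> lifts Y -> lifts (X + Y).
Proof.
move=> [x xA [xX x0]] [y yA [yY y0]]; exists (x + y).
  exact: (subalgD nsTL_subalgebra).
split=> [|nu nu' p p' e e']; first by rewrite rhoD // xX yY.
by rewrite rhoD // x0 // y0 // addr0.
Qed.

Lemma liftsZ k X : lifts X -> lifts (k *: X).
Proof.
move=> [x xA [xX x0]]; exists (k *: x); first exact: (subalgZ nsTL_subalgebra).
split=> [|nu nu' p p' e e']; first by rewrite rhoZ // xX.
by rewrite rhoZ // x0 // scaler0.
Qed.

Lemma lifts_mul X y : lifts X -> y \in nsTL t ->
  lifts (X *m rho lam mu y) /\ lifts (rho lam mu y *m X).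
Proof.
move=> [x xA [xX x0]] yA; split.
  exists (x * y); first exact: (subalgM nsTL_subalgebra).
  split=> [|nu nu' p p' e e']; first by rewrite rhoM // xX.
  by rewrite rhoM // x0 // mul0mx.
exists (y * x); first exact: (subalgM nsTL_subalgebra).
split=> [|nu nu' p p' e e']; first by rewrite rhoM // xX.
by rewrite rhoM // x0 // mulmx0.
Qed.

Lemma liftsM X Y : lifts X -> lifts Y -> lifts (X *m Y).
Proof. by move=> LX [y yA [<- _]]; apply: (lifts_mul LX yA).1. Qed.

Lemma lifts_pairU (s a : 'I_#|SYT n lam|) (t' b : 'I_#|SYT n mu|) :
  wdl s != wdl t' -> wdl a != wdl b ->
  lifts (delta_mx s a *t delta_mx t' b
         + M lam (E (wdl t') (wdl b)) *t M mu (E (wdl s) (wdl a))).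
Proof.
move=> st ab; exists (pairU l r E (wdl s) (wdl t') (wdl a) (wdl b)).
  apply: nsTL_pairU; rewrite ?(wdl_Om pl) ?(wdl_Om pm) //.
    by rewrite !(wdl_ht pl).
  by rewrite !(wdl_ht pm).
split=> [|nu nu' p p' e e']; rewrite rho_pairU //; first by rewrite !unit_act.
have -> : M nu (E (wdl s) (wdl a)) *t M nu' (E (wdl t') (wdl b)) = 0.
  have [nl|nl] := eqVneq nu lam; last by rewrite (unit_act0 _ _ p pl nl) tens0mx.
  have nm : nu' != mu by apply: contraNneq e => nm; rewrite nl nm.
  by rewrite (unit_act0 _ _ p' pm nm) tensmx0.
rewrite add0r; have [nl|nl] := eqVneq nu mu; last by rewrite (unit_act0 _ _ p pm nl) tens0mx.
have nm : nu' != lam by apply: contraNneq e' => nm; rewrite nl nm.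
by rewrite (unit_act0 _ _ p' pl nm) tensmx0.
Qed.

End Lifts.

(** Words of different shapes are always distinct, and on M_lam (x) M_mu the flipped term of [pairU]
    acts by 0; so every matrix unit is obtained. *)
Lemma lifts_mixed lam mu X : part2 n.+1 lam -> part2 n.+1 mu -> lam != mu ->
  @lifts lam mu X.
Proof.
move=> pl pm lm; rewrite [X]matrix_sum_delta.
elim/big_ind: _ => [|? ? ? ?|k _]; [exact: lifts0|exact: liftsD|].
elim/big_ind: _ => [|? ? ? ?|k' _]; [exact: lifts0|exact: liftsD|].
apply: liftsZ => //; case: (mxtens_indexP k) => s t'; case: (mxtens_indexP k') => a b.
have ne (i : 'I_#|SYT n lam|) (j : 'I_#|SYT n mu|) : wdl i != wdl j.
  apply: contraNneq lm => e; apply/eqP/(part2_inj pl pm).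
  by rewrite -(wdl_ht pl i) e (wdl_ht pm).
have := lifts_pairU pl pm (ne s t') (ne a b).
by rewrite (unit_act0 _ _ pl pm lm) tens0mx addr0 tens_delta.
Qed.

Definition gl lam (a : 'I_#|SYT n lam|) : K := gam coefsK (wdl a).

Section Square.
Variable lam : seq nat.
Hypothesis pl : part2 n.+1 lam.

Lemma gl_neq0 (a : 'I_#|SYT n lam|) : gl a != 0.
Proof. exact: (gam_neq0 coefsK (wdl_Om pl a)). Qed.

Lemma lifts_PU (s t' a b : 'I_#|SYT n lam|) : s != t' -> a != b ->
  @lifts lam lam (PU K s t' a b).
Proof.
move=> st ab; have := @lifts_pairU lam lam pl pl s a t' b.
rewrite !(inj_eq (wdl_inj pl)) => /(_ st ab).
by rewrite !unit_act // /PU /ec /er !mul_delta_mx !tens_delta.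
Qed.

Lemma lifts_leib (c o : 'I_#|SYT n lam|) X : c != o -> @lifts lam lam X ->
  @lifts lam lam (X *m leib (Jmx (@gl lam) c o)) /\
  @lifts lam lam (leib (Jmx (@gl lam) c o) *m X).
Proof.
move=> co LX; have hE : ht (wdl c) = ht (wdl o) by rewrite !(wdl_ht pl).
have JA := nsTL_tsq.2 _ _ (wdl_Om pl c) (wdl_Om pl o) hE.
have <- : rho lam lam (l (Jab coefsK E (wdl c) (wdl o)) + r (Jab coefsK E (wdl c) (wdl o)))
    = leib (Jmx (@gl lam) c o).
  rewrite /= rhoD // !rho_tens // -[M lam 1]/(V lam 1) (act1 (mV pl)).
  have -> // : M lam (Jab coefsK E (wdl c) (wdl o)) = Jmx (@gl lam) c o.
  rewrite -[M lam _]/(V lam _) /Jab (actD (mV pl)) -scaleN1r !(actZ (mV pl)) scaleN1r.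
  by rewrite /V /= !unit_act.
exact: (lifts_mul pl pl LX JA).
Qed.

Lemma lifts_sym X : part2' n.+1 lam ->
  flip_mx K _ *m X = X -> X *m flip_mx K _ = X ->
  theta_mx (@gl lam) *m X = 0 -> X *m tau_mx (@gl lam) = 0 -> @lifts lam lam X.
Proof.
move=> /SYT_two [s [t' st]].
exact: (D_sym n2K gl_neq0 (lifts0 pl pl) (liftsD pl pl) (liftsZ pl pl)
  (liftsM pl pl) lifts_PU lifts_leib st).
Qed.

Lemma lifts_ext X : flip_mx K _ *m X = - X -> X *m flip_mx K _ = - X -> @lifts lam lam X.
Proof.
exact: (D_ext n2K (lifts0 pl pl) (liftsD pl pl) (liftsZ pl pl) lifts_PU).
Qed.

Lemma hinv_sym i (a b : 'I_#|SYT n lam|) :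
  M lam (hinv (t i)) b a * gl b = gl a * M lam (hinv (t i)) a b.
Proof.
have /matrixP/(_ a b) := symR pl i.
by rewrite mul_mx_diag mul_diag_mx !mxE.
Qed.

Lemma hinv_mx_sq i : M lam (hinv (t i)) *m M lam (hinv (t i)) = 1%:M.
Proof. by rewrite -[LHS](actM (mV pl)) R2 (act1 (mV pl)). Qed.

End Square.

Lemma hinv_form lam i : part2 n.+1 lam ->
  theta_mx (@gl lam) *m rho lam lam (nsgen t i) = (u + u^-1) ^+ 2 *: theta_mx (@gl lam) /\
  rho lam lam (nsgen t i) *m tau_mx (@gl lam) = (u + u^-1) ^+ 2 *: tau_mx (@gl lam).
Proof.
move=> pl; have cc : 2%:R^-1 * (u + u^-1) ^+ 2 * 2%:R = (u + u^-1) ^+ 2.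
  by rewrite mulrC mulrA divff // mul1r.
have [e1 e2] := tens_form (gl_neq0 pl) (hinv_mx_sq pl i) (hinv_sym pl i).
rewrite nsgenE rhoZ // rhoD // rho1 // rho_tens // -scalemxAr -scalemxAl.
rewrite mulmxDr mulmxDl e1 e2 mulmx1 mul1mx -!mulr2n -!scaler_nat !scalerA.
by rewrite cc.
Qed.

(** The scalar is independent of lam: the invariant lines of all the squares carry the same
    character. *)
Lemma nsTL_form x : x \in nsTL t -> exists e, forall lam, part2 n.+1 lam ->
  theta_mx (@gl lam) *m rho lam lam x = e *: theta_mx (@gl lam) /\
  rho lam lam x *m tau_mx (@gl lam) = e *: tau_mx (@gl lam).
Proof.
move: x; apply: nsTL_ind => [|i]; last by exists ((u + u^-1) ^+ 2) => lam pl; apply: hinv_form.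
split=> [|x y [e he] [f hf]|x y [e he] [f hf]|k x [e he]].
- by exists 1 => lam pl; rewrite rho1 // mulmx1 mul1mx !scale1r.
- exists (e + f) => lam pl; have [e1 e2] := he _ pl; have [f1 f2] := hf _ pl.
  by rewrite rhoD // mulmxDr mulmxDl e1 e2 f1 f2 !scalerDl.
- exists (e * f) => lam pl; have [e1 e2] := he _ pl; have [f1 f2] := hf _ pl.
  rewrite rhoM // mulmxA e1 -scalemxAl f1 -mulmxA f2 -scalemxAr e2 !scalerA.
  by rewrite [f * e]mulrC.
- exists (k * e) => lam pl; have [e1 e2] := he _ pl.
  by rewrite rhoZ // -scalemxAr -scalemxAl e1 e2 !scalerA.
Qed.

Lemma SYT_neq0 lam : part2 n.+1 lam -> #|SYT n lam|%:R != 0 :> K.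
Proof.
move=> /SYT_ex [o _]; case: #|SYT n lam| o => [o|m _]; last exact: (natK_neq0 m).
by exfalso; case: o.
Qed.

Definition row_shape := [:: n.+1].

Lemma part2_row : part2 n.+1 row_shape.
Proof. by have /andP[] := @part2_lam_of n 0 isT. Qed.

(** A total function which on the nonstandard algebra is the character eps_+, read off on the square
    of the row shape; the denominator is the value of [theta_tau]. *)
Definition ns_eps (x : tens_alg H2 H2) : K :=
  (theta_mx (@gl row_shape) *m rho row_shape row_shape x *m tau_mx (@gl row_shape)) 0 0
  / #|SYT n row_shape|%:R.

Lemma ns_eps_eq x e :
  theta_mx (@gl row_shape) *m rho row_shape row_shape x = e *: theta_mx (@gl row_shape) ->
  ns_eps x = e.
Proof.
move=> e1; rewrite /ns_eps e1 -scalemxAl.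
rewrite (theta_tau (gl_neq0 part2_row)); apply: scale_scalar_mx11.
exact: (SYT_neq0 part2_row).
Qed.

Lemma ns_epsE x lam : x \in nsTL t -> part2 n.+1 lam ->
  theta_mx (@gl lam) *m rho lam lam x = ns_eps x *: theta_mx (@gl lam) /\
  rho lam lam x *m tau_mx (@gl lam) = ns_eps x *: tau_mx (@gl lam).
Proof.
move=> xA pl; have [e he] := nsTL_form xA; rewrite (_ : ns_eps x = e); first exact: he.
have [e1 _] := he _ part2_row; exact: ns_eps_eq.
Qed.

Lemma nsTL_swap x lam mu : x \in nsTL t -> part2 n.+1 lam -> part2 n.+1 mu ->
  rho lam mu x *m swap_mx K #|SYT n lam| #|SYT n mu|
  = swap_mx K #|SYT n lam| #|SYT n mu| *m rho mu lam x.
Proof.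
move=> xA; move: lam mu; apply: (nsTL_ind (P := fun x => forall lam mu,
  part2 n.+1 lam -> part2 n.+1 mu -> rho lam mu x *m swap_mx K _ _ =
  swap_mx K _ _ *m rho mu lam x) _ _ xA) => [|i lam mu pl pm].
  split=> [|y z hy hz|y z hy hz|k y hy] lam mu pl pm.
  - by rewrite !rho1 // mulmx1 mul1mx.
  - by rewrite !rhoD // mulmxDl mulmxDr hy // hz.
  - by rewrite !rhoM // -mulmxA hz // mulmxA hy // mulmxA.
  - by rewrite !rhoZ // -scalemxAl -scalemxAr hy.
rewrite nsgenE !rhoZ // !rhoD // !rho1 // !rho_tens // -scalemxAl -scalemxAr.
by rewrite mulmxDl mulmxDr mulmx1 mul1mx tens_swap.
Qed.

Lemma tens_span (y : tens_alg H2 H2) : exists k : word * word -> word * word -> K,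
  y = \sum_(p <- Om2 n.+1) \sum_(q <- Om2 n.+1) k p q *: tens (E p.1 p.2) (E q.1 q.2).
Proof.
elim/tens_ind: y => [|k x y [kx ->] [ky ->]|a b].
- exists (fun _ _ => 0); rewrite big1 // => p _; rewrite big1 // => q _.
  by rewrite scale0r.
- exists (fun p q => k * kx p q + ky p q); rewrite scaler_sumr -big_split.
  apply: eq_bigr => p _; rewrite scaler_sumr -big_split; apply: eq_bigr => q _ /=.
  by rewrite scalerDl scalerA.
have [ka ->] := spanE a; have [kb ->] := spanE b.
exists (fun p q => ka p * kb q); rewrite -tens_lr !linear_sum /= big_distrlr /=.
apply: eq_bigr => p _; apply: eq_bigr => q _.
by rewrite !linearZ /= -!scalerAl -!scalerAr scalerA tens_lr.
Qed.

Lemma rho_faithful y : (forall lam mu, part2 n.+1 lam -> part2 n.+1 mu ->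
  rho lam mu y = 0) -> y = 0.
Proof.
have [k ->] := tens_span y => z; rewrite big_seq big1 // => p pO.
rewrite big_seq big1 // => q qO; rewrite (_ : k p q = 0) ?scale0r //.
case: p q pO qO => [a b] [d e]; rewrite !mem_Om2 => /and3P[ak bk /eqP ab] /and3P[dk ek /eqP de].
have [lam pl hl1] := ht_lam ak; have [mu pm hm] := ht_lam dk.
have [i iE] := wdl_surj pl ak (esym hl1).
have [j jE] := wdl_surj pl bk (etrans (esym ab) (esym hl1)).
have [i' iE'] := wdl_surj pm dk (esym hm).
have [j' jE'] := wdl_surj pm ek (etrans (esym de) (esym hm)).
have entry p q : p \in Om2 n.+1 -> q \in Om2 n.+1 ->
    rho lam mu (tens (E p.1 p.2) (E q.1 q.2)) (mxtens_index (i, i')) (mxtens_index (j, j'))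
    = ((p == (a, b)) && (q == (d, e)))%:R.
  case: p q => [a' b'] [d' e']; rewrite !mem_Om2 => /and3P[? ? /eqP ?] /and3P[? ? /eqP ?].
  rewrite rho_tens // tensmxE !ME // iE jE iE' jE' -natrM mulnb !xpair_eqE.
  by rewrite ![a == _]eq_sym ![b == _]eq_sym ![d == _]eq_sym ![e == _]eq_sym.
have abO : (a, b) \in Om2 n.+1 by rewrite mem_Om2 ak bk ab eqxx.
have deO : (d, e) \in Om2 n.+1 by rewrite mem_Om2 dk ek de eqxx.
have /matrixP/(_ (mxtens_index (i, i')) (mxtens_index (j, j'))) := z _ _ pl pm.
rewrite rho_sum // summxE (bigD1_seq (a, b)) ?Om2_uniq //= [X in _ + X]big_seq_cond.
rewrite [X in _ + X]big1 => [|p /andP[pO pab]]; last first.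
  rewrite rho_sum // summxE big_seq big1 // => q qO.
  by rewrite rhoZ // mxE entry // (negPf pab) mulr0.
rewrite addr0 rho_sum // summxE (bigD1_seq (d, e)) ?Om2_uniq //= [X in _ + X]big_seq_cond.
rewrite [X in _ + X]big1 => [|q /andP[qO qde]]; last first.
  by rewrite rhoZ // mxE (entry (a, b)) // (negPf qde) andbF mulr0.
by rewrite addr0 rhoZ // mxE (entry (a, b) (d, e)) // !eqxx mulr1 mxE.
Qed.

Variable Phi : forall lam : seq nat, 'M[K]_#|SYT n lam|.
Hypothesis PhiE : forall lam, part2 n.+1 lam -> exists2 c, c != 0 &
  forall i j, Phi lam i j = (i == j)%:R * (c / gam coefsK (wdl i)).
Local Notation A := (subvs_of (nsTL t)).

Lemma vsval_one : vsval (1 : A) = 1.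
Proof.
by rewrite -[vsval 1]/(algid (nsTL t)); apply/eqP; rewrite algid_eq1 (subalg1 nsTL_subalgebra).
Qed.

Definition Eps_mod : rmodule A := RModule (fun x : A => (ns_eps (vsval x))%:M : 'M_1).

Lemma Eps_module : is_module Eps_mod.
Proof.
have pr := part2_row; have h (x : A) := (ns_epsE (subvsP x) pr).1.
split=> [k x y||x y].
- rewrite -[Eps_mod _]/((ns_eps (k *: vsval x + vsval y))%:M : 'M_1).
  rewrite (@ns_eps_eq _ (k * ns_eps (vsval x) + ns_eps (vsval y))).
    by rewrite raddfD /= -scale_scalar_mx.
  by rewrite rhoD // rhoZ // mulmxDr -scalemxAr !h scalerDl scalerA.
- rewrite -[Eps_mod 1]/((ns_eps (vsval (1 : A)))%:M : 'M_1) vsval_one.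
  by rewrite (@ns_eps_eq _ 1) // rho1 // mulmx1 scale1r.
- rewrite -[Eps_mod _]/((ns_eps (vsval x * vsval y))%:M : 'M_1).
  rewrite (@ns_eps_eq _ (ns_eps (vsval x) * ns_eps (vsval y))); first exact: scalar_mxM.
  by rewrite rhoM // mulmxA h -scalemxAl h scalerA.
Qed.

Lemma Eps_plus : is_eps_plus Eps_mod.
Proof.
split=> [||i] //; first exact: Eps_module.
rewrite -[LHS]/((ns_eps (vsval (nsP t i)))%:M : 'M_1) vsprojK ?nsTL_gen //.
rewrite (@ns_eps_eq _ ((u + u^-1) ^+ 2)) //.
exact: (hinv_form i part2_row).1.
Qed.

Lemma tr_formE lam : part2 n.+1 lam ->
  exists2 c, c != 0 & tr_form V Phi lam = c *: tau_mx (@gl lam).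
Proof.
move=> /PhiE [c c0 cE]; exists c => //; apply/colP => k.
case: (mxtens_indexP k) => a b; rewrite mxE mxtens_indexK /= cE [RHS]mxE tau_mxE.
by rewrite /gl; case: eqVneq => [->|_]; rewrite ?mul1r // !mul0r mulr0.
Qed.

Let flipE lam (x : A) : part2 n.+1 lam ->
  rho lam lam (vsval x) *m flip_mx K _ = flip_mx K _ *m rho lam lam (vsval x).
Proof. by move=> pl; exact: (nsTL_swap (subvsP x) pl pl). Qed.

Lemma Sprime_submod lam : part2 n.+1 lam ->
  is_submod (V := Mtens t V lam lam) (Sprime_space V Phi lam).
Proof.
move=> pl; have [c c0 cE] := tr_formE pl.
exact: (submod_Sprime c0 cE (fun x => flipE x pl) (fun x : A => (ns_epsE (subvsP x) pl).2)).
Qed.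

Lemma ext2_submod lam : part2 n.+1 lam ->
  is_submod (V := Mtens t V lam lam) (ext2 K (mdim (V lam))).
Proof. by move=> pl; exact: (submod_ext2 (fun x => flipE x pl)). Qed.

Lemma square_iso lam : part2 n.+1 lam -> mod_iso (Mtens t V lam lam)
  (dsum (dsum (Sprime t V Phi lam) (Ext2 t V lam)) Eps_mod).
Proof.
move=> pl; have [c c0 cE] := tr_formE pl.
exact: (tensor_square_iso n2K (gl_neq0 pl) (SYT_neq0 pl) c0 cE (fun x => flipE x pl)
  (fun x : A => (ns_epsE (subvsP x) pl).1) (fun x : A => (ns_epsE (subvsP x) pl).2)).
Qed.

Lemma square_dim1 lam : part2 n.+1 lam -> mdim (V lam) = 1%N ->
  mdim (Sprime t V Phi lam) = 0%N /\ mdim (Ext2 t V lam) = 0%N.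
Proof.
move=> pl d1; have := mod_iso_dim (square_iso pl).
rewrite -[LHS]/(mdim (V lam) * mdim (V lam))%N d1.
rewrite -[RHS]/(mdim (Sprime t V Phi lam) + mdim (Ext2 t V lam) + 1)%N.
by move: (mdim _) (mdim _) => p q; clear; lia.
Qed.

Lemma Mtens_module lam mu : part2 n.+1 lam -> part2 n.+1 mu -> is_module (Mtens t V lam mu).
Proof.
move=> pl pm; split=> [k x y||x y].
- by rewrite -[LHS]/(rho lam mu (k *: vsval x + vsval y)) rhoD // rhoZ.
- by rewrite -[LHS]/(rho lam mu (vsval (1 : A))) vsval_one rho1.
- by rewrite -[LHS]/(rho lam mu (vsval x * vsval y)) rhoM.
Qed.

Local Notation irr := (ns_irr t V Phi Eps_mod).

Lemma part2'_part2 lam : part2' n.+1 lam -> part2 n.+1 lam.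
Proof. by case/and3P. Qed.

Lemma irr_module lb : label_ok n lb -> is_module (irr lb).
Proof.
case: lb => [lam mu /and3P[pl pm _]|lam /part2'_part2 pl|lam /part2'_part2 pl|_].
- exact: Mtens_module.
- exact: (submod_module (Mtens_module pl pl) (Sprime_submod pl)).
- exact: (submod_module (Mtens_module pl pl) (ext2_submod pl)).
- exact: Eps_module.
Qed.

Lemma irr_pos lb : label_ok n lb -> (0 < mdim (irr lb))%N.
Proof.
have pos lam : part2 n.+1 lam -> (0 < #|SYT n lam|)%N by move=> /SYT_ex [[]]; case: #|_|.
case: lb => [lam mu /and3P[pl pm _]|lam p'|lam p'|_] //.
- by rewrite /= muln_gt0 !pos.
- have pl := part2'_part2 p'; have [c c0 cE] := tr_formE pl.
  have [s [t' st]] := SYT_two p'; apply: (@rank_pos _ _ _ _ (er K s t' + 1 *: er K t' s)).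
    rewrite (sub_Sprime c0 cE); apply/andP; split; apply/eqP.
      exact: er_swap_tau.
    by rewrite scale1r mulmxDl !er_flip addrC.
  exact: er_swap_neq0.
- have [s [t' st]] := SYT_two p'; apply: (@rank_pos _ _ _ _ (er K s t' + (-1) *: er K t' s)).
    rewrite sub_ext2 scaleN1r mulmxBl !er_flip opprB; exact: eqxx.
  exact: er_swap_neq0.
Qed.

(** The tensor product from which the irreducible module is cut out; for [Eps] it is the square on
    which [ns_eps] is computed. *)
Definition label_pair (lb : label) : seq nat * seq nat :=
  match lb with
  | Mixed lam mu => (lam, mu)
  | Defs.Sym lam | Ext lam => (lam, lam)
  | Eps => (row_shape, row_shape)
  end.

Lemma irr_vanish lb (x : A) :
  rho (label_pair lb).1 (label_pair lb).2 (vsval x) = 0 -> irr lb x = 0.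
Proof.
case: lb => [lam mu|lam|lam|] z; rewrite /= in z.
- exact: z.
- exact: (@submod_act0 _ _ (Mtens t V lam lam) _ (Sprime_space V Phi lam) x z).
- exact: (@submod_act0 _ _ (Mtens t V lam lam) _ (ext2 K (mdim (V lam))) x z).
- by rewrite /= /ns_eps z mulmx0 mul0mx mxE mul0r raddf0.
Qed.

(** [Eps] is excluded because the operators lifted on a square kill the invariant line; its block is
    found by complement in [W_surj]. *)
Lemma irr_lift lb (b : 'M_(mdim (irr lb))) : label_ok n lb -> lb <> Eps ->
  exists2 x : A, irr lb x = b &
    forall lb', label_ok n lb' -> ~ same_label lb lb' -> irr lb' x = 0.
Proof.
case: lb b => [lam mu|lam|lam|] b //.
- case/and3P=> pl pm lm _; have [y yA [yb y0]] := lifts_mixed b pl pm lm.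
  exists (Subvs yA) => [//|lb' ok' ns]; apply: irr_vanish.
  case: lb' ok' ns => [nu nu' /and3P[p p' _] ns|nu /part2'_part2 p _|nu /part2'_part2 p _|_ _];
    rewrite /=; apply: y0 => //; try exact: part2_row.
  + by apply: contra_notN ns => /eqP[-> ->]; left.
  + by apply: contra_notN ns => /eqP[-> ->]; right; exists lam, mu.
  + by apply: contraNneq lm => -[<- <-].
  + by apply: contraNneq lm => -[<- <-].
  + by apply: contraNneq lm => -[<- <-].
  + by apply: contraNneq lm => -[<- <-].
  + by apply: contraNneq lm => -[<- <-].
  + by apply: contraNneq lm => -[<- <-].
- move=> p' _; have pl := part2'_part2 p'; have [c c0 cE] := tr_formE pl.
  have [X [[X1 X2 X3 X4] [Xb X0]]] := lift_sym n2K (gl_neq0 pl) (SYT_neq0 pl) c0 cE b.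
  have [y yA [yX y0]] := lifts_sym pl p' X1 X2 X3 X4.
  have {}y0 nu nu' : part2 n.+1 nu -> part2 n.+1 nu' -> (nu, nu') != (lam, lam) ->
    rho nu nu' y = 0 by move=> p q e; apply: y0.
  exists (Subvs yA); first by rewrite -[RHS]Xb -yX.
  case=> [nu nu' /and3P[p q ne] _|nu q' ns|nu q' ns|_ _].
  + apply: irr_vanish; apply: y0 => //=.
    by apply: contraNneq ne => -[-> ->].
  + apply: irr_vanish; have q := part2'_part2 q'; apply: y0 => //=.
    by apply: contra_notN ns => /eqP[->]; left.
  + have q := part2'_part2 q'; have [e|ne] := eqVneq nu lam.
      by rewrite e -[RHS]X0 -yX.
    by apply: irr_vanish; apply: y0 => //=; rewrite xpair_eqE negb_and ne.
  (* [Eps] is evaluated on the row shape, which differs from lam because lam satisfies [part2']. *)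
  + apply: irr_vanish; apply: y0 => //=; try exact: part2_row.
    by apply: contraTneq p' => -[<-]; rewrite /= /part2' /= andbF.
- move=> p' _; have pl := part2'_part2 p'; have [c c0 cE] := tr_formE pl.
  have [X [[X1 X2] [Xb X0]]] := lift_ext n2K c0 cE b.
  have [y yA [yX y0]] := lifts_ext pl X1 X2.
  have {}y0 nu nu' : part2 n.+1 nu -> part2 n.+1 nu' -> (nu, nu') != (lam, lam) ->
    rho nu nu' y = 0 by move=> p q e; apply: y0.
  exists (Subvs yA); first by rewrite -[RHS]Xb -yX.
  case=> [nu nu' /and3P[p q ne] _|nu q' ns|nu q' ns|_ _].
  + apply: irr_vanish; apply: y0 => //=.
    by apply: contraNneq ne => -[-> ->].
  + have q := part2'_part2 q'; have [e|ne] := eqVneq nu lam.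
      by rewrite e -[RHS]X0 -yX.
    by apply: irr_vanish; apply: y0 => //=; rewrite xpair_eqE negb_and ne.
  + apply: irr_vanish; have q := part2'_part2 q'; apply: y0 => //=.
    by apply: contra_notN ns => /eqP[->]; left.
  + apply: irr_vanish; apply: y0 => //=; try exact: part2_row.
    by apply: contraTneq p' => -[<-]; rewrite /= /part2' /= andbF.
Qed.

Lemma Mtens_swap lam mu : part2 n.+1 lam -> part2 n.+1 mu ->
  mod_iso (Mtens t V lam mu) (Mtens t V mu lam).
Proof.
move=> pl pm; exists (swap_mx K #|SYT n lam| #|SYT n mu|); split.
- by apply/row_freeP; exists (swap_mx K #|SYT n mu| #|SYT n lam|); apply: swap_mxK.
- by apply/row_fullP; exists (swap_mx K #|SYT n mu| #|SYT n lam|); apply: swap_mxK.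
- by move=> x; apply: (nsTL_swap (subvsP x) pl pm).
Qed.

Lemma irr_same_label lb lb' : label_ok n lb -> same_label lb lb' -> mod_iso (irr lb) (irr lb').
Proof.
move=> ok [<-|[lam [mu [e ->]]]]; first exact: mod_iso_refl.
by move: ok; rewrite e => /and3P[pl pm _]; apply: Mtens_swap.
Qed.

Local Notation I := {x : irr_index n | index_ok x}.
Let W (i : I) := irr (index_label (val i)).

Let okW (i : I) : label_ok n (index_label (val i)).
Proof. by have /andP[] := valP i. Qed.

Let mW i : is_module (W i). Proof. exact: irr_module (okW i). Qed.
Let dW i : (0 < mdim (W i))%N. Proof. exact: irr_pos (okW i). Qed.

Let W_inj x : (forall i, W i x = 0) -> x = 0.
Proof.
move=> z; have {}z lb : label_ok n lb -> irr lb x = 0.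
  move=> ok; have [y oky s] := index_surj ok.
  have := z (exist _ y oky); apply: mod_iso0.
  by apply: irr_same_label => //; apply: same_label_sym.
apply: val_inj; apply: rho_faithful => lam mu pl pm.
have [e|lm] := eqVneq lam mu; last first.
  by apply: (z (Mixed lam mu)); rewrite /= pl pm lm.
rewrite -e -[LHS]/(Mtens t V lam lam x); apply: (mod_iso0 (square_iso pl)).
(* Outside [part2'] the two modules are not in the list, but they have dimension 0. *)
have zS : Sprime t V Phi lam x = 0 /\ Ext2 t V lam x = 0.
  case p' : (part2' n.+1 lam); first by split; [apply: (z (Defs.Sym lam))|apply: (z (Ext lam))].
  have [d1 d2] := square_dim1 pl (SYT_one pl (negbT p')).
  by split; [exact: (flat_mx_eq _ _ d1)|exact: (flat_mx_eq _ _ d2)].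
have zE : Eps_mod x = 0 by apply: (z Eps).
rewrite -[LHS]/(block_mx (block_mx (Sprime t V Phi lam x) 0 0 (Ext2 t V lam x)) 0 0
  (Eps_mod x)) zS.1 zS.2 zE.
by rewrite !block_mx0.
Qed.

Let W_surj i (b : 'M_(mdim (W i))) :
  exists2 x, W i x = b & forall j, j != i -> W j x = 0.
Proof.
have lift (j : I) (c : 'M_(mdim (W j))) : index_label (val j) <> Eps ->
    exists2 x, W j x = c & forall k, k != j -> W k x = 0.
  move=> ne; have [x xc x0] := irr_lift c (okW j) ne; exists x => // k kj.
  apply: x0; first exact: okW.
  move=> s; case/eqP: kj; apply: val_inj; apply: index_inj (valP k) (valP j) _.
  exact: same_label_sym.
have [e|ne] : index_label (val i) = Eps \/ index_label (val i) <> Eps.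
  by case: (index_label _); [right|right|right|left].
  2: exact: lift.
(* [z j] acts as the identity on block j and by 0 on the others, so 1 minus the sum of these is the
   identity of the block of [Eps]. The index i itself receives a dummy value. *)
have ex j : exists x : A, j != i -> W j x = 1%:M /\ forall k, k != j -> W k x = 0.
  have [ji|ji] := eqVneq j i; first by exists 0.
  have ne : index_label (val j) <> Eps.
    move=> ej; case/eqP: ji; apply: val_inj; apply: index_inj (valP j) (valP i) _.
    by left; rewrite ej e.
  by have [x x1 x0] := lift j 1%:M ne; exists x.
have [z hz] := fin_all_exists ex.
have [c cE] : exists c, b = c%:M.
  have d1 : mdim (W i) = 1%N by rewrite /W e.
  by move: b; rewrite d1 => b; exists (b 0 0); apply: mx11_scalar.
have act1B j (y : A) : W j (1 - y) = 1%:M - W j y.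
  by rewrite actD // -scaleN1r actZ // act1 // scaleN1r.
exists (c *: (1 - \sum_(j | j != i) z j)) => [|j ji]; rewrite actZ // act1B act_sum //.
  rewrite big1 => [|j ji]; last by have [_ ->] := hz j ji; rewrite // eq_sym.
  by rewrite subr0 scalemx1.
rewrite (bigD1 j) //= big1 => [|k /andP[ki kj]].
  by rewrite addr0 (hz j ji).1 subrr scaler0.
by have [_ ->] := hz k ki; rewrite // eq_sym.
Qed.

Theorem nsTL_structure : split_semisimple A /\
  [/\ forall lb, label_ok n lb -> mod_irr (irr lb),
      forall X, mod_irr X -> exists2 lb, label_ok n lb & mod_iso X (irr lb)
    & forall lb lb', label_ok n lb -> label_ok n lb' ->
        (mod_iso (irr lb) (irr lb') <-> same_label lb lb')].
Proof.
split; first exact: (product_split_semisimple mW dW W_inj W_surj).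
split=> [lb ok|X iX|lb lb' ok ok'].
- have [x okx s] := index_surj ok.
  have iso : mod_iso (irr lb) (W (exist _ x okx)).
    by apply: irr_same_label => //; apply: same_label_sym.
  exact: (mod_irr_iso (irr_module ok) iso (product_irr mW dW W_surj _)).
- have [i iso] := product_complete mW W_inj W_surj iX.
  by exists (index_label (val i)).
- split; last exact: irr_same_label.
  move=> iso; have [x okx s] := index_surj ok; have [y oky s'] := index_surj ok'.
  have isox : mod_iso (W (exist _ x okx)) (irr lb) by apply: irr_same_label => //; case/andP: okx.
  have isoy : mod_iso (irr lb') (W (exist _ y oky)).
    by apply: irr_same_label => //; apply: same_label_sym.
  have := product_iso_inj dW W_surj (mod_iso_trans (mod_iso_trans isox iso) isoy).
  case=> xy; apply: same_label_trans (same_label_sym s) _.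
  by rewrite xy.
Qed.

End NonstandardAlgebra.

Theorem theorem5p1 (n : nat)
    (H : falgType K) (T : 'S_n.+1 -> H) (C : 'S_n.+1 -> H)
    (H2 : falgType K) (pi : 'AHom(H, H2))
    (M : forall lam : seq nat, H2 -> 'M[K]_#|SYT n lam|)
    (Phi : forall lam : seq nat, 'M[K]_#|SYT n lam|) :
  let t (i : 'I_n) := pi (T (simple i)) in
  let V (lam : seq nat) := RModule (M lam) in
  let irr := ns_irr t V Phi in
  is_hecke T ->
  (forall w, is_kl T w (C w)) ->
  limg pi = fullv ->
  lker pi = <<[seq C w | w <- enum 'S_n.+1 & (2 < size (rsk_P w))%N]>>%VS ->
  (forall lam, part2 n.+1 lam ->
     is_module (V lam) /\ forall i, M lam (t i) = seminormal lam i) ->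
  (forall lam, part2 n.+1 lam ->
     @mod_iso_by _ _ (pullback pi (V lam)) (dual T (pullback pi (V lam)))
       (Phi lam)) ->
  split_semisimple (subvs_of (nsTL t)) /\
  (forall lam, part2 n.+1 lam ->
     is_submod (V := Mtens t V lam lam) (Sprime_space V Phi lam) /\
     is_submod (V := Mtens t V lam lam) (ext2 K (mdim (V lam)))) /\
  exists E : rmodule (subvs_of (nsTL t)), is_eps_plus E /\
  [/\ forall l, label_ok n l -> mod_irr (irr E l),
      forall W, mod_irr W -> exists2 l, label_ok n l & mod_iso W (irr E l),
      forall l l', label_ok n l -> label_ok n l' ->
        (mod_iso (irr E l) (irr E l') <-> same_label l l'),
      forall lam mu, part2 n.+1 lam -> part2 n.+1 mu -> lam != mu ->
        mod_iso (nsres t (tens_mod (V lam) (V mu))) (irr E (Mixed lam mu))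
    & forall lam, part2 n.+1 lam ->
        mod_iso (nsres t (tens_mod (V lam) (V lam)))
          (dsum (dsum (Sprime t V Phi lam) (Ext2 t V lam)) E) /\
        (mdim (V lam) = 1%N ->
         mdim (Sprime t V Phi lam) = 0%N /\ mdim (Ext2 t V lam) = 0%N)].
Proof.
move=> t V irr hT hC spi kpi hM hPhi.
have [E [uE RE ME spanE PhiE]] := TL_units hT hC spi kpi hM hPhi.
have mV lam : part2 n.+1 lam -> is_module (V lam) by move=> /hM[].
have symR lam : part2 n.+1 lam -> forall i,
    (M lam (hinv (t i)))^T *m gdiag n lam = gdiag n lam *m M lam (hinv (t i)).
  by move=> pl i; exact: (hinv_gdiag hM pl i).
have R2 i : hinv (t i) * hinv (t i) = 1 by exact: (hinv_sq pi hT i).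
have [ss [Hirr Hall Hiso]] := nsTL_structure mV uE RE ME spanE symR R2 PhiE.
split; first exact: ss.
split=> [lam pl|].
  split; first exact: (Sprime_submod mV symR R2 PhiE pl).
  exact: (ext2_submod mV pl).
exists (Eps_mod t M); split; first exact: (Eps_plus mV symR R2).
split=> //.
- by move=> lam mu pl pm lm; apply: mod_iso_refl.
- move=> lam pl; split; first exact: (square_iso mV symR R2 PhiE pl).
  exact: (square_dim1 mV symR R2 PhiE pl).
Qed.
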